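(* For every $\varepsilon > 0$ there exist a smooth, convex, bounded domain $X \subset \mathbb{R}^2$ and a bounded domain $Y \subset \mathbb{R}^2$ with $|X| = |Y|$, such that $Y$ is an $\varepsilon$-small Lipschitz perturbation of $X$ and the optimal transport taking $X$ to $Y$ is discontinuous.
   Context: A domain is a (bounded) connected open set; $|E|$ denotes Lebesgue measure and $\mathbf{1}_E$ the indicator function of $E$. Optimal transport: for bounded open sets $X, Y \subset \mathbb{R}^n$ with $|X| = |Y|$, the optimal transport taking $X$ to $Y$ is the ($\mathrm{a.e.}$ unique) map $T$ minimizing $\int_X |x - T(x)|^2 \, dx$ among all measurable maps satisfying $T_{\#}(\mathbf{1}_X\,dx) = \mathbf{1}_Y\,dy$. By Brenier's theorem it exists and has the form $T = \nabla u$ a.e. in $X$ with $u : \mathbb{R}^n \to \mathbb{R}$ convex. ''$T$ is discontinuous'' means that no continuous map on $X$ agrees with $T$ a.e. in $X$. $\varepsilon$-small Lipschitz perturbation: $Y$ is an $\varepsilon$-small Lipschitz perturbation of $X$ if there is a bi-Lipschitz homeomorphism $\Phi : \overline{X} \to \overline{Y}$ with $\Phi(X)=Y$ and $\|\Phi - \mathrm{Id}\|_{L^\infty(X)} + \mathrm{Lip}(\Phi - \mathrm{Id}) \le \varepsilon$, where $\mathrm{Lip}$ denotes the best Lipschitz constant on $\overline{X}$. *)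

(* Defs.v *)
From HB Require Import structures.
From mathcomp Require Import all_boot all_order all_algebra.
From mathcomp Require Import all_classical all_reals all_analysis.

Set Implicit Arguments.
Unset Strict Implicit.
Unset Printing Implicit Defensive.

Import Order.TTheory GRing.Theory Num.Theory.
Import numFieldNormedType.Exports.

Local Open Scope classical_set_scope.
Local Open Scope ring_scope.

Section Plane.
Context {R : realType}.
Implicit Types (x y e : R * R) (A B X Y : set (R * R)) (f S T Phi : R * R -> R * R).

(* The library norm on R * R is the max norm; it induces the right topology and
   bounded sets, but lengths and Lipschitz constants must be Euclidean. *)
Definition dot x y : R := x.1 * y.1 + x.2 * y.2.

Definition enorm x : R := Num.sqrt (dot x x).

Definition perp e : R * R := (- e.2, e.1).

(* lebesgue_measure lives on measurableTypeR R, which is convertible to R but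
   carries its own canonical Borel sigma-algebra instance. *)
Local Notation mplane := (measurableTypeR R * measurableTypeR R)%type.

Definition area : {measure set mplane -> \bar R} :=
  (@lebesgue_measure R \x @lebesgue_measure R)%E.

Definition bounded_domain X : Prop :=
  [/\ open X, connected X & bounded_set X].

Definition smooth_fun (g : R -> R) : Prop :=
  forall (n : nat) (t : R), derivable (derive1n n g) t 1.

(* Near each boundary point, in the orthonormal frame (e, perp e), the set is
   the strict epigraph of a C^oo function. *)
Definition smooth_boundary X : Prop :=
  forall p, (closure X `\` X^°) p ->
    exists (e : R * R) (g : R -> R) (r : R),
      [/\ enorm e = 1, smooth_fun g, 0 < r &
          forall x, enorm (x - p) < r -> X x <-> g (dot e x) < dot (perp e) x].

(* Lip is valued in \bar R, and is +oo when f is not Lipschitz on A. *)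
Definition Lip A f : \bar R :=
  ereal_inf [set k%:E | k in [set k : R | 0 <= k /\
    forall x y, A x -> A y -> enorm (f x - f y) <= k * enorm (x - y)]].

(* Such a bijection is automatically a homeomorphism of A onto B. *)
Definition bilipschitz_homeo A B f : Prop :=
  set_bij A B f /\
  exists2 L : R, 0 < L & forall x y, A x -> A y ->
    L^-1 * enorm (x - y) <= enorm (f x - f y) <= L * enorm (x - y).

Definition Linfty_norm X f : \bar R :=
  ('N[area]_+oo [(fun x => (enorm (f x))%:E) \_ X])%E.

Definition small_lipschitz_perturbation (eps : R) X Y : Prop :=
  exists Phi : R * R -> R * R,
    [/\ bilipschitz_homeo (closure X) (closure Y) Phi,
        Phi @` X = Y &
        (Linfty_norm X (Phi \- id)%R + Lip (closure X) (Phi \- id)%R <= eps%:E)%E].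

(* T_#(1_X dx) = 1_Y dy; the values of T outside X are irrelevant. *)
Definition transport_map X Y T : Prop :=
  measurable_fun (X : set mplane) (T : mplane -> mplane) /\
  forall B : set mplane, measurable B ->
    area (X `&` T @^-1` B) = area (Y `&` B).

Definition transport_cost X T : \bar R :=
  (\int[area]_(x in X) (enorm (x - T x) ^+ 2)%R%:E)%E.

Definition optimal_transport X Y T : Prop :=
  transport_map X Y T /\
  forall S, transport_map X Y S -> (transport_cost X T <= transport_cost X S)%E.

Definition discontinuous_on X T : Prop :=
  ~ exists S : R * R -> R * R, {within X, continuous S} /\
      {ae area, forall x, X x -> S x = T x}.

End Plane.

(* Main.v *)
(* Put s = y + i p and v = s + e s log s = q + i x. Since v is holomorphic in s,
   there is a harmonic function w of (p, y) with w_p = x and w_y = - q, so that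
   (x, y) |-> (p, q) is the gradient of u = x p - w, the partial Legendre
   transform of w, and it preserves the area. Because of the logarithm, x / p is
   negative near s = 0; hence for small y > 0 the value of p in the right
   half-plane stays above a positive threshold as x -> 0. Extended
   symmetrically, the gradient of u jumps across a segment of the axis x = 0, but
   u remains convex: in terms of w this is a strict saddle inequality, and by
   Kantorovich duality the map is the unique optimal transport onto its image.

   The source X is a smooth convex domain whose boundary is flat near the origin.
   The image of X has a dent along the line y = 0, and up to a null set it is
   Phi(X), where Phi is the composite of two shears, x to p at fixed y followed
   by y to q at fixed p, with the formulas for x and q modified near the origin
   so as to be e-close to the identity in the Lipschitz sense. This modification
   does not change the image, because only the end points of the vertical fibres
   matter there. *)
Require Import Defs.
From HB Require Import structures.
From mathcomp Require Import all_boot all_order all_algebra.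
From mathcomp Require Import all_classical all_reals all_analysis.
From mathcomp Require Import measurable_realfun ess_sup_inf.
From mathcomp Require Import ring lra.

Import Order.TTheory GRing.Theory Num.Theory.
Import numFieldNormedType.Exports.

Local Open Scope classical_set_scope.
Local Open Scope ring_scope.

(** * Real analysis *)

(** Since v is holomorphic, x_p = q_y and x_y = - q_p = e * [angle] > 0. Thus w is convex in p and
    concave in y wherever the common density is positive, in particular wherever x > 0. If the
    region x > 0 were a product, the saddle inequality would follow by going from (p, y) to (p', y)
    and then to (p', y'). It is not a product, because of the dent. The missing case uses the
    direction (1, -1), where harmonicity leaves only the second derivative - 2 w_py = - 2 e *
    [angle] < 0. The other obstacle is that the model map is far from the identity near the origin,
    where the logarithm is unbounded, so it cannot itself be Phi. What keeps Y close to X is that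
    only the curve x = 0 is visible in the image. This curve lies in the disc of radius exp (- 1 /
    e), and on it x = 0 forces e log |s| <= - 1, which leaves a density of size e. The lower
    boundary of the image therefore has slope O(e), although its dent is a genuine singularity of
    the map. *)

Section RealDerivatives.
Variable R : realType.
Implicit Types (f g : R -> R) (x a b c : R).

Lemma is_derive_congr x f df df' : is_derive x 1 f df -> df = df' -> is_derive x 1 f df'.
Proof. by move=> + <-. Qed.

Lemma is_derive_add x f g df dg : is_derive x 1 f df -> is_derive x 1 g dg ->
  is_derive x 1 (fun z => f z + g z) (df + dg).
Proof. by move=> ? ?; exact: is_deriveD. Qed.

Lemma is_derive_opp x f df : is_derive x 1 f df -> is_derive x 1 (fun z => - f z) (- df).
Proof. by move=> ?; exact: is_deriveN. Qed.

Lemma is_derive_mul x f g df dg : is_derive x 1 f df -> is_derive x 1 g dg ->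
  is_derive x 1 (fun z => f z * g z) (f x * dg + g x * df).
Proof. by move=> df0 dg0; have h := is_deriveM df0 dg0; exact: h. Qed.

Lemma is_derive_exprn n x f df : is_derive x 1 f df ->
  is_derive x 1 (fun z => f z ^+ n.+1) (n.+1%:R * f x ^+ n * df).
Proof.
move=> h; elim: n => [|n ih].
  by rewrite (_ : (fun z => _) = f) ?mul1r ?mulr1 ?expr0 ?mul1r//; apply/funext => z; rewrite expr1.
rewrite (_ : (fun z => _) = fun z => f z * f z ^+ n.+1); last by apply/funext => z; rewrite exprS.
by eapply is_derive_congr; [exact: is_derive_mul h ih|rewrite !exprS -[n.+2%:R]natr1; ring].
Qed.

Lemma is_derive_comp x (h f : R -> R) df dh :
  is_derive (f x) 1 h dh -> is_derive x 1 f df ->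
  is_derive x 1 (fun z => h (f z)) (dh * df).
Proof. by move=> ? ?; exact: is_derive1_comp. Qed.

Lemma is_derive_inv x f df : f x != 0 -> is_derive x 1 f df ->
  is_derive x 1 (fun z => (f z)^-1) (- df / f x ^+ 2).
Proof.
move=> fx0 h; eapply is_derive_congr; first exact: is_deriveV.
by rewrite scaleNr mulNr mulrC.
Qed.

Lemma is_derive_const x c : is_derive x 1 (fun _ : R => c) 0.
Proof. exact: is_derive_cst. Qed.

Lemma is_derive_var x : is_derive x 1 (fun z : R => z) 1.
Proof. exact: is_derive_id. Qed.

Lemma is_derive_ln_comp x f df : 0 < f x -> is_derive x 1 f df ->
  is_derive x 1 (fun z => ln (f z)) ((f x)^-1 * df).
Proof. by move=> ? ?; apply: is_derive_comp => //; exact: is_derive1_ln. Qed.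

Lemma is_derive_expR_comp x f df : is_derive x 1 f df ->
  is_derive x 1 (fun z => expR (f z)) (expR (f x) * df).
Proof. by move=> ?; apply: is_derive_comp => //; exact: is_derive_expR. Qed.

Lemma is_derive_atan_comp x f df : is_derive x 1 f df ->
  is_derive x 1 (fun z => atan (f z)) ((1 + f x ^+ 2)^-1 * df).
Proof. by move=> ?; apply: is_derive_comp => //; exact: is_derive1_atan. Qed.

Lemma intermediate_value f df a b v : a <= b ->
  (forall z, a <= z <= b -> is_derive z 1 f (df z)) ->
  f a <= v <= f b -> exists c, a <= c <= b /\ f c = v.
Proof.
move=> ab fd /andP[av vb].
have fab : f a <= f b := le_trans av vb.
have [||c] := @IVT R f a b v ab.
- apply: derivable_within_continuous => x; rewrite in_itv/= => /fd h.
  exact: ex_derive.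
- by rewrite (min_idPl fab) (max_idPr fab) av.
- by rewrite in_itv/= => cab <-; exists c.
Qed.

End RealDerivatives.

Ltac derive_step :=
  lazymatch goal with
  | |- is_derive ?x _ (fun _ => ?c) _ => exact (is_derive_const _ x c)
  | |- is_derive ?x _ (fun z => z) _ => exact (is_derive_var _ x)
  | |- is_derive _ _ (fun z => @?f z + @?g z) _ => eapply (@is_derive_add _ _ f g)
  | |- is_derive _ _ (fun z => - @?f z) _ => eapply (@is_derive_opp _ _ f)
  | |- is_derive _ _ (fun z => @?f z * @?g z) _ => eapply (@is_derive_mul _ _ f g)
  | |- is_derive _ _ (fun z => @?f z ^+ _) _ => eapply (@is_derive_exprn _ _ _ f)
  | |- is_derive _ _ (fun z => (@?f z)^-1) _ => eapply (@is_derive_inv _ _ f)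
  | |- is_derive _ _ (fun z => ln (@?f z)) _ => eapply (@is_derive_ln_comp _ _ f)
  | |- is_derive _ _ (fun z => atan (@?f z)) _ => eapply (@is_derive_atan_comp _ _ f)
  | |- is_derive _ _ (fun z => expR (@?f z)) _ => eapply (@is_derive_expR_comp _ _ f)
  end; cbv beta.

Ltac derive := eapply is_derive_congr; [repeat derive_step|].

Section RealInequalities.
Variable R : realType.
Implicit Types (f g : R -> R) (x a b c : R).

Lemma is_derive_continuous x f df : is_derive x 1 f df -> {for x, continuous f}.
Proof. by move=> h; exact/differentiable_continuous/derivable1_diffP. Qed.

Lemma mean_value f df a b : a < b ->
  (forall z, a <= z <= b -> is_derive z 1 f (df z)) ->
  exists c, a < c < b /\ f b - f a = df c * (b - a).
Proof.
move=> ab fd; have [|/=|c] := @MVT R f df a b ab.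
- by move=> x; rewrite in_itv/= => /andP[ax xb]; apply: fd; rewrite !ltW.
- apply: derivable_within_continuous => x; rewrite in_itv/= => /fd h.
  exact: ex_derive.
- by rewrite in_itv/= => cab ->; exists c.
Qed.

Lemma derive_ge0_le f df a b : a <= b ->
  (forall z, a <= z <= b -> is_derive z 1 f (df z)) ->
  (forall z, a < z < b -> 0 <= df z) -> f a <= f b.
Proof.
rewrite le_eqVlt => /predU1P[->//|ab] fd df0.
have [c [cab fE]] := mean_value _ _ _ _ ab fd.
by rewrite -subr_ge0 fE mulr_ge0 ?df0// subr_ge0 ltW.
Qed.

Lemma derive_gt0_lt f df a b : a < b ->
  (forall z, a <= z <= b -> is_derive z 1 f (df z)) ->
  (forall z, a < z < b -> 0 < df z) -> f a < f b.
Proof.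
move=> ab fd df0; have [c [cab fE]] := mean_value _ _ _ _ ab fd.
by rewrite -subr_gt0 fE mulr_gt0 ?df0// subr_gt0.
Qed.

Lemma ln_lt_sub1 x : 0 < x -> x != 1 -> ln x < x - 1.
Proof.
move=> x0 x1; have d (z : R) : 0 < z -> is_derive z 1 (fun z => z - 1 - ln z) (1 - z^-1).
  by move=> z0; derive => //; ring.
case: (ltgtP x 1) x1 => // xl1 _; rewrite -subr_gt0.
- have := @derive_gt0_lt (fun z => - (z - 1 - ln z)) (fun z => - (1 - z^-1)) x 1 xl1.
  rewrite ln1 !subr0 subrr oppr0 oppr_lt0; apply.
    by move=> z /andP[xz _]; apply/is_derive_opp/d/(lt_le_trans x0).
  move=> z /andP[xz z1]; have z0 := lt_trans x0 xz.
  by rewrite oppr_gt0 subr_lt0 invf_gt1.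
- have := @derive_gt0_lt (fun z => z - 1 - ln z) (fun z => 1 - z^-1) 1 x xl1.
  rewrite ln1 subr0 subrr; apply.
    by move=> z /andP[xz _]; apply/d/(lt_le_trans ltr01).
  by move=> z /andP[xz z1]; rewrite subr_gt0 invf_lt1// (lt_trans ltr01).
Qed.

Lemma ln_le_id x : 0 <= x -> ln x <= x.
Proof.
rewrite le_eqVlt => /predU1P[<-|x0]; first by rewrite ln0.
have [->|x1] := eqVneq x 1; first by rewrite ln1.
by have := ln_lt_sub1 _ x0 x1; lra.
Qed.

Lemma atan_ge0 x : 0 <= x -> 0 <= atan x.
Proof. by move=> x0; rewrite -atan0; exact: le_atan. Qed.

Lemma atan_lt_id x : 0 < x -> atan x < x.
Proof.
move=> x0; rewrite -subr_gt0.
have := @derive_gt0_lt (fun z => z - atan z) (fun z => 1 - (1 + z ^+ 2)^-1) 0 x x0.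
rewrite atan0 subrr; apply => z.
move=> /andP[z0 _]; rewrite subr_gt0 invf_lt1; first by rewrite ltrDl exprn_gt0.
by rewrite addr_gt0// exprn_gt0.
Qed.

Lemma atanV x : 0 < x -> atan x^-1 = pi / 2 - atan x.
Proof.
move=> x0; have a0 : 0 < atan x by rewrite -atan0 lt_atan.
have a1 := atan_ltpi2 x; rewrite -[RHS]tanK; last first.
  by rewrite in_itv/=; have := @pi_gt0 R; lra.
congr atan; rewrite /tan addrC sinDpihalf cosDpihalf sinN opprK cosN.
by rewrite -{1}[x]atanK /tan invf_div.
Qed.

(** Equivalent to x / (1 + x) <= atan x. Both sides vanish at 0, and the derivatives compare because
    1 + t^2 <= (1 + t)^2 for t >= 0. *)
Lemma sub_atan_le_mul x : 0 <= x -> x - atan x <= x * atan x.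
Proof.
move=> x0; have p (t : R) : 0 < 1 + t ^+ 2 by rewrite ltr_pwDl// sqr_ge0.
suff : 0 <= atan x - x / (1 + x).
  have xp : 0 < 1 + x by lra.
  by rewrite subr_ge0 ler_pdivrMr//; lra.
have := @derive_ge0_le (fun z => atan z - z / (1 + z))
  (fun z => (1 + z ^+ 2)^-1 - (1 + z) ^- 2) 0 x x0.
rewrite atan0 mul0r subr0; apply => t /andP[t0 _].
  by derive; [lra|field; rewrite !gt_eqF//; lra].
rewrite subr_ge0 lef_pV2 ?posrE ?p//; last by rewrite exprn_gt0//; lra.
by nra.
Qed.

End RealInequalities.

(** * The model potential *)

Section ModelPotential.
Variables (R : realType) (e : R).
Hypothesis e_gt0 : 0 < e.
Implicit Types p y x q z h : R.

(* With s = y + i p and v = s + e s log s one has v = model_q + i model_x, and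
   model_w is the harmonic function with p-derivative model_x and y-derivative
   - model_q. The slope is model_x / p; the density is both the p-derivative of
   model_x and the y-derivative of model_q. *)
Definition log_radius p y := ln (p ^+ 2 + y ^+ 2) / 2.
Definition angle p y := pi / 2 - atan (y / p).
Definition model_x p y := p + e * (p * log_radius p y + y * angle p y).
Definition model_q p y := y + e * (y * log_radius p y - p * angle p y).
Definition model_w p y :=
  (p ^+ 2 - y ^+ 2) / 2 * (1 - e / 2 + e * log_radius p y) + e * (p * y * angle p y).
Definition model_slope p y := 1 + e * (log_radius p y + y / p * angle p y).
Definition model_density p y := 1 + e * (log_radius p y + 1).

Lemma sqr_radius_gt0 p y : 0 < p -> 0 < p ^+ 2 + y ^+ 2.
Proof. by move=> p0; rewrite ltr_pwDl ?exprn_gt0// sqr_ge0. Qed.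

Lemma angle_gt0 p y : 0 < angle p y.
Proof. by rewrite subr_gt0 atan_ltpi2. Qed.

Lemma angle_le_pihalf p y : 0 < p -> 0 <= y -> angle p y <= pi / 2.
Proof. by move=> p0 y0; rewrite gerBl atan_ge0// divr_ge0// ltW. Qed.

Lemma angleE p y : 0 < p -> 0 < y -> angle p y = atan (p / y).
Proof. by move=> p0 y0; rewrite -[p / y]invf_div atanV ?divr_gt0. Qed.

(** For y > 0 this is atan t < t at t = p / y. It is the sign that makes the slope increase with
    p. *)
Lemma mul_angle_lt p y : 0 < p -> y * angle p y < p.
Proof.
move=> p0; have [y0|y0] := ltP 0 y.
  by rewrite angleE// mulrC -ltr_pdivlMr// atan_lt_id// divr_gt0.
by rewrite (le_lt_trans _ p0)// mulr_le0_ge0// ltW// angle_gt0.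
Qed.

Lemma sub_mul_angle_le p y : 0 < p -> 0 <= y -> p - y * angle p y <= p * angle p y.
Proof.
move=> p0; rewrite le_eqVlt => /predU1P[<-|y0].
  rewrite mul0r subr0 /angle mul0r atan0 subr0 ler_peMr//; last exact: pihalf_ge1.
  exact: ltW.
rewrite angleE//; have := @sub_atan_le_mul R (p / y) (divr_ge0 (ltW p0) (ltW y0)).
have yp : y * (p / y) = p by field; rewrite gt_eqF.
by rewrite -(ler_pM2l y0) mulrBr (mulrA y (p / y)) yp.
Qed.

(** Product rule for x = p * slope: the second term is p times the p-derivative of the slope. Its
    positivity shows that the density is positive wherever x is. *)
Lemma model_slope_density p y : 0 < p ->
  model_density p y = model_slope p y + e * (p - y * angle p y) / p.
Proof. by move=> p0; rewrite /model_density /model_slope; field; rewrite gt_eqF. Qed.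

Lemma model_density_gt p y : 0 < p -> model_slope p y < model_density p y.
Proof.
move=> p0; rewrite model_slope_density// ltrDl !mulr_gt0 ?invr_gt0//.
by rewrite subr_gt0 mul_angle_lt.
Qed.

Lemma model_xE p y : 0 < p -> model_x p y = p * model_slope p y.
Proof. by move=> p0; rewrite /model_x /model_slope; field; rewrite gt_eqF. Qed.

Lemma is_derive_angle_l p y : 0 < p ->
  is_derive p 1 (fun z => angle z y) (y / (p ^+ 2 + y ^+ 2)).
Proof.
move=> p0; have p1 : p != 0 by rewrite gt_eqF.
have r0 := gt_eqF (sqr_radius_gt0 _ y p0).
by rewrite /angle; derive => //; field; rewrite r0 p1.
Qed.

Lemma is_derive_angle_r p y : 0 < p ->
  is_derive y 1 (fun z => angle p z) (- p / (p ^+ 2 + y ^+ 2)).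
Proof.
move=> p0; have p1 : p != 0 by rewrite gt_eqF.
have r0 := gt_eqF (sqr_radius_gt0 _ y p0).
by rewrite /angle; derive => //; field; rewrite r0 p1.
Qed.

Lemma is_derive_log_radius_l p y : 0 < p ->
  is_derive p 1 (fun z => log_radius z y) (p / (p ^+ 2 + y ^+ 2)).
Proof.
move=> p0; have r0 := sqr_radius_gt0 _ y p0.
by rewrite /log_radius; derive => //; field; rewrite gt_eqF.
Qed.

Lemma is_derive_log_radius_r p y : 0 < p ->
  is_derive y 1 (fun z => log_radius p z) (y / (p ^+ 2 + y ^+ 2)).
Proof.
move=> p0; have r0 := sqr_radius_gt0 _ y p0.
by rewrite /log_radius; derive => //; field; rewrite gt_eqF.
Qed.

Local Ltac model_derive :=
  derive; try (by [exact: is_derive_angle_l | exact: is_derive_angle_r |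
    exact: is_derive_log_radius_l | exact: is_derive_log_radius_r | rewrite gt_eqF]).

Lemma is_derive_model_x_l p y : 0 < p ->
  is_derive p 1 (fun z => model_x z y) (model_density p y).
Proof.
move=> p0; have r0 := gt_eqF (sqr_radius_gt0 _ y p0).
by rewrite /model_x; model_derive; rewrite /model_density; field; rewrite r0.
Qed.

Lemma is_derive_model_q_l p y : 0 < p ->
  is_derive p 1 (fun z => model_q z y) (- e * angle p y).
Proof.
move=> p0; have r0 := gt_eqF (sqr_radius_gt0 _ y p0).
by rewrite /model_q; model_derive; field; rewrite r0.
Qed.

Lemma is_derive_model_q_r p y : 0 < p ->
  is_derive y 1 (fun z => model_q p z) (model_density p y).
Proof.
move=> p0; have r0 := gt_eqF (sqr_radius_gt0 _ y p0).
by rewrite /model_q; model_derive; rewrite /model_density; field; rewrite r0.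
Qed.

Lemma is_derive_model_w_l p y : 0 < p ->
  is_derive p 1 (fun z => model_w z y) (model_x p y).
Proof.
move=> p0; have r0 := gt_eqF (sqr_radius_gt0 _ y p0).
by rewrite /model_w; model_derive; rewrite /model_x; field; rewrite r0.
Qed.

Lemma is_derive_model_w_r p y : 0 < p ->
  is_derive y 1 (fun z => model_w p z) (- model_q p y).
Proof.
move=> p0; have r0 := gt_eqF (sqr_radius_gt0 _ y p0).
by rewrite /model_w; model_derive; rewrite /model_q; field; rewrite r0.
Qed.

Lemma is_derive_model_slope_l p y : 0 < p ->
  is_derive p 1 (fun z => model_slope z y) (e * (p - y * angle p y) / p ^+ 2).
Proof.
move=> p0; have r0 := gt_eqF (sqr_radius_gt0 _ y p0).
have p1 : p != 0 by rewrite gt_eqF.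
by rewrite /model_slope; model_derive => //; field; rewrite r0 p1.
Qed.

Lemma is_derive_model_slope_r p y : 0 < p ->
  is_derive y 1 (fun z => model_slope p z) (e * angle p y / p).
Proof.
move=> p0; have r0 := gt_eqF (sqr_radius_gt0 _ y p0).
have p1 : p != 0 by rewrite gt_eqF.
by rewrite /model_slope; model_derive => //; field; rewrite r0 p1.
Qed.

Lemma model_slope_le_l p q y : 0 < p -> p <= q -> model_slope p y <= model_slope q y.
Proof.
move=> p0 pq; apply: (@derive_ge0_le R (fun z => model_slope z y)
  (fun z => e * (z - y * angle z y) / z ^+ 2) p q pq) => z.
  by move=> /andP[pz _]; apply/is_derive_model_slope_l/(lt_le_trans p0).
move=> /andP[pz _]; have z0 := lt_trans p0 pz.
by rewrite !mulr_ge0 ?invr_ge0 ?sqr_ge0// ?ltW// subr_gt0 mul_angle_lt.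
Qed.

Lemma model_slope_lt_r p y z : 0 < p -> y < z -> model_slope p y < model_slope p z.
Proof.
move=> p0 yz; apply: (@derive_gt0_lt R (fun z => model_slope p z)
  (fun z => e * angle p z / p) y z yz) => t.
  by move=> _; exact: is_derive_model_slope_r.
by move=> _; rewrite !mulr_gt0 ?invr_gt0// angle_gt0.
Qed.

Lemma model_slope_le_r p y z : 0 < p -> y <= z -> model_slope p y <= model_slope p z.
Proof.
by move=> p0; rewrite le_eqVlt => /predU1P[->//|?]; apply/ltW/model_slope_lt_r.
Qed.

Lemma is_derive_angle_diagonal p y h : 0 < p + h ->
  is_derive h 1 (fun h => angle (p + h) (y - h))
    ((p + h + (y - h)) / ((p + h) ^+ 2 + (y - h) ^+ 2)).
Proof.
move=> p0; have p1 : p + h != 0 by rewrite gt_eqF.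
have r0 := gt_eqF (sqr_radius_gt0 _ (y - h) p0).
by rewrite /angle; derive => //; field; rewrite r0 p1.
Qed.

Lemma is_derive_log_radius_diagonal p y h : 0 < p + h ->
  is_derive h 1 (fun h => log_radius (p + h) (y - h))
    ((p + h - (y - h)) / ((p + h) ^+ 2 + (y - h) ^+ 2)).
Proof.
move=> p0; have p1 : p + h != 0 by rewrite gt_eqF.
have r0 := sqr_radius_gt0 _ (y - h) p0.
by rewrite /log_radius; derive => //; field; rewrite gt_eqF.
Qed.

Local Ltac diagonal_derive :=
  derive; try (by [exact: is_derive_angle_diagonal |
    exact: is_derive_log_radius_diagonal | rewrite gt_eqF]).

(** The derivative along (1, -1) is e (p - y angle - p angle) / p^2, which [sub_mul_angle_le] makes
    nonpositive. This is what bounds the steepness of the dent. *)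
Lemma model_slope_diagonal p y h : 0 < p -> 0 <= h <= y ->
  model_slope (p + h) (y - h) <= model_slope p y.
Proof.
move=> p0 /andP[h0 hy].
have := @derive_ge0_le R (fun h => - model_slope (p + h) (y - h))
  (fun h => e * ((p + h) * angle (p + h) (y - h) -
     (p + h - (y - h) * angle (p + h) (y - h))) / (p + h) ^+ 2) 0 h h0.
rewrite addr0 subr0 lerN2; apply => z /andP[z0 zh].
  have pz : 0 < p + z by lra.
  have r0 := gt_eqF (sqr_radius_gt0 _ (y - z) pz).
  have p1 : p + z != 0 by rewrite gt_eqF.
  by rewrite /model_slope; diagonal_derive; field; rewrite r0 p1.
rewrite !mulr_ge0 ?invr_ge0 ?sqr_ge0// ?(ltW e_gt0)//.
by rewrite subr_ge0 sub_mul_angle_le//; lra.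
Qed.

(** x + q is the derivative of w along (1, -1). When it is differentiated once more in that
    direction the two densities cancel, leaving - 2 e * [angle]. *)
Lemma model_xq_diagonal p y h : 0 < p -> 0 <= h ->
  model_x (p + h) (y - h) + model_q (p + h) (y - h) <= model_x p y + model_q p y.
Proof.
move=> p0 h0.
have := @derive_ge0_le R
  (fun h => - (model_x (p + h) (y - h) + model_q (p + h) (y - h)))
  (fun h => 2 * e * angle (p + h) (y - h)) 0 h h0.
rewrite !addr0 !subr0 lerN2; apply => z /andP[z0 zh].
  have pz : 0 < p + z by lra.
  have r0 := gt_eqF (sqr_radius_gt0 _ (y - z) pz).
  by rewrite /model_x /model_q; diagonal_derive; field; rewrite r0.
by rewrite !mulr_ge0// ltW// ?angle_gt0.
Qed.

Lemma model_w_diagonal p y h : 0 < p -> 0 <= h ->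
  model_w (p + h) (y - h) <= model_w p y + (model_x p y + model_q p y) * h.
Proof.
move=> p0 h0.
have := @derive_ge0_le R
  (fun h => (model_x p y + model_q p y) * h - model_w (p + h) (y - h))
  (fun h => (model_x p y + model_q p y) -
    (model_x (p + h) (y - h) + model_q (p + h) (y - h))) 0 h h0.
rewrite !addr0 !subr0 mulr0 => H; suff : 0 - model_w p y <=
   (model_x p y + model_q p y) * h - model_w (p + h) (y - h) by lra.
apply: H => z /andP[z0 zh]; last by rewrite subr_ge0 model_xq_diagonal// ltW.
have pz : 0 < p + z by lra.
have r0 := gt_eqF (sqr_radius_gt0 _ (y - z) pz).
by rewrite /model_w; diagonal_derive; rewrite /model_x /model_q; field; rewrite r0.
Qed.

Lemma model_x_lt p z y : 0 < z -> z < p -> 0 < model_slope p y ->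
  model_x z y < model_x p y.
Proof.
move=> z0 zp s0; have p0 := lt_trans z0 zp.
rewrite !model_xE//; apply: (@le_lt_trans _ _ (z * model_slope p y)).
  by rewrite ler_pM2l// model_slope_le_l// ltW.
by rewrite ltr_pM2r.
Qed.

Lemma model_x_gt0 p y : 0 < p -> (0 < model_x p y) = (0 < model_slope p y).
Proof. by move=> p0; rewrite model_xE// pmulr_rgt0. Qed.

(** w need not be convex in p near the origin, where the density is negative. The tangent at a point
    of positive slope still lies below: for c < p, x(c) = c slope(c) <= c slope(p) < x(p), because
    the slope increases with p. *)
Lemma model_w_tangent_l p y z : 0 < p -> 0 < model_slope p y -> 0 < z ->
  model_w p y + model_x p y * (z - p) <= model_w z y.
Proof.
move=> p0 s0 z0; case: (ltgtP z p) => [zp|pz|->]; last by rewrite subrr; lra.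
- have [|c [/andP[zc cp] wE]] := @mean_value R (fun z => model_w z y) (fun z => model_x z y) z p zp.
    by move=> t /andP[zt _]; apply/is_derive_model_w_l/(lt_le_trans z0).
  have := model_x_lt p c y (lt_trans z0 zc) cp s0; nra.
- have [|c [/andP[pc cz] wE]] := @mean_value R (fun z => model_w z y) (fun z => model_x z y) p z pz.
    by move=> t /andP[pt _]; apply/is_derive_model_w_l/(lt_le_trans p0).
  have s1 : 0 < model_slope c y by rewrite (lt_le_trans s0)// model_slope_le_l// ltW.
  have := model_x_lt c p y p0 pc s1; nra.
Qed.

Lemma model_w_tangent_l_lt p y z : 0 < p -> 0 < model_slope p y -> 0 < z -> z != p ->
  model_w p y + model_x p y * (z - p) < model_w z y.
Proof.
move=> p0 s0 z0; case: (ltgtP z p) => // [zp|pz] _.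
- have [|c [/andP[zc cp] wE]] := @mean_value R (fun z => model_w z y) (fun z => model_x z y) z p zp.
    by move=> t /andP[zt _]; apply/is_derive_model_w_l/(lt_le_trans z0).
  have := model_x_lt p c y (lt_trans z0 zc) cp s0; nra.
- have [|c [/andP[pc cz] wE]] := @mean_value R (fun z => model_w z y) (fun z => model_x z y) p z pz.
    by move=> t /andP[pt _]; apply/is_derive_model_w_l/(lt_le_trans p0).
  have s1 : 0 < model_slope c y by rewrite (lt_le_trans s0)// model_slope_le_l// ltW.
  have := model_x_lt c p y p0 pc s1; nra.
Qed.

Lemma model_q_lt p y z : 0 < p -> 0 <= model_slope p y -> y < z ->
  model_q p y < model_q p z.
Proof.
move=> p0 s0 yz; apply: (@derive_gt0_lt R (fun z => model_q p z) (fun z => model_density p z) y z yz) => t.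
  by move=> _; exact: is_derive_model_q_r.
move=> /andP[yt _]; apply: (le_lt_trans s0).
by apply: le_lt_trans (model_density_gt _ _ p0); rewrite model_slope_le_r// ltW.
Qed.

(** The slope increases with y, so its sign at the lower end passes to the whole segment between y
    and z, where w_yy = - density < 0. *)
Lemma model_w_tangent_r_lt p y z : 0 < p -> 0 <= model_slope p y ->
  0 <= model_slope p z -> z != y ->
  model_w p z < model_w p y - model_q p y * (z - y).
Proof.
move=> p0 sy sz; case: (ltgtP z y) => // [zy|yz] _.
- have [|c [/andP[zc cy] wE]] := @mean_value R (fun z => model_w p z) (fun z => - model_q p z) z y zy.
    by move=> t _; exact: is_derive_model_w_r.
  have s1 : 0 <= model_slope p c by rewrite (le_trans sz)// model_slope_le_r// ltW.
  have := model_q_lt p c y p0 s1 cy; nra.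
- have [|c [/andP[yc cz] wE]] := @mean_value R (fun z => model_w p z) (fun z => - model_q p z) y z yz.
    by move=> t _; exact: is_derive_model_w_r.
  have := model_q_lt p y c p0 sy yc; nra.
Qed.

Lemma model_w_tangent_r p y z : 0 < p -> 0 <= model_slope p y ->
  0 <= model_slope p z ->
  model_w p z <= model_w p y - model_q p y * (z - y).
Proof.
move=> p0 sy sz; have [->|zy] := eqVneq z y; first by lra.
exact/ltW/model_w_tangent_r_lt.
Qed.

(* When (p', y) lies in the region where the slope is negative, go from
   (p', y') straight down to the curve [model_slope = 0] and then along the
   direction (1, -1), in which the harmonic function w is concave. *)
Lemma model_w_saddle_lt p y p' y' : 0 < p -> 0 < y -> 0 < model_slope p y ->
  0 < p' -> 0 < y' -> 0 < model_slope p' y' -> (p, y) != (p', y') ->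
  model_w p y + model_x p y * (p' - p) < model_w p' y' - model_q p' y' * (y - y').
Proof.
move=> p0 y0 s0 p'0 y'0 s'0 neq.
have [sm|sm] := leP 0 (model_slope p' y).
  have h1 := model_w_tangent_l _ _ _ p0 s0 p'0.
  have h2 := model_w_tangent_r _ _ _ p'0 (ltW s'0) sm.
  have [pE|pN] := eqVneq p' p.
    have yN : y != y' by apply: contra_neq neq => ->; rewrite pE.
    exact: le_lt_trans h1 (model_w_tangent_r_lt _ _ _ p'0 (ltW s'0) sm yN).
  exact: lt_le_trans (model_w_tangent_l_lt _ _ _ p0 s0 p'0 pN) h2.
have yy' : y < y'.
  rewrite ltNge; apply/negP => /(model_slope_le_r _ _ _ p'0) h.
  by have := lt_le_trans s'0 h; rewrite ltNge (ltW sm).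
have [||z [/andP[yz zy'] zE]] := @intermediate_value R (fun z => model_slope p' z)
  (fun z => e * angle p' z / p') y y' 0 (ltW yy').
- by move=> z _; exact: is_derive_model_slope_r.
- by rewrite !ltW.
have yz1 : y < z.
  rewrite lt_neqAle yz andbT; apply/eqP => yzE; by rewrite yzE zE ltxx in sm.
have zz1 : z < y'.
  rewrite lt_neqAle zy' andbT; apply/eqP => zyE; by rewrite -zyE zE ltxx in s'0.
have h0 : 0 <= z - y by lra.
have h1 := model_w_diagonal p' z (z - y) p'0 h0.
rewrite subKr model_xE// zE mulr0 add0r in h1.
have sz : 0 <= model_slope p' z by rewrite zE.
have h2 := model_w_tangent_r p' y' z p'0 (ltW s'0) sz.
have h3 : model_q p' z < model_q p' y' by apply: model_q_lt; rewrite ?zE.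
have h4 := model_w_tangent_l p y (p' + (z - y)) p0 s0.
have h5 : 0 < model_x p y by rewrite model_x_gt0.
have {}h4 := h4 _; nra.
Qed.

End ModelPotential.

(** * Solving for p at fixed y, and the shape of the dent *)

Section ModelMap.
Variables (R : realType) (e : R).
Hypothesis e_gt0 : 0 < e.
Implicit Types p y x q z h : R.

Local Notation lr := (@log_radius R).
Local Notation th := (@angle R).
Local Notation mx := (@model_x R e).
Local Notation mq := (@model_q R e).
Local Notation slope := (@model_slope R e).
Local Notation density := (@model_density R e).

Lemma log_radius_le p y c : 0 < p -> p ^+ 2 + y ^+ 2 <= c -> lr p y <= ln c / 2.
Proof.
move=> p0 h; rewrite /log_radius ler_pM2r ?invr_gt0// ler_ln ?posrE//.
  exact: sqr_radius_gt0.
exact: lt_le_trans (sqr_radius_gt0 _ _ y p0) h.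
Qed.

Lemma log_radius_ge0 p y : 1 <= p ^+ 2 + y ^+ 2 -> 0 <= lr p y.
Proof. by move=> h; rewrite /log_radius divr_ge0// ln_ge0. Qed.

Lemma mul_angle_ge0 p y : 0 <= y -> 0 <= y * th p y.
Proof. by move=> y0; rewrite mulr_ge0// ltW// angle_gt0. Qed.

Lemma model_slope_ge1 p y : 0 < p -> 0 <= y -> 1 <= p ^+ 2 + y ^+ 2 -> 1 <= slope p y.
Proof.
move=> p0 y0 r1; rewrite /model_slope lerDl mulr_ge0 ?(ltW e_gt0)// addr_ge0//.
  exact: log_radius_ge0.
by rewrite mulrAC divr_ge0// ?mul_angle_ge0// ltW.
Qed.

(** Intermediate values between a and 1 + x. For a <= 1, ln t <= t and [mul_angle_lt] give x(a, y)
    <= a c, hence the choice of a. The point (1 + x, y) lies outside the unit disc, where the slope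
    is at least 1. *)
Lemma model_x_surj x y : 0 < x -> 0 < y -> exists p, 0 < p /\ mx p y = x.
Proof.
move=> x0 y0; pose c := 1 + e * ((1 + y ^+ 2) / 2 + 1).
have c0 : 0 < c.
  have h : 0 <= (1 + y ^+ 2) / 2 + 1 by have := sqr_ge0 y; lra.
  by have := mulr_ge0 (ltW e_gt0) h; rewrite /c; lra.
pose a := Num.min 1 (x / c).
have a0 : 0 < a by rewrite lt_min ltr01 divr_gt0.
have a1 : a <= 1 by rewrite ge_min lexx.
have ax : a * c <= x by rewrite -ler_pdivlMr// ge_min lexx orbT.
have am : a <= 1 + x by lra.
have [|/=|p [/andP[ap pm] pE]] := @intermediate_value R (fun p => mx p y)
  (fun p => density p y) a (1 + x) x am.
- by move=> z /andP[az _]; apply: is_derive_model_x_l; exact: lt_le_trans az.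
- apply/andP; split.
    apply: le_trans ax; rewrite /model_x.
    have h1 : lr a y <= (1 + y ^+ 2) / 2.
      rewrite /log_radius ler_pM2r ?invr_gt0//.
      apply: le_trans (ln_le_id _ _ _) _; first by rewrite addr_ge0// sqr_ge0.
      by rewrite lerD2r expr_le1// ltW.
    have h2 : y * th a y <= a by rewrite ltW// mul_angle_lt.
    have h3 : a * lr a y <= a * ((1 + y ^+ 2) / 2) by rewrite ler_pM2l.
    have h4 : a * lr a y + y * th a y <= a * ((1 + y ^+ 2) / 2 + 1) by lra.
    by have := ler_wpM2l (ltW e_gt0) h4; rewrite /c; lra.
  rewrite model_xE; last by lra.
  apply: (@le_trans _ _ (1 + x)); first by lra.
  rewrite ler_peMr//; first by lra.
  by apply: model_slope_ge1; [lra|lra|have := sqr_ge0 y; nra].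
- by exists p; split => //; exact: lt_le_trans ap.
Qed.

Lemma model_x_inj p z y : 0 < p -> 0 < z -> 0 < mx p y -> mx p y = mx z y -> p = z.
Proof.
move=> p0 z0 x0 E; case: (ltgtP p z) => // h.
- have := model_x_lt _ _ e_gt0 _ _ y p0 h; rewrite -model_x_gt0// -E => /(_ x0).
  by rewrite E ltxx.
- have := model_x_lt _ _ e_gt0 _ _ y z0 h; rewrite -model_x_gt0// => /(_ x0).
  by rewrite E ltxx.
Qed.

Lemma model_x_le p z y : 0 < z -> z <= p -> 0 < slope p y -> mx z y <= mx p y.
Proof.
move=> z0; rewrite le_eqVlt => /predU1P[->//|zp] s0; apply: ltW.
exact: model_x_lt.
Qed.

(* The lower end of the region [0 < model_slope] on the vertical line of abscissa p. *)
Definition dent_spec p d := [/\ 0 <= d, 0 <= slope p d & 0 < d -> slope p d = 0].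
Definition dent p : R := xget 0 [set d | dent_spec p d].

Lemma dentP p : 0 < p -> dent_spec p (dent p).
Proof.
move=> p0; rewrite /dent; case: xgetP => [_ _ //|H]; exfalso.
have [s0|s0] := leP 0 (slope p 0).
  by apply: (H 0); split => //; rewrite ltxx.
have [|/=|d [/andP[d0 _] dE]] := @intermediate_value R (fun y => slope p y)
  (fun y => e * th p y / p) 0 1 0 ler01.
- by move=> z _; exact: is_derive_model_slope_r.
- rewrite ltW//= (le_trans ler01)// model_slope_ge1//.
  by rewrite expr1n lerDr sqr_ge0.
- by apply: (H d); split => //; rewrite dE.
Qed.

Lemma dent_ge0 p : 0 < p -> 0 <= dent p.
Proof. by move=> /dentP[]. Qed.

Lemma dent_slope_ge0 p : 0 < p -> 0 <= slope p (dent p).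
Proof. by move=> /dentP[]. Qed.

Lemma dent_slope0 p : 0 < p -> 0 < dent p -> slope p (dent p) = 0.
Proof. by move=> /dentP[]. Qed.

Lemma model_slope_gt0 p y : 0 < p -> 0 < y -> (0 < slope p y) = (dent p < y).
Proof.
move=> p0 y0; apply/idP/idP => [s0|dy]; last first.
  by rewrite (le_lt_trans (dent_slope_ge0 _ p0))// model_slope_lt_r.
rewrite ltNge; apply/negP => yd; have d0 := lt_le_trans y0 yd.
have := model_slope_le_r _ _ e_gt0 _ _ _ p0 yd.
by rewrite dent_slope0// leNgt s0.
Qed.

Lemma dent_le p z : 0 < p -> p <= z -> dent z <= dent p.
Proof.
move=> p0 pz; have z0 := lt_le_trans p0 pz; rewrite leNgt; apply/negP => dd.
have d0 : 0 < dent z := le_lt_trans (dent_ge0 _ p0) dd.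
have h1 := model_slope_lt_r _ _ e_gt0 _ _ _ z0 dd.
have h2 := model_slope_le_l _ _ e_gt0 _ _ (dent p) p0 pz.
have h3 := dent_slope_ge0 _ p0.
by rewrite dent_slope0// in h1; lra.
Qed.

(** Following (1, -1) from the zero (p, dent p), the slope does not increase, so it is nonpositive
    at (z, dent p - (z - p)), which therefore cannot lie above the dent. *)
Lemma dent_lipschitz p z : 0 < p -> p <= z -> dent p - (z - p) <= dent z.
Proof.
move=> p0 pz; have z0 := lt_le_trans p0 pz; rewrite leNgt; apply/negP => dd.
have dz0 := dent_ge0 _ z0.
have d0 : 0 < dent p by lra.
have h1 := model_slope_diagonal _ _ e_gt0 p (dent p) (z - p) p0.
rewrite (dent_slope0 p)// subrKC in h1.
have h2 := model_slope_lt_r _ _ e_gt0 _ _ _ z0 dd.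
have h3 := dent_slope_ge0 _ z0.
have := h1 _; lra.
Qed.

(** The zero of the slope on the axis y = 0, where it equals 1 + e ln p. *)
Definition dent_radius := expR (- e^-1).

Lemma dent_slope_lt0 p y : 0 < p -> 0 <= y -> slope p y <= 0 ->
  p ^+ 2 + y ^+ 2 <= dent_radius ^+ 2.
Proof.
move=> p0 y0 s0; have r0 := sqr_radius_gt0 _ _ y p0.
rewrite -ler_ln ?posrE ?exprn_gt0 ?expR_gt0// /dent_radius -expRM_natl expRK.
have h1 : 0 <= y / p * th p y by rewrite mulrAC divr_ge0 ?mul_angle_ge0// ltW.
move: s0; rewrite /model_slope => s0.
have h2 : lr p y <= - e^-1.
  by have h3 := mulr_ge0 (ltW e_gt0) h1; rewrite -(ler_pM2l e_gt0) mulrN mulfV ?gt_eqF//; lra.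
by move: h2; rewrite /log_radius => h2; lra.
Qed.

Lemma dent0 p : dent_radius <= p -> dent p = 0.
Proof.
move=> lp; have p0 : 0 < p := lt_le_trans (expR_gt0 _) lp.
apply/eqP; rewrite eq_le dent_ge0// andbT leNgt; apply/negP => d0.
have := dent_slope_lt0 _ _ p0 (ltW d0); rewrite dent_slope0// => /(_ (lexx _)).
apply/negP; rewrite -ltNge; apply: (@le_lt_trans _ _ (p ^+ 2)).
  by rewrite lerXn2r ?nnegrE// ltW// expR_gt0.
by rewrite ltrDl exprn_gt0.
Qed.

Definition dent_q p := mq p (dent p).

(** Go from (p, dent p) to (z, dent p) and then to (z, dent z). On the first leg |q_p| = e * [angle]
    <= 2 e. The second leg has length at most z - p by [dent_lipschitz], and the density on it is
    between 0 and 2 e. This O(e) bound is the source of the smallness of the perturbation. *)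
Lemma dent_q_lipschitz p z : 0 < p -> p <= z -> z <= dent_radius ->
  `|dent_q z - dent_q p| <= 4 * e * (z - p).
Proof.
move=> p0; rewrite le_eqVlt => /predU1P[<- _|pz zl]; first by rewrite !subrr normr0 mulr0.
have z0 := lt_trans p0 pz.
have d0 := dent_ge0 _ p0.
have h1 : `|mq z (dent p) - mq p (dent p)| <= 2 * e * (z - p).
  have [|c [/andP[pc cz] ->]] := @mean_value R (fun z => mq z (dent p)) (fun z => - e * th z (dent p)) p z pz.
    by move=> t /andP[pt _]; apply/is_derive_model_q_l/(lt_le_trans p0).
  have c0 := lt_trans p0 pc.
  have a1 := angle_gt0 _ c (dent p); have a2 := angle_le_pihalf _ _ _ c0 d0.
  have a3 := @pihalf_lt2 R.
  rewrite normrM mulNr normrN !normrM (gtr0_norm e_gt0) (gtr0_norm a1) gtr0_norm; last lra.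
  have ez : 0 < e * (z - p) by rewrite mulr_gt0// subr_gt0.
  rewrite mulrAC -[2 * e * _]mulrA [leRHS]mulrC ler_pM2l//; lra.
have h2 : `|mq z (dent p) - mq z (dent z)| <= 2 * e * (z - p).
  have := dent_le _ _ p0 (ltW pz); rewrite le_eqVlt => /predU1P[->|dd].
    by rewrite subrr normr0 !mulr_ge0 ?(ltW e_gt0)// subr_ge0 ltW.
  have dz0 := dent_ge0 _ z0.
  have [|c [/andP[dc cd] ->]] := @mean_value R (fun y => mq z y) (fun y => density z y) _ _ dd.
    by move=> t _; exact: is_derive_model_q_r.
  have A0 : 0 <= density z c.
    apply: le_trans (ltW (model_density_gt _ _ e_gt0 z c z0)).
    by apply: le_trans (dent_slope_ge0 _ z0) _; apply: model_slope_le_r => //; exact: ltW.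
  have A1 : density z c <= 2 * e.
    have dl : p ^+ 2 + dent p ^+ 2 <= dent_radius ^+ 2.
      by apply: dent_slope_lt0 => //; rewrite dent_slope0//; lra.
    have lz : z ^+ 2 <= dent_radius ^+ 2 by rewrite lerXn2r ?nnegrE// ltW// expR_gt0.
    (* Both z and c are at most [dent_radius], so log r <= (ln 2) / 2 - 1 / e; multiplied by e, the
       term - 1 / e cancels the leading 1 of the density. *)
    have r2 : z ^+ 2 + c ^+ 2 <= 2 * dent_radius ^+ 2 by nra.
    have := log_radius_le _ _ _ z0 r2.
    rewrite lnM ?posrE ?exprn_gt0 ?expR_gt0// -expRM_natl expRK => h.
    have l2 : ln 2 < (1 : R) by have := @ln_lt_sub1 R 2; lra.
    have {}h : lr z c <= 1 - e^-1 by lra.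
    rewrite /model_density; have := mulfV (lt0r_neq0 e_gt0).
    by move: h; rewrite -(ler_pM2l e_gt0); nra.
  have dl := dent_lipschitz _ _ p0 (ltW pz).
  rewrite normrM !ger0_norm//; last by lra.
  by rewrite ler_pM//; lra.
have -> : dent_q z - dent_q p = (mq z (dent p) - mq p (dent p)) -
   (mq z (dent p) - mq z (dent z)) by rewrite /dent_q; ring.
apply: le_trans (ler_normB _ _) _; lra.
Qed.

End ModelMap.

(** * The Lipschitz perturbation *)

Section LipschitzEstimates.
Variable R : realType.
Implicit Types a b c p y x z t : R.

Lemma lipschitz_of_derive (f df : R -> R) (c a b : R) : a <= b ->
  (forall z, a <= z <= b -> is_derive z 1 f (df z)) ->
  (forall z, a < z < b -> `|df z| <= c) -> `|f b - f a| <= c * (b - a).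
Proof.
rewrite le_eqVlt => /predU1P[<- _ _|ab fd dfc]; first by rewrite !subrr normr0 mulr0.
have [z [zab ->]] := mean_value _ _ _ _ _ ab fd.
have ab0 : 0 <= b - a by rewrite subr_ge0 ltW.
by rewrite normrM (ger0_norm ab0) ler_wpM2r// dfc.
Qed.

Lemma lipschitz_intermediate_value (f : R -> R) (c a b v : R) : a <= b ->
  (forall s t, a <= s <= b -> a <= t <= b -> `|f s - f t| <= c * `|s - t|) ->
  f a <= v <= f b -> exists2 z, a <= z <= b & f z = v.
Proof.
move=> ab fl /andP[av vb]; have fab := le_trans av vb.
have [||z] := @IVT R f a b v ab.
- apply/subspace_continuousP => x; rewrite /= in_itv/= => xab.
  apply/cvgrPdist_lt => d d0; rewrite near_withinE.
  have c0 : 0 < `|c| + 1 by rewrite ltr_wpDl.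
  near=> t => /=; rewrite in_itv/= => tab.
  apply: le_lt_trans (fl _ _ xab tab) _.
  apply: (@le_lt_trans _ _ ((`|c| + 1) * `|x - t|)).
    by rewrite ler_wpM2r//; have := ler_norm c; lra.
  rewrite -ltr_pdivlMl//; near: t.
  by apply: cvgr_dist_lt; [exact: cvg_id|rewrite mulr_gt0// invr_gt0].
- by rewrite (min_idPl fab) (max_idPr fab) av.
- by rewrite in_itv/= => zab <-; exists z.
Unshelve. all: by end_near. Qed.

(** Homogeneous of degree one, hence Lipschitz up to the origin. For p, y > 0 it carries the angular
    terms of the model: [hat y p] is y * [angle p y] and [hat p y] is p (pi / 2 - [angle p y]). *)
Definition hat a b := a * atan (b / a).

Lemma hatN a b : hat (- a) b = - a * - atan (b / a).
Proof. by rewrite /hat invrN mulrN atanN. Qed.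

Lemma hat_norm a b : hat `|a| b = hat a b.
Proof.
have [a0|a0] := lerP 0 a; first by rewrite ger0_norm.
by rewrite ltr0_norm// hatN mulrNN.
Qed.

Lemma atan_lipschitz x y : `|atan x - atan y| <= `|x - y|.
Proof.
wlog xy : x y / y <= x => [H|].
  by have [/H//|/ltW/H] := leP y x; rewrite distrC (distrC y).
rewrite (ger0_norm (_ : 0 <= x - y)) ?subr_ge0// -[leRHS]mul1r.
apply: (@lipschitz_of_derive atan (fun z => (1 + z ^+ 2)^-1)) => // z _.
rewrite ger0_norm ?invr_ge0 ?addr_ge0 ?sqr_ge0//.
by rewrite invf_le1 ?ltr_pwDl ?sqr_ge0// lerDl sqr_ge0.
Qed.

Lemma hat_lipschitz_r a y z : `|hat a y - hat a z| <= `|y - z|.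
Proof.
rewrite /hat -mulrBr normrM; have [->|a0] := eqVneq a 0; first by rewrite normr0 mul0r.
apply: le_trans (ler_wpM2l (normr_ge0 a) (atan_lipschitz _ _)) _.
by rewrite -normrM -mulrBl mulrCA mulfV// mulr1.
Qed.

Lemma atan_norm_le2 x : `|atan x| <= 2.
Proof.
have := @pihalf_lt2 R; have := atan_ltpi2 x; have := atan_gtNpi2 x => *.
by rewrite ler_norml; apply/andP; split; lra.
Qed.

Lemma hat_norm_le a b : `|hat a b| <= 2 * `|a|.
Proof. by rewrite /hat normrM mulrC ler_wpM2r// atan_norm_le2. Qed.

(** [hat] is even in its first argument, so both values may be taken nonnegative. The derivative is
    atan t - t / (1 + t^2) with t = b / z, bounded by 2 + 1; the end point 0 is treated apart
    because of the division. *)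
Lemma hat_lipschitz_l a c b : `|hat a b - hat c b| <= 3 * `|a - c|.
Proof.
wlog ac : a c / `|c| <= `|a| => [H|].
  by have [/H//|/ltW/H] := leP `|c| `|a|; rewrite distrC (distrC c).
rewrite -(hat_norm a) -(hat_norm c).
apply: (@le_trans _ _ (3 * (`|a| - `|c|))); last first.
  by rewrite ler_pM2l// (le_trans _ (lerB_dist _ _))// ler_norm.
move: `|a| `|c| (normr_ge0 c) ac => {a c} a c c0 ac.
move: c0; rewrite le_eqVlt => /predU1P[cE|c0].
  rewrite -{}cE in ac *; rewrite subr0 {2}/hat mul0r subr0; have a0 : 0 <= a by lra.
  apply: le_trans (hat_norm_le _ _) _; by rewrite ger0_norm//; lra.
apply: (@lipschitz_of_derive (fun z => hat z b)
  (fun z => atan (b / z) - (b / z) / (1 + (b / z) ^+ 2))) => // z /andP[cz _].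
  have z0 : z != 0 by rewrite gt_eqF// (lt_le_trans c0).
  have r0 : (z ^+ 2 + b ^+ 2 == 0) = false.
    by rewrite gt_eqF// ltr_pwDl ?sqr_ge0// exprn_even_gt0.
  by rewrite /hat; derive => //; field; rewrite z0 r0.
have s0 : 0 < 1 + (b / z) ^+ 2 by rewrite ltr_pwDl ?sqr_ge0.
apply: le_trans (ler_normB _ _) _.
suff : `|b / z / (1 + (b / z) ^+ 2)| <= 1 by have := atan_norm_le2 (b / z); lra.
rewrite normrM normfV (gtr0_norm s0) ler_pdivrMr// mul1r.
by rewrite -[(b / z) ^+ 2]real_normK ?num_real//; have := sqr_ge0 (`|b / z| - 1); nra.
Qed.

(** Soft thresholding: for y >= 0, t minus its projection onto [-y, y]. It is t on the axis y = 0
    and vanishes once y >= |t|, so it corrects the bottom edge without acting far from it. *)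
Definition soft t y := t - Num.max (- y) (Num.min t y).

Lemma max_lipschitz a b c t : `|Num.max a b - Num.max c t| <= `|a - c| + `|b - t|.
Proof.
have h1 := ler_norm (a - c); have h2 := ler_norm (b - t).
have h3 := ler_norm (c - a); have h4 := ler_norm (t - b).
rewrite distrC in h3; rewrite distrC in h4.
by rewrite ler_norml !maxEle; case: ifP => /=; case: ifP => /= ? ?; apply/andP; split; lra.
Qed.

Lemma min_lipschitz a b c t : `|Num.min a b - Num.min c t| <= `|a - c| + `|b - t|.
Proof.
have h1 := ler_norm (a - c); have h2 := ler_norm (b - t).
have h3 := ler_norm (c - a); have h4 := ler_norm (t - b).
rewrite distrC in h3; rewrite distrC in h4.
by rewrite ler_norml !minEle; case: ifP => /=; case: ifP => /= ? ?; apply/andP; split; lra.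
Qed.

Lemma soft_lipschitz t y a z : `|soft t y - soft a z| <= 2 * `|t - a| + 2 * `|y - z|.
Proof.
have h1 := max_lipschitz (- y) (Num.min t y) (- z) (Num.min a z).
have h2 := min_lipschitz t y a z.
have h3 : `|- y - - z| = `|y - z| by rewrite -opprD normrN.
rewrite /soft (_ : _ - _ - _ = (t - a) -
  (Num.max (- y) (Num.min t y) - Num.max (- z) (Num.min a z))); last by ring.
apply: le_trans (ler_normB _ _) _; lra.
Qed.

Lemma soft0r t : soft t 0 = t.
Proof. by rewrite /soft oppr0 maxEle minEle; case: ifP; case: ifP => /=; lra. Qed.

Lemma soft_eq0 t y : `|t| <= y -> soft t y = 0.
Proof.
rewrite ler_norml => /andP[yt ty].
by rewrite /soft (min_idPl ty) (max_idPr yt) subrr.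
Qed.

Definition log_radius_max p y := ln (Num.max (p ^+ 2 + y ^+ 2) 1) / 2.

Lemma ln_lipschitz a b : 1 <= a -> 1 <= b -> `|ln a - ln b| <= `|a - b|.
Proof.
wlog ab : a b / b <= a => [H|].
  move=> a1 b1; have [/H->//|/ltW/H] := leP b a.
  by rewrite distrC (distrC b); exact.
move=> a1 b1; rewrite (ger0_norm (_ : 0 <= a - b)) ?subr_ge0// -[leRHS]mul1r.
apply: (@lipschitz_of_derive (@ln R) (fun z => z^-1)) => // z /andP[bz _].
  by apply: is_derive1_ln; lra.
by rewrite ger0_norm ?invr_ge0 ?invf_le1; lra.
Qed.

Definition box p y := `|p| <= 3 /\ 0 <= y <= 3.

Lemma log_radius_max_lipschitz p y q z : box p y -> box q z ->
  `|log_radius_max p y - log_radius_max q z| <= 3 * `|p - q| + 3 * `|y - z|.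
Proof.
move=> [p3 /andP[y0 y3]] [q3 /andP[z0 z3]]; rewrite /log_radius_max -mulrBl normrM.
rewrite [X in _ * X]ger0_norm ?invr_ge0// ler_pdivrMr//.
apply: le_trans (ln_lipschitz _ _ _ _) _; rewrite ?le_max ?lexx ?orbT//.
apply: le_trans (max_lipschitz _ _ _ _) _; rewrite subrr normr0 addr0.
have -> : p ^+ 2 + y ^+ 2 - (q ^+ 2 + z ^+ 2) = (p + q) * (p - q) + (y + z) * (y - z).
  by ring.
apply: le_trans (ler_normD _ _) _; rewrite !normrM.
have h1 : `|p + q| <= 6 by apply: le_trans (ler_normD _ _) _; lra.
have h2 : `|y + z| <= 6 by rewrite ger0_norm; lra.
have := ler_wpM2r (normr_ge0 (p - q)) h1; have := ler_wpM2r (normr_ge0 (y - z)) h2; lra.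
Qed.

Lemma log_radius_max_bounds p y : box p y -> 0 <= log_radius_max p y <= 9.
Proof.
move=> [p3 /andP[y0 y3]]; rewrite /log_radius_max; apply/andP; split.
  by rewrite divr_ge0// ln_ge0// le_max lexx orbT.
have m0 : 0 <= Num.max (p ^+ 2 + y ^+ 2) 1 by rewrite le_max ler01 orbT.
have h := ln_le_id _ _ m0; rewrite ler_pdivrMr//; apply: le_trans h _.
rewrite ge_max -[p ^+ 2]real_normK ?num_real//; apply/andP; split; last by lra.
have := normr_ge0 p; nra.
Qed.

Lemma log_radius_max_inner p y : p ^+ 2 + y ^+ 2 <= 1 -> log_radius_max p y = 0.
Proof. by move=> h; rewrite /log_radius_max (max_idPr h) ln1 mul0r. Qed.

Lemma log_radius_max_outer p y : 1 <= p ^+ 2 + y ^+ 2 ->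
  log_radius_max p y = log_radius R p y.
Proof. by move=> h; rewrite /log_radius_max (max_idPl h). Qed.

Lemma mul_lipschitz a b c t A B : `|a| <= A -> `|t| <= B ->
  `|a * b - c * t| <= A * `|b - t| + B * `|a - c|.
Proof.
move=> aA tB; have -> : a * b - c * t = a * (b - t) + t * (a - c) by ring.
apply: le_trans (ler_normD _ _) _; rewrite !normrM.
by apply: lerD; rewrite ler_wpM2r.
Qed.

End LipschitzEstimates.

(** * The modified coordinates *)

Section PerturbationMap.
Variables (R : realType) (e : R).
Hypothesis e_gt0 : 0 < e.
Hypothesis e_small : 100 * e <= 1.
Implicit Types p y x q z h a b : R.

Local Notation dent_q := (@dent_q R e).
Local Notation lambda := (@dent_radius R e).
Local Notation lm := (@log_radius_max R).
Local Notation hat := (@hat R).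

Lemma dent_radius_le : lambda <= e.
Proof.
rewrite /dent_radius expRN -[leRHS]invrK lef_pV2 ?posrE ?expR_gt0 ?invr_gt0//.
by have := @expR_ge1Dx R e^-1; lra.
Qed.

(** Without a dent the value of q on the axis y = 0 is - e a pi / 2. The gap is the deviation of
    [dent_q] from it, divided by - e, so that it is Lipschitz uniformly in e. *)
Definition dent_gap a := - dent_q a / e - a * (pi / 2).

Lemma dent_gap0 a : lambda <= a -> dent_gap a = 0.
Proof.
move=> la; rewrite /dent_gap /dent_q dent0// /model_q /angle !mul0r atan0.
by field; rewrite gt_eqF.
Qed.

(** The constant is 4, from [dent_q_lipschitz] divided by e, plus pi / 2 <= 2. Beyond [dent_radius]
    the gap is zero, so a pair straddling it is compared through that point. *)
Lemma dent_gap_lipschitz a b : 0 < a -> 0 < b -> `|dent_gap a - dent_gap b| <= 6 * `|a - b|.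
Proof.
have near c t : 0 < c -> c <= t -> t <= lambda ->
    `|dent_gap t - dent_gap c| <= 6 * (t - c).
  move=> c0 ct tl; have h := dent_q_lipschitz _ _ e_gt0 _ _ c0 ct tl.
  have -> : dent_gap t - dent_gap c =
      - ((dent_q t - dent_q c) / e) - (t - c) * (pi / 2) by rewrite /dent_gap; ring.
  apply: le_trans (ler_normB _ _) _; rewrite normrN !normrM.
  rewrite normfV (gtr0_norm e_gt0) (ger0_norm (_ : 0 <= t - c)) ?subr_ge0//.
  have pp : `|pi / 2 : R| <= 2.
    by rewrite ger0_norm; have := @pihalf_lt2 R; have := @pihalf_ge1 R; lra.
  have h1 : `|dent_q t - dent_q c| / e <= 4 * (t - c).
    by rewrite ler_pdivrMr//; lra.
  have h2 := ler_wpM2l (_ : 0 <= t - c) pp; rewrite subr_ge0 in h2.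
  have := h2 ct; rewrite normrM; lra.
wlog ab : a b / a <= b => [H a0 b0|a0 b0].
  by have [/H->//|/ltW/H] := leP a b; rewrite distrC (distrC a); exact.
rewrite distrC (distrC a) (ger0_norm (_ : 0 <= b - a)) ?subr_ge0//.
have [bl|bl] := leP b lambda; first exact: near.
rewrite (dent_gap0 b (ltW bl)) sub0r normrN.
have [al|al] := leP lambda a; first by rewrite dent_gap0// normr0; lra.
have := near a lambda a0 (ltW al) (lexx _); rewrite dent_gap0// sub0r normrN; lra.
Qed.

(* The 6-Lipschitz even extension of [dent_gap] to the whole line. *)
Definition gap p := inf [set dent_gap a + 6 * `| `|p| - a| | a in [set a | 0 < a]].

Lemma gap_has_inf p : has_inf [set dent_gap a + 6 * `| `|p| - a| | a in [set a | 0 < a]].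
Proof.
split; first by exists (dent_gap 1 + 6 * `| `|p| - 1|), 1 => /=.
exists (dent_gap 1 - 6 * `| `|p| - 1|) => _ [a /= a0 <-].
have h := dent_gap_lipschitz 1 a ltr01 a0.
have h1 := ler_norm (dent_gap 1 - dent_gap a).
have h2 := ler_distD `|p| 1 a; rewrite (distrC 1 `|p|) in h2; lra.
Qed.

Lemma gapE p : p != 0 -> gap p = dent_gap `|p|.
Proof.
move=> p0; have ap : 0 < `|p| by rewrite normr_gt0.
apply/eqP; rewrite eq_le; apply/andP; split.
  apply: ge_inf; first by have [] := gap_has_inf p.
  by exists `|p|; rewrite // subrr normr0 mulr0 addr0.
apply: lb_le_inf; first by have [] := gap_has_inf p.
move=> _ [a /= a0 <-]; have := dent_gap_lipschitz `|p| a ap a0.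
by have := ler_norm (dent_gap `|p| - dent_gap a); lra.
Qed.

Lemma gap_lipschitz p z : `|gap p - gap z| <= 6 * `|p - z|.
Proof.
suff H a b : gap a <= gap b + 6 * `|a - b|.
  have h1 := H p z; have h2 := H z p; rewrite (distrC z) in h2.
  by rewrite ler_norml; apply/andP; split; lra.
rewrite -lerBlDr; apply: lb_le_inf; first by have [] := gap_has_inf b.
move=> _ [t /= t0 <-]; rewrite lerBlDr.
apply: (@le_trans _ _ (dent_gap t + 6 * `| `|a| - t|)).
  by apply: ge_inf; [have [] := gap_has_inf a|exists t].
have h2 := ler_distD `|b| `|a| t; have h3 := lerB_dist a b.
have : `| `|a| - `|b| | <= `|a - b|.
  rewrite ler_norml; have := lerB_dist b a; rewrite distrC => h4; apply/andP; split; lra.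
lra.
Qed.

(** [gap] vanishes for |p| >= [dent_radius]; otherwise |p - lambda| < 2 lambda <= 2 e, and the
    Lipschitz constant 6 gives 12 e. *)
Lemma gap_norm_le p : `|gap p| <= 1 / 2.
Proof.
have l0 : 0 < lambda := expR_gt0 _; have le := dent_radius_le.
have gl : gap lambda = 0 by rewrite gapE ?gt_eqF// gtr0_norm// dent_gap0.
have [lp|lp] := leP lambda `|p|.
  have p0 : p != 0 by rewrite -normr_gt0 (lt_le_trans l0).
  by rewrite gapE// dent_gap0// normr0.
have := gap_lipschitz p lambda; rewrite gl subr0.
have := ler_normB p lambda; rewrite (gtr0_norm l0); have := e_small; lra.
Qed.

(** Outside the unit disc either |p| >= [dent_radius], where the gap is zero, or p is tiny and y >=
    1 / 2. Hence [soft] vanishes there and [ext_q] coincides with [model_q]. *)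
Lemma gap_outer p y : 0 <= y -> 1 <= p ^+ 2 + y ^+ 2 -> `|gap p| <= y.
Proof.
move=> y0 r1; have [lp|lp] := leP lambda `|p|.
  have l0 : 0 < lambda := expR_gt0 _.
  have p0 : p != 0 by rewrite -normr_gt0 (lt_le_trans l0).
  by rewrite gapE// dent_gap0// normr0.
apply: le_trans (gap_norm_le p) _; rewrite leNgt; apply/negP => y1.
have le := dent_radius_le; have es := e_small; have eg := e_gt0.
have : p ^+ 2 < 1 / 4 by rewrite -real_normK ?num_real//; have := normr_ge0 p; nra.
nra.
Qed.

(* [model_x] and [model_q] modified inside the unit disc so as to become
   Lipschitz perturbations of the coordinates: the logarithm is truncated, and
   the term in [gap] sends the axis [y = 0] to the graph of [dent_q]. *)
Definition shift_x p y := p * lm p y + hat y p.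
Definition shift_q p y := y * lm p y - `|p| * (pi / 2) + hat p y - soft R (gap p) y.
Definition ext_x p y := p + e * shift_x p y.
Definition ext_q p y := y + e * shift_q p y.

(** 40 is a round constant that also serves [shift_q]; with 100 * e <= 1 it makes [ext_x] increasing
    in p and [ext_q] increasing in y. *)
Lemma shift_x_lipschitz p y q z : box R p y -> box R q z ->
  `|shift_x p y - shift_x q z| <= 40 * (`|p - q| + `|y - z|).
Proof.
move=> b1 b2; have [p3 /andP[y0 y3]] := b1; have [q3 /andP[z0 z3]] := b2.
have h1 := log_radius_max_lipschitz _ _ _ _ _ b1 b2.
have /andP[h2 h2'] := log_radius_max_bounds _ _ _ b2.
have l9 : `|lm q z| <= 9 by rewrite ger0_norm.
have h3 := mul_lipschitz _ _ (lm p y) _ _ _ _ p3 l9.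
have h4 := hat_lipschitz_r _ y p q; have h5 := hat_lipschitz_l _ y z q.
have -> : shift_x p y - shift_x q z = (p * lm p y - q * lm q z) +
  ((hat y p - hat y q) + (hat y q - hat z q)) by rewrite /shift_x; ring.
apply: le_trans (ler_normD _ _) _.
have h6 := ler_normD (hat y p - hat y q) (hat y q - hat z q).
have h7 := h3 q.
have := normr_ge0 (p - q); have := normr_ge0 (y - z); lra.
Qed.

Lemma shift_q_lipschitz p y q z : box R p y -> box R q z ->
  `|shift_q p y - shift_q q z| <= 40 * (`|p - q| + `|y - z|).
Proof.
move=> b1 b2; have [p3 /andP[y0 y3]] := b1; have [q3 /andP[z0 z3]] := b2.
have h1 := log_radius_max_lipschitz _ _ _ _ _ b1 b2.
have /andP[h2 h2'] := log_radius_max_bounds _ _ _ b2.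
have l9 : `|lm q z| <= 9 by rewrite ger0_norm.
have y3' : `|y| <= 3 by rewrite ger0_norm.
have h3 := mul_lipschitz _ _ (lm p y) z _ _ _ y3' l9.
have h4 := hat_lipschitz_r _ p y z; have h5 := hat_lipschitz_l _ p q z.
have h6 := soft_lipschitz _ (gap p) y (gap q) z.
have h7 := gap_lipschitz p q.
have h8 : `|(`|p| - `|q|) * (pi / 2)| <= 2 * `|p - q|.
  rewrite normrM mulrC ler_pM//; last first.
    rewrite ler_norml; have := lerB_dist q p; have := lerB_dist p q.
    by rewrite (distrC q p) => h4' h4''; apply/andP; split; lra.
  by rewrite ger0_norm; have := @pihalf_lt2 R; have := @pihalf_ge1 R; lra.
have -> : shift_q p y - shift_q q z = (y * lm p y - z * lm q z) +
  (((hat p y - hat p z) + (hat p z - hat q z)) - (`|p| - `|q|) * (pi / 2)) -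
  (soft R (gap p) y - soft R (gap q) z) by rewrite /shift_q; ring.
apply: le_trans (ler_normB _ _) _.
have h10 := ler_normD (y * lm p y - z * lm q z)
  (((hat p y - hat p z) + (hat p z - hat q z)) - (`|p| - `|q|) * (pi / 2)).
have h11 := ler_normB ((hat p y - hat p z) + (hat p z - hat q z))
   ((`|p| - `|q|) * (pi / 2)).
have h12 := ler_normD (hat p y - hat p z) (hat p z - hat q z).
have := normr_ge0 (p - q); have := normr_ge0 (y - z); lra.
Qed.

Lemma shift_norm_le p y : box R p y -> `|shift_x p y| <= 40 /\ `|shift_q p y| <= 40.
Proof.
move=> b; have [p3 /andP[y0 y3]] := b.
have /andP[h2 h2'] := log_radius_max_bounds _ _ _ b.
have h3 := hat_norm_le _ y p; have h4 := hat_norm_le _ p y.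
rewrite (ger0_norm y0) in h3.
have l9 : `|lm p y| <= 9 by rewrite ger0_norm.
split.
  apply: le_trans (ler_normD _ _) _; rewrite normrM.
  by have := ler_pM (normr_ge0 _) (normr_ge0 _) p3 l9; lra.
rewrite /shift_q.
have h5 := soft_lipschitz _ (gap p) y 0 y; rewrite subrr normr0 subr0 in h5.
rewrite (soft_eq0 _ 0) ?normr0// subr0 in h5.
have h6 := gap_norm_le p.
have h8 : `| `|p| * (pi / 2)| <= 3 * 2.
  rewrite normrM ler_pM// ?normr_id//.
  by rewrite ger0_norm; have := @pihalf_lt2 R; have := @pihalf_ge1 R; lra.
have h9 : `|y * lm p y| <= 3 * 9 by rewrite normrM ler_pM// ger0_norm.
have h10 := ler_normB (y * lm p y - `|p| * (pi / 2) + hat p y) (soft R (gap p) y).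
have h11 := ler_normD (y * lm p y - `|p| * (pi / 2)) (hat p y).
have h12 := ler_normB (y * lm p y) (`|p| * (pi / 2)).
lra.
Qed.

Lemma ext_x_lt p q y : box R p y -> box R q y -> p < q -> ext_x p y < ext_x q y.
Proof.
move=> b1 b2 pq; have := shift_x_lipschitz _ _ _ _ b1 b2.
rewrite subrr normr0 addr0 distrC (distrC p).
rewrite (gtr0_norm (_ : 0 < q - p)) ?subr_gt0// => h.
have := ler_norm (- (shift_x q y - shift_x p y)); rewrite normrN => h1.
have qp : 0 < q - p by lra.
rewrite /ext_x -subr_gt0.
have : 0 <= shift_x q y - shift_x p y + 40 * (q - p) by lra.
move=> /(ler_wpM2l (ltW e_gt0)); have := e_small; have := e_gt0; nra.
Qed.

Lemma ext_q_lt p y z : box R p y -> box R p z -> y < z -> ext_q p y < ext_q p z.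
Proof.
move=> b1 b2 yz; have := shift_q_lipschitz _ _ _ _ b1 b2.
rewrite subrr normr0 add0r distrC (distrC y).
rewrite (gtr0_norm (_ : 0 < z - y)) ?subr_gt0// => h.
have := ler_norm (- (shift_q p z - shift_q p y)); rewrite normrN => h1.
have qp : 0 < z - y by lra.
rewrite /ext_q -subr_gt0.
have : 0 <= shift_q p z - shift_q p y + 40 * (z - y) by lra.
move=> /(ler_wpM2l (ltW e_gt0)); have := e_small; have := e_gt0; nra.
Qed.

Lemma ext_xN p y : ext_x (- p) y = - ext_x p y.
Proof.
by rewrite /ext_x /shift_x /log_radius_max /hat sqrrN !mulNr atanN; ring.
Qed.

(** The truncated logarithm and [hat y p] are nonnegative. Consequently |p| <= |x|, so the preimage
    of an abscissa in [-3, 3] is found in the same interval. *)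
Lemma ext_x_ge p y : 0 <= p -> 0 <= y -> p <= ext_x p y.
Proof.
move=> p0 y0; rewrite /ext_x lerDl mulr_ge0 ?(ltW e_gt0)// addr_ge0//.
  by rewrite mulr_ge0// divr_ge0// ln_ge0// le_max lexx orbT.
by rewrite mulr_ge0// atan_ge0// divr_ge0.
Qed.

Lemma ext_x_surj x y : `|x| <= 3 -> 0 <= y <= 3 -> exists2 p, `|p| <= 3 & ext_x p y = x.
Proof.
move=> x3 y3; have /andP[y0 _] := y3.
have three : (0 : R) <= 3 by [].
have [|||p] := @lipschitz_intermediate_value R (fun p => ext_x p y) (1 + e * 40) (- 3) 3 x.
- by lra.
- move=> s t s3 t3; rewrite -ler_norml in s3; rewrite -ler_norml in t3.
  have b1 : box R s y by []. have b2 : box R t y by [].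
  have h := shift_x_lipschitz _ _ _ _ b1 b2.
  rewrite subrr normr0 addr0 in h.
  have -> : ext_x s y - ext_x t y = (s - t) + e * (shift_x s y - shift_x t y).
    by rewrite /ext_x; ring.
  apply: le_trans (ler_normD _ _) _; rewrite normrM (gtr0_norm e_gt0).
  by have := ler_wpM2l (ltW e_gt0) h; lra.
- rewrite ext_xN; have := ext_x_ge 3 y three y0.
  by move: x3; rewrite ler_norml => /andP[]; lra.
- by rewrite -ler_norml => p3 pE; exists p.
Qed.

Lemma ext_x_norm p y : 0 <= y -> `|p| <= `|ext_x p y|.
Proof.
move=> y0; have [p0|p0] := lerP 0 p.
  by rewrite ger0_norm// (le_trans (ext_x_ge _ _ p0 y0))// ler_norm.
rewrite -normrN -(normrN (ext_x p y)) -ext_xN ger0_norm; last by lra.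
by apply: le_trans (ler_norm _); apply: ext_x_ge => //; lra.
Qed.

Lemma ext_x_outer p y : 0 < p -> 0 < y -> 1 <= p ^+ 2 + y ^+ 2 -> ext_x p y = model_x R e p y.
Proof.
move=> p0 y0 r1; rewrite /ext_x /shift_x log_radius_max_outer// /model_x /hat.
by rewrite angleE.
Qed.

Lemma ext_q_outer p y : 0 < p -> 0 < y -> 1 <= p ^+ 2 + y ^+ 2 -> ext_q p y = model_q R e p y.
Proof.
move=> p0 y0 r1; rewrite /ext_q /shift_q log_radius_max_outer// soft_eq0; last first.
  by apply: gap_outer => //; exact: ltW.
by rewrite /model_q /hat /angle gtr0_norm//; ring.
Qed.

Lemma ext_q_bottom p : 0 < p -> ext_q p 0 = dent_q p.
Proof.
move=> p0; rewrite /ext_q /shift_q soft0r gapE ?gt_eqF// gtr0_norm// /hat !mul0r atan0.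
by rewrite /dent_gap; field; rewrite gt_eqF.
Qed.

Lemma ext_qN p y : ext_q (- p) y = ext_q p y.
Proof.
rewrite /ext_q /shift_q /log_radius_max sqrrN normrN hatN /hat mulrNN.
by rewrite /gap normrN.
Qed.

(** Points of the unit disc keep an abscissa below 2 in absolute value, which places them in the
    rectangle contained in the source domain. *)
Lemma ext_x_inner p y : 0 <= y -> p ^+ 2 + y ^+ 2 <= 1 -> `|ext_x p y| < 2.
Proof.
move=> y0 r1; rewrite /ext_x /shift_x log_radius_max_inner// mulr0 add0r.
have y1 : y <= 1 by nra.
have p1 : `|p| <= 1 by rewrite -(@expr_le1 _ 2)// real_normK ?num_real//; nra.
apply: le_lt_trans (ler_normD _ _) _; rewrite normrM (gtr0_norm e_gt0).
have := e_small; have := e_gt0; have := hat_norm_le _ y p; rewrite (ger0_norm y0); nra.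
Qed.

End PerturbationMap.

(** * Neighbourhoods and the Euclidean norm in the plane *)

Section PlaneTopology.
Variable R : realType.
Implicit Types (z v : R * R) (A : set (R * R)).

Definition close_to z (d : R) v := `|v.1 - z.1| < d /\ `|v.2 - z.2| < d.

Lemma ball_planeE z (d : R) v : ball z d v <-> close_to z d v.
Proof.
rewrite /ball/= /prod_ball -!ball_normE /= /close_to.
by rewrite (distrC v.1) (distrC v.2).
Qed.

Lemma nbhs_planeP z A : nbhs z A <->
  exists2 d : R, 0 < d & forall v, close_to z d v -> A v.
Proof.
split=> [/nbhs_ballP[d /= d0 dA]|[d d0 dA]].
  by exists d => // v /ball_planeE/dA.
by apply/nbhs_ballP; exists d => //= v /ball_planeE/dA.
Qed.

Lemma open_planeP A : open A <->
  forall z, A z -> exists2 d : R, 0 < d & forall v, close_to z d v -> A v.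
Proof.
rewrite openE; split=> [oA z /oA /nbhs_planeP//|H z /H ?].
by apply/nbhs_planeP.
Qed.

Lemma closure_planeP A z : closure A z <->
  forall d : R, 0 < d -> exists2 v, A v & close_to z d v.
Proof.
split=> [clA d d0|H B /nbhs_planeP[d d0 dB]].
  have [|v [Av]] := clA [set v | close_to z d v]; last by exists v.
  by apply/nbhs_planeP; exists d.
by have [v Av /dB Bv] := H d d0; exists v.
Qed.

Lemma lipschitz_within_continuous (V W : normedModType R) (A : set V) (f : V -> W) (c : R) :
  (forall s t, A s -> A t -> `|f s - f t| <= c * `|s - t|) -> {within A, continuous f}.
Proof.
move=> fl; apply/subspace_continuousP => x xA.
apply/cvgrPdist_lt => d d0; rewrite near_withinE.
have c0 : 0 < `|c| + 1 by rewrite ltr_wpDl.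
near=> t => /= tA; apply: le_lt_trans (fl _ _ xA tA) _.
apply: (@le_lt_trans _ _ ((`|c| + 1) * `|x - t|)).
  by rewrite ler_wpM2r//; have := ler_norm c; lra.
rewrite -ltr_pdivlMl//; near: t.
by apply: cvgr_dist_lt; [exact: cvg_id|rewrite mulr_gt0// invr_gt0].
Unshelve. all: by end_near. Qed.

Lemma prod_norm_le z (c : R) : (`|z| <= c) = (`|z.1| <= c) && (`|z.2| <= c).
Proof. by rewrite /Num.norm/= ge_max. Qed.

Lemma fst_norm_le z : `|z.1| <= `|z|.
Proof. by have := lexx `|z|; rewrite {1}prod_norm_le => /andP[]. Qed.

Lemma snd_norm_le z : `|z.2| <= `|z|.
Proof. by have := lexx `|z|; rewrite {1}prod_norm_le => /andP[]. Qed.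

Lemma enorm_ge0 z : 0 <= enorm z. Proof. exact: sqrtr_ge0. Qed.

Lemma enorm_le_sum z : enorm z <= `|z.1| + `|z.2|.
Proof.
rewrite /enorm -[leRHS]ger0_norm ?addr_ge0// -sqrtr_sqr ler_wsqrtr//.
rewrite /dot -!expr2 -[z.1 ^+ 2]real_normK ?num_real// -[z.2 ^+ 2]real_normK ?num_real//.
by have := mulr_ge0 (normr_ge0 z.1) (normr_ge0 z.2); nra.
Qed.

Lemma fst_le_enorm z : `|z.1| <= enorm z.
Proof.
rewrite /enorm -sqrtr_sqr ler_wsqrtr// /dot -!expr2 lerDl; exact: sqr_ge0.
Qed.

Lemma snd_le_enorm z : `|z.2| <= enorm z.
Proof.
rewrite /enorm -sqrtr_sqr ler_wsqrtr// /dot -!expr2 lerDr; exact: sqr_ge0.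
Qed.

Lemma dot_sqr_le z : dot z z = enorm z ^+ 2.
Proof. by rewrite /enorm sqr_sqrtr// /dot addr_ge0// -expr2 sqr_ge0. Qed.

Lemma enormD z v : enorm (z + v) <= enorm z + enorm v.
Proof.
rewrite -[leRHS]ger0_norm ?addr_ge0 ?enorm_ge0//.
rewrite {1}/enorm -sqrtr_sqr ler_wsqrtr// sqrrD -!dot_sqr_le.
have -> : dot (z + v) (z + v) = dot z z + dot z v *+ 2 + dot v v.
  by rewrite /dot/=; ring.
rewrite lerD2r lerD2l lerMn2r/=.
have [h|h] := leP (dot z v) 0.
  by apply: le_trans h _; rewrite mulr_ge0 ?enorm_ge0.
rewrite -ler_sqr ?nnegrE ?mulr_ge0 ?enorm_ge0 ?(ltW h)// exprMn -!dot_sqr_le /dot.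
by have := sqr_ge0 (z.1 * v.2 - z.2 * v.1); nra.
Qed.

Lemma enormN z : enorm (- z) = enorm z.
Proof. by rewrite /enorm /dot/= !mulrNN. Qed.

End PlaneTopology.

(** * The homeomorphism Phi and the target domain *)

Section PerturbedDomain.
Variables (R : realType) (e : R).
Hypothesis e_gt0 : 0 < e.
Hypothesis e_small : 1000 * e <= 1.
Variable X : set (R * R).
Hypothesis openX : open X.
Hypothesis connectedX : connected X.
Hypothesis X_bound : forall z, X z -> `|z.1| < 5 / 2 /\ 0 < z.2 < 2.
Hypothesis X_flat : forall z, `|z.1| < 2 -> 0 < z.2 <= 1 -> X z.
Implicit Types (z v : R * R) (p y : R).

Local Notation ext_x := (@ext_x R e).
Local Notation ext_q := (@ext_q R e).
Local Notation sx := (@shift_x R).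
Local Notation sq := (@shift_q R e).

Let es : 100 * e <= 1. Proof. have h := e_small; have := e_gt0; lra. Qed.

Definition strip : set (R * R) := [set z | `|z.1| <= 3 /\ 0 <= z.2 <= 3].

Lemma closure_strip z : closure X z -> strip z.
Proof.
move=> /closure_planeP H; have near d : 0 < d ->
    `|z.1| < 5 / 2 + d /\ - d < z.2 < 2 + d.
  move=> d0; have [v /X_bound[v1 /andP[v2 v3]] [h1 h2]] := H d d0.
  have := ler_distD v.1 z.1 0; rewrite !subr0 (distrC z.1) => h3.
  have := ler_norm (v.2 - z.2); have := ler_norm (- (v.2 - z.2)); rewrite normrN.
  by split; [|apply/andP; split]; lra.
have [] := near (1 / 2); first by rewrite divr_gt0.
move=> n1 /andP[_ n2]; split; first by apply/ltW; lra.
apply/andP; split; last by lra.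
rewrite leNgt; apply/negP => z0; have [] := near (- z.2); first by lra.
by move=> _ /andP[]; lra.
Qed.

Lemma X_strip z : X z -> strip z.
Proof. by move=> /subset_closure; exact: closure_strip. Qed.

Lemma strip_box z p : strip z -> `|p| <= 3 -> box R p z.2.
Proof. by move=> [_ z2]. Qed.

Definition inv_x z : R := xget 0 [set p | `|p| <= 3 /\ ext_x p z.2 = z.1].

Lemma inv_xP z : strip z -> `|inv_x z| <= 3 /\ ext_x (inv_x z) z.2 = z.1.
Proof.
move=> [z1 z2]; rewrite /inv_x; case: xgetP => [_ _ //|H]; exfalso.
by have [p p3 pE] := ext_x_surj _ _ e_gt0 _ _ z1 z2; apply: (H p).
Qed.

Lemma inv_x_uniq z p : strip z -> `|p| <= 3 -> ext_x p z.2 = z.1 -> inv_x z = p.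
Proof.
move=> sz p3 pE; have [q3 qE] := inv_xP _ sz.
have b1 := strip_box _ _ sz p3; have b2 := strip_box _ _ sz q3.
case: (ltgtP (inv_x z) p) => // h.
- by have := ext_x_lt _ _ e_gt0 es _ _ _ b2 b1 h; rewrite qE pE ltxx.
- by have := ext_x_lt _ _ e_gt0 es _ _ _ b1 b2 h; rewrite qE pE ltxx.
Qed.

(** x - p has Lipschitz constant at most 40 e <= 4 / 10 in (p, y), whence 6 / 10 |a - b| is at most
    the change of x plus 4 / 10 of the change of y. *)
Lemma inv_x_lipschitz z v : strip z -> strip v ->
  `|inv_x z - inv_x v| <= 2 * (`|z.1 - v.1| + `|z.2 - v.2|).
Proof.
move=> sz sv; have [p3 pE] := inv_xP _ sz; have [q3 qE] := inv_xP _ sv.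
have h := shift_x_lipschitz _ _ _ _ _ (strip_box _ _ sz p3) (strip_box _ _ sv q3).
rewrite -pE -qE; set a := inv_x z in h *; set b := inv_x v in h *.
have -> : ext_x a z.2 - ext_x b v.2 = (a - b) + e * (sx a z.2 - sx b v.2).
  by rewrite /ext_x; ring.
have h1 := lerB_normD (a - b) (e * (sx a z.2 - sx b v.2)).
rewrite normrM (gtr0_norm e_gt0) in h1.
have h2 := ler_wpM2l (ltW e_gt0) h.
have h3 : e * (40 * (`|a - b| + `|z.2 - v.2|)) <= 4 / 10 * (`|a - b| + `|z.2 - v.2|).
  rewrite mulrA ler_wpM2r ?addr_ge0//; have := es; lra.
have := normr_ge0 (a - b); have := normr_ge0 (z.2 - v.2); lra.
Qed.

Definition perturbation z : R * R := (inv_x z, ext_q (inv_x z) z.2).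
Local Notation Phi := perturbation.

Lemma perturbation_sub_fst z : strip z -> (Phi z - z).1 = - (e * sx (inv_x z) z.2).
Proof. by move=> /inv_xP[_ h]; rewrite /= -[X in _ - X]h /ext_x; ring. Qed.

Lemma perturbation_sub_snd z : (Phi z - z).2 = e * sq (inv_x z) z.2.
Proof. by rewrite /= /ext_q; ring. Qed.

(** Both components of Phi - id are, up to sign, e times a shift evaluated at ([inv_x z], z.2). The
    two shifts contribute 80 e (|dp| + |dy|), and [inv_x_lipschitz] bounds |dp| + |dy| by 2 |dx| + 3
    |dy|. *)
Lemma perturbation_lipschitz z v : strip z -> strip v ->
  enorm ((Phi z - z) - (Phi v - v)) <= 480 * e * enorm (z - v).
Proof.
move=> sz sv; apply: le_trans (enorm_le_sum _ _) _.
have [p3 pE] := inv_xP _ sz; have [q3 qE] := inv_xP _ sv.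
have b1 := strip_box _ _ sz p3; have b2 := strip_box _ _ sv q3.
have -> : ((Phi z - z) - (Phi v - v)).1 = - (e * (sx (inv_x z) z.2 - sx (inv_x v) v.2)).
  rewrite [LHS](_ : _ = (Phi z - z).1 - (Phi v - v).1)//.
  by rewrite !perturbation_sub_fst//; ring.
have -> : ((Phi z - z) - (Phi v - v)).2 = e * (sq (inv_x z) z.2 - sq (inv_x v) v.2).
  rewrite [LHS](_ : _ = (Phi z - z).2 - (Phi v - v).2)//.
  by rewrite !perturbation_sub_snd; ring.
rewrite normrN !normrM !(gtr0_norm e_gt0) -mulrDr -mulrA mulrCA ler_pM2l//.
have h1 := shift_x_lipschitz _ _ _ _ _ b1 b2.
have h2 := shift_q_lipschitz _ _ e_gt0 _ _ _ _ b1 b2.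
have h3 := inv_x_lipschitz _ _ sz sv.
have := fst_le_enorm _ (z - v); have := snd_le_enorm _ (z - v).
by have := normr_ge0 (z - v).1; have := normr_ge0 (z - v).2; rewrite /=; lra.
Qed.

Lemma perturbation_norm z : strip z -> enorm (Phi z - z) <= 80 * e.
Proof.
move=> sz; apply: le_trans (enorm_le_sum _ _) _.
have [p3 pE] := inv_xP _ sz; have b1 := strip_box _ _ sz p3.
rewrite perturbation_sub_fst// perturbation_sub_snd normrN !normrM !(gtr0_norm e_gt0).
have [h1 h2] := shift_norm_le _ _ e_gt0 es _ _ b1.
by have := ler_wpM2l (ltW e_gt0) h1; have := ler_wpM2l (ltW e_gt0) h2; lra.
Qed.

Lemma perturbation_bilipschitz z v : strip z -> strip v ->
  2^-1 * enorm (z - v) <= enorm (Phi z - Phi v) <= 2 * enorm (z - v).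
Proof.
move=> sz sv; have h := perturbation_lipschitz _ _ sz sv.
have h0 : 480 * e * enorm (z - v) <= 2^-1 * enorm (z - v).
  rewrite ler_wpM2r ?enorm_ge0//; have := e_small; have := e_gt0; lra.
have h1 := enormD _ (z - v) ((Phi z - z) - (Phi v - v)).
have h2 := enormD _ (Phi z - Phi v) (- ((Phi z - z) - (Phi v - v))).
have E : (z - v) + ((Phi z - z) - (Phi v - v)) = Phi z - Phi v.
  by rewrite [RHS]surjective_pairing [LHS]surjective_pairing /=; congr pair; ring.
have E' : (Phi z - Phi v) - ((Phi z - z) - (Phi v - v)) = z - v by rewrite -E addrK.
rewrite E in h1; rewrite E' enormN in h2; have h3 := enorm_ge0 _ (z - v).
by apply/andP; split; lra.
Qed.

Definition perturbed_domain : set (R * R) := Phi @` X.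
Local Notation Y := perturbed_domain.

Lemma perturbation_continuous A : A `<=` strip -> {within A, continuous Phi}.
Proof.
move=> AS; apply: (@lipschitz_within_continuous _ _ _ _ _ 4) => z v /AS sz /AS sv.
have /andP[_ h] := perturbation_bilipschitz _ _ sz sv.
have h1 := enorm_le_sum _ (z - v).
have h2 := fst_norm_le _ (z - v); have h3 := snd_norm_le _ (z - v).
rewrite prod_norm_le.
have := fst_le_enorm _ (Phi z - Phi v); have := snd_le_enorm _ (Phi z - Phi v).
by move=> h4 h5; apply/andP; split; lra.
Qed.

Lemma closure_X_compact : compact (closure X).
Proof.
have c : compact (`[- 3, 3]%classic `*` `[0, 3]%classic : set (R * R)).
  by apply: compact_setX; exact: segment_compact.
apply: (subclosed_compact _ c); first exact: closed_closure.
by move=> z /closure_strip[]; rewrite ler_norml => ? ?; split; rewrite /= in_itv.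
Qed.

Lemma image_closure_compact : compact (Phi @` closure X).
Proof.
apply: continuous_compact closure_X_compact.
by apply: perturbation_continuous; exact: closure_strip.
Qed.

Lemma closure_perturbed_domain : closure Y = Phi @` closure X.
Proof.
apply/seteqP; split.
  have cl : closed (Phi @` closure X).
    by apply: compact_closed image_closure_compact; exact: norm_hausdorff.
  rewrite [X in _ `<=` X](proj1 (closure_id _) cl); apply: closureS.
  by move=> _ [z Xz <-]; exists z => //; exact: subset_closure.
move=> _ [z clz <-]; apply/closure_planeP => d d0.
have d4 : 0 < d / 8 by rewrite divr_gt0.
have [v Xv [h1 h2]] := proj1 (closure_planeP _ _ _) clz _ d4.
exists (Phi v); first by exists v.
have /andP[_ h] := perturbation_bilipschitz _ _ (X_strip _ Xv) (closure_strip _ clz).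
have h3 := enorm_le_sum _ (v - z).
have := fst_le_enorm _ (Phi v - Phi z); have := snd_le_enorm _ (Phi v - Phi z).
by rewrite /= in h3 *; move=> h4 h5; split => /=; lra.
Qed.

Lemma perturbation_bilipschitz_homeo :
  bilipschitz_homeo (closure X) (closure Y) Phi.
Proof.
split; last first.
  exists 2 => // z v /closure_strip sz /closure_strip sv.
  exact: perturbation_bilipschitz.
rewrite closure_perturbed_domain; split => //.
move=> z v; rewrite !inE => /closure_strip sz /closure_strip sv E.
have /andP[+ _] := perturbation_bilipschitz _ _ sz sv.
rewrite E subrr [X in _ <= X](_ : _ = 0) ?pmulr_rle0 ?invr_gt0//; last first.
  by rewrite /enorm /dot/= mulr0 addr0 sqrtr0.
have := fst_le_enorm _ (z - v); have := snd_le_enorm _ (z - v); rewrite /= => h1 h2 h3.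
have e1 : `|z.1 - v.1| <= 0 by lra.
have e2 : `|z.2 - v.2| <= 0 by lra.
move: e1 e2; rewrite !normr_le0 !subr_eq0 => /eqP e1 /eqP e2.
by rewrite (surjective_pairing z) e1 e2 -surjective_pairing.
Qed.

Lemma perturbed_domain_bounded : bounded_set Y.
Proof.
have [M [_ HM]] := compact_bounded image_closure_compact.
exists M; split; first exact: num_real.
by move=> M' /HM H _ [z Xz <-]; apply: H; exists z => //; exact: subset_closure.
Qed.

Lemma perturbed_domain_connected : connected Y.
Proof.
apply: connected_continuous_connected => //; apply: perturbation_continuous.
exact: X_strip.
Qed.

(** In the coordinates (p, y) the implicit [inv_x] disappears, and Y can be studied on each vertical
    line of abscissa p. *)
Lemma perturbed_domainP p q : Y (p, q) <->
  exists y, [/\ `|p| <= 3, X (ext_x p y, y) & ext_q p y = q].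
Proof.
split=> [[z Xz [<- <-]]|[y [p3 Xy <-]]].
  have [p3 pE] := inv_xP _ (X_strip _ Xz).
  by exists z.2; split => //; rewrite pE -surjective_pairing.
exists (ext_x p y, y) => //; rewrite /perturbation.
by rewrite (inv_x_uniq _ p (X_strip _ Xy)).
Qed.

Lemma ext_q_increment p y (z : R) : box R p y -> box R p z -> y <= z ->
  (z - y) / 2 <= ext_q p z - ext_q p y <= 2 * (z - y).
Proof.
move=> b1 b2 yz; have := shift_q_lipschitz _ _ e_gt0 _ _ _ _ b2 b1.
rewrite subrr normr0 add0r (ger0_norm (_ : 0 <= z - y)) ?subr_ge0// => h.
have -> : ext_q p z - ext_q p y = (z - y) + e * (sq p z - sq p y).
  by rewrite /ext_q; ring.
have h2 : `|e * (sq p z - sq p y)| <= (z - y) / 2.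
  rewrite normrM (gtr0_norm e_gt0); apply: le_trans (ler_wpM2l (ltW e_gt0) h) _.
  rewrite mulrA mulrC ler_wpM2l ?subr_ge0//; have := es; lra.
by move: h2; rewrite ler_norml => /andP[h2 h3]; apply/andP; split; lra.
Qed.

(** Openness by intermediate values on nearby fibres: for (p', q') close to (p, q), q' stays between
    the values of [ext_q p'] at y - h and y + h. The bound d1 / 4 on h keeps the resulting preimage
    in X, the other two keep all points in [box]. *)
Lemma perturbed_domain_open : open Y.
Proof.
apply/open_planeP => -[p q] /perturbed_domainP[y [p3 Xy qE]].
have [d1 d10 dX] := proj1 (open_planeP _ _) openX _ Xy.
have [x1 /andP[y0 y2]] := X_bound _ Xy; rewrite /= in x1 y0 y2.
have p5 : `|p| < 5 / 2 by apply: le_lt_trans x1; rewrite ext_x_norm// ltW.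
pose h := Num.min (d1 / 4) (Num.min (1 / 4) (y / 2)).
have h0 : 0 < h by rewrite !lt_min !divr_gt0.
have hd : h <= d1 / 4 by rewrite ge_min lexx.
have h4 : h <= 1 / 4 by rewrite !ge_min lexx orbT.
have hy : h <= y / 2 by rewrite !ge_min lexx !orbT.
exists (h / 4); first by rewrite divr_gt0.
move=> [p' q'] [/= pp qq].
have p'3 : `|p'| <= 3.
  have := ler_distD p p' 0; rewrite !subr0; lra.
have bx t : y - h <= t <= y + h -> box R p' t.
  by move=> /andP[t1 t2]; split => //; apply/andP; split; lra.
have by0 : box R p y by split => //; apply/andP; split; lra.
have by1 : box R p' y by apply: bx; lra.
have hq : `|ext_q p' y - q| <= e * (40 * `|p' - p|).
  have := shift_q_lipschitz _ _ e_gt0 _ _ _ _ by1 by0; rewrite subrr normr0 addr0 => H.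
  have -> : ext_q p' y - q = e * (sq p' y - sq p y) by rewrite -qE /ext_q; ring.
  by rewrite normrM (gtr0_norm e_gt0) ler_pM2l.
have hq2 : `|ext_q p' y - q| <= h / 8.
  apply: le_trans hq _; rewrite mulrA.
  apply: (@le_trans _ _ (1 / 2 * `|p' - p|)); last by lra.
  by rewrite ler_wpM2r//; have := es; lra.
move: hq2; rewrite ler_norml => /andP[hq2 hq3].
move: qq; rewrite ltr_norml => /andP[qq1 qq2].
have b1 : box R p' (y - h) by apply: bx; lra.
have b2 : box R p' (y + h) by apply: bx; lra.
have i1 := ext_q_increment _ _ _ b1 by1 _; have /andP[i1l _] := i1 ltac:(lra).
have i2 := ext_q_increment _ _ _ by1 b2 _; have /andP[i2l _] := i2 ltac:(lra).
have [|||y' /andP[y'1 y'2] y'E] := @lipschitz_intermediate_value R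
   (fun y => ext_q p' y) 2 (y - h) (y + h) q'.
- by lra.
- move=> s t /bx bs /bx bt; have [st|ts] := leP s t.
    have /andP[i3 i4] := ext_q_increment _ _ _ bs bt st.
    by rewrite distrC (distrC s) !ger0_norm//; lra.
  have /andP[i3 i4] := ext_q_increment _ _ _ bt bs (ltW ts).
  by rewrite !ger0_norm//; lra.
- by apply/andP; split; lra.
apply/perturbed_domainP; exists y'; split => //.
apply: dX; split => /=; last first.
  by rewrite ltr_norml; apply/andP; split; lra.
have by' : box R p' y' by apply: bx; rewrite y'1 y'2.
have := shift_x_lipschitz _ _ _ _ _ by' by0.
have -> : ext_x p' y' - ext_x p y = (p' - p) + e * (sx p' y' - sx p y).
  by rewrite /ext_x; ring.
have yh : `|y' - y| <= h by rewrite ler_norml; apply/andP; split; lra.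
move=> /(ler_wpM2l (ltW e_gt0)) H.
apply: le_lt_trans (ler_normD _ _) _; rewrite normrM (gtr0_norm e_gt0).
have : e * (40 * (`|p' - p| + `|y' - y|)) <= 1 / 2 * (`|p' - p| + `|y' - y|).
  by rewrite mulrA ler_wpM2r ?addr_ge0//; have := es; lra.
lra.
Qed.

End PerturbedDomain.

(** * Area preservation *)

Section DensityMeasure.
Local Open Scope ereal_scope.
Context {R : realType}.
Local Notation mu := (@lebesgue_measure R).

(* The proof of measurability is an argument so that the measure structure can
   be inferred. *)
Definition density_measure (f : measurableTypeR R -> R)
    of measurable_fun [set: measurableTypeR R] f :=
  fun A : set (measurableTypeR R) => \int[mu]_(x in A) (Num.max 0 (f x))%:E.
Arguments density_measure {f}.

Variable f : measurableTypeR R -> R.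
Hypothesis mf : measurable_fun [set: measurableTypeR R] f.

Let g : measurableTypeR R -> R := fun x => Num.max 0%R (f x).

Let g_ge0 x : 0 <= (g x)%:E.
Proof. by rewrite lee_fin le_max lexx. Qed.

Let mg : measurable_fun [set: measurableTypeR R] (EFin \o g).
Proof. by apply/measurable_EFinP; apply: measurable_maxr. Qed.

Let density0 : density_measure mf set0 = 0.
Proof. by rewrite /density_measure integral_set0. Qed.

Let density_ge0 A : 0 <= density_measure mf A.
Proof. by apply: integral_ge0 => x _; exact: g_ge0. Qed.

Let density_sigma_additive : semi_sigma_additive (density_measure mf).
Proof.
move=> /= A mA tA mUA; rewrite /density_measure ge0_integral_bigcup//=; last 2 first.
- by apply: measurable_funS mg.
- by move=> x _; exact: g_ge0.
by apply: is_cvg_ereal_nneg_natsum_cond => n _ _; exact: density_ge0.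
Qed.

HB.instance Definition _ := isMeasure.Build _ _ _
  (density_measure mf) density0 density_ge0 density_sigma_additive.

End DensityMeasure.
Arguments density_measure {R f}.

(** * Change of variable in one dimension, and Tonelli *)

Section ChangeOfVariable.
Context {R : realType}.
Local Notation mu := (@lebesgue_measure R).
Local Notation mR := (measurableTypeR R).
Implicit Types (F h : R -> R) (a b c : R).

Lemma measure_eq_ocitv (m1 m2 : {measure set mR -> \bar R}) :
  (forall u v : R, u <= v -> m1 `]u, v]%classic = m2 `]u, v]%classic) ->
  (forall u v : R, (m1 `]u, v]%classic < +oo)%E) ->
  forall A, measurable A -> m1 A = m2 A.
Proof.
move=> m12 m1oo A mA; apply: (@measure_unique _ R mR (@ocitv R)
  (fun n : nat => `](- n%:R : R), n%:R]%classic)) => //.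
- exact: ocitvI.
- by move=> n; exact: is_ocitv.
- apply/seteqP; split=> // x _; exists (Num.bound `|x|) => //=.
  by rewrite in_itv/=; have := archi_boundP (normr_ge0 x); rewrite ltr_norml => /andP[-> /ltW].
- move=> _ [[u v] _ <-] /=; have [uv|vu] := leP u v; first exact: m12.
  by rewrite set_itv_ge ?measure0// bnd_simp -leNgt ltW.
Qed.

(** Both sides are finite measures of A on bounded intervals, so it suffices to compare them on
    half-open intervals, where the claim is the fundamental theorem of calculus. *)
Lemma lebesgue_image_segment F h (mh : measurable_fun [set: mR] (h : mR -> R))
    b c (A : set mR) : b < c ->
  (forall p, b <= p <= c -> is_derive p 1 F (h p)) ->
  (forall p, b <= p <= c -> {for p, continuous h}) ->
  (forall p, b <= p <= c -> 0 < h p) ->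
  measurable A ->
  mu (A `&` `]F b, F c]%classic) =
  density_measure mh (`]b, c]%classic `&` F @^-1` A).
Proof.
move=> bc dF ch h0 mA.
have Flt u v : b <= u -> u < v -> v <= c -> F u < F v.
  move=> bu uv vc; apply: (@derive_gt0_lt R F h u v uv) => z /andP[uz zv].
    by apply: dF; rewrite (le_trans bu)//= (le_trans zv).
  by apply: h0; rewrite (le_trans bu) ?(ltW uz)//= (le_trans (ltW zv)).
have Fle u v : b <= u -> u <= v -> v <= c -> F u <= F v.
  by move=> bu; rewrite le_eqVlt => /predU1P[->//|uv] vc; exact/ltW/Flt.
(* Clamping p to [b, c] turns F into a function that is monotone on the whole line, hence
   measurable, so that the right-hand side becomes a pushforward. *)
pose k p := Num.max b (Num.min p c).
have kb p : b <= k p <= c by rewrite /k le_max lexx/= ge_max (ltW bc) ge_min lexx orbT.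
have kE p : b <= p <= c -> k p = p.
  by move=> /andP[bp pc]; rewrite /k (min_idPl pc) (max_idPr bp).
pose G p := F (k p).
have Gle : {homo G : u v / u <= v}.
  move=> u v uv; have /andP[b1 _] := kb u; have /andP[_ c1] := kb v.
  by apply: Fle => //; rewrite /k ge_max !le_max lexx/= le_min !ge_min uv lexx !orbT.
have mG : measurable_fun [set: mR] (G : mR -> mR).
  by apply: nondecreasing_measurable => // u v; exact: Gle.
pose m1 : {measure set mR -> \bar R} := mrestr mu (measurable_itv `]F b, F c]).
pose d : {measure set mR -> \bar R} :=
  mrestr (density_measure mh) (measurable_itv `]b, c]).
pose m2 : {measure set mR -> \bar R} :=
  measure_function_pushforward__canonical__measure_function_Measure d mG.
have m2E B : m2 B = density_measure mh (`]b, c]%classic `&` F @^-1` B).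
  rewrite /m2 /= /pushforward /d /= /mrestr setIC; congr density_measure.
  apply/seteqP; split=> p [/= pbc]; rewrite in_itv/= in pbc.
    by rewrite /G kE//; case/andP: pbc => /ltW-> ->.
  by rewrite -[X in B X]/(F p) -[in F p](kE p)//; case/andP: pbc => /ltW-> ->.
have m1E u v : m1 `]u, v]%classic = mu `]Num.max u (F b), Num.min v (F c)]%classic.
  rewrite /m1/= /mrestr; congr mu.
  apply/seteqP; split=> x /=; rewrite !in_itv/= gt_max le_min.
    by move=> [/andP[-> ->] /andP[-> ->]].
  by move=> /andP[/andP[-> ->] /andP[-> ->]].
rewrite -m2E -[LHS]/(m1 A); apply: measure_eq_ocitv mA => u v; last first.
  by rewrite m1E lebesgue_measure_itv; case: ifP => _; rewrite -?EFinB ltry.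
move=> uv; rewrite m2E m1E.
set u' := Num.max u (F b); set v' := Num.min v (F c).
have uu' : u <= u' by rewrite le_max lexx.
have vv' : v' <= v by rewrite ge_min lexx.
have [uv'|vu'] := ltP u' v'; last first.
  rewrite set_itv_ge ?bnd_simp -?leNgt// measure0.
  rewrite [X in density_measure _ X](_ : _ = set0) ?measure0//.
  rewrite -subset0 => p [/=]; rewrite !in_itv/= => /andP[bp pc] /andP[up pv].
  have F1 := Flt _ _ (lexx b) bp pc.
  have F2 := Fle _ _ (ltW bp) pc (lexx c).
  move: vu'; rewrite leNgt => /negP; apply.
  rewrite /u' /v' gt_max !lt_min.
  by rewrite (lt_le_trans up pv) (lt_le_trans up F2) (lt_le_trans F1 pv) Flt.
have Fbu : F b <= u' by rewrite le_max lexx orbT.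
have Fcv : v' <= F c by rewrite ge_min lexx orbT.
have [|b' [/andP[bb b'c] Fb']] := @intermediate_value R F h b c u' (ltW bc) dF.
  by rewrite Fbu (le_trans (ltW uv')).
have [|c' [/andP[bc' cc] Fc']] := @intermediate_value R F h b c v' (ltW bc) dF.
  by rewrite Fcv andbT (le_trans _ (ltW uv')).
have bc'' : b' < c'.
  by rewrite ltNge; apply/negP => /Fle-/(_ bc' b'c); rewrite Fb' Fc' leNgt uv'.
rewrite [X in density_measure _ X](_ : _ = `]b', c']%classic); last first.
  apply/seteqP; split=> p /=; rewrite !in_itv/=.
    move=> [/andP[bp pc] /andP[up pv]]; apply/andP; split.
      rewrite ltNge; apply/negP => /(Fle _ _ (ltW bp))-/(_ b'c).
      by rewrite Fb' leNgt gt_max up Flt.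
    rewrite leNgt; apply/negP => /(Flt _ _ bc')-/(_ pc).
    by rewrite Fc' ltNge le_min pv Fle// ltW.
  move=> /andP[bp pc]; rewrite (le_lt_trans bb bp) (le_trans pc cc)/=.
  rewrite (le_lt_trans uu') ?(le_trans _ vv')//; first by rewrite -Fc' Fle// (le_trans bb (ltW bp)).
  by rewrite -Fb' Flt// (le_trans pc).
rewrite [RHS](_ : _ = \int[mu]_(x in `]b', c']) (h x)%:E)%E; last first.
  apply: eq_integral => p; rewrite inE/= in_itv/= => /andP[bp pc].
  have hp := h0 p; rewrite (max_idPr _)// ltW// hp//.
  by rewrite (le_trans bb (ltW bp)) (le_trans pc).
rewrite lebesgue_measure_itv/= lte_fin uv' -Fc' -Fb' -EFinB.
rewrite integral_itv_obnd_cbnd; last first.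
  by apply/measurable_EFinP; exact: measurable_funTS.
have sub p : b' <= p <= c' -> b <= p <= c.
  by move=> /andP[bp pc]; rewrite (le_trans bb bp) (le_trans pc cc).
have Fc p : b' <= p <= c' -> {for p, continuous F}.
  by move=> /sub/dF/is_derive_continuous.
rewrite (@continuous_FTC2 R h F b' c')//.
- apply: continuous_in_subspaceT => p; rewrite inE/= in_itv/= => /sub; exact: ch.
- split.
  + by move=> p; rewrite in_itv/= => /andP[/ltW bp /ltW pc]; apply: ex_derive; apply/dF/sub; rewrite bp.
  + by apply: cvg_at_right_filter; apply: Fc; rewrite lexx ltW.
  + by apply: cvg_at_left_filter; apply: Fc; rewrite lexx ltW.
- move=> p; rewrite in_itv/= => /andP[/ltW bp /ltW pc]; rewrite derive1E.
  by apply: derive_val; apply/dF/sub; rewrite bp.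
Qed.

Lemma measurable_preimage_segment F h b c (A : set mR) : b < c ->
  (forall p, b <= p <= c -> is_derive p 1 F (h p)) ->
  measurable A -> measurable (`]b, c]%classic `&` F @^-1` A : set mR).
Proof.
move=> bc dF mA; rewrite (_ : _ `&` _ = `]b, c]%classic `&` (`[b, c]%classic `&` F @^-1` A)).
  apply: measurableI; first exact: measurable_itv.
  apply: (subspace_continuous_measurable_fun (D := `[b, c]%classic)) => //.
  apply/subspace_continuousP => p; rewrite /= in_itv/= => /dF/is_derive_continuous cF.
  exact: cvg_within_filter cF.
apply/seteqP; split=> p [/= pbc]; last by case.
by split=> //; split=> //; move: pbc; rewrite !in_itv/= => /andP[/ltW-> ->].
Qed.

(** Exhaustion by segments and continuity of measures from below. The end point a is approached but
    never reached, since it may be 0, where the logarithm is singular. *)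
Lemma lebesgue_image_ray F h (mh : measurable_fun [set: mR] (h : mR -> R)) a (A : set mR) :
  (forall p, a < p -> is_derive p 1 F (h p)) ->
  (forall p, a < p -> {for p, continuous h}) ->
  (forall p, a < p -> 0 < h p) ->
  measurable A -> A `<=` [set F p | p in `]a, +oo[%classic] ->
  mu A = density_measure mh (`]a, +oo[%classic `&` F @^-1` A).
Proof.
move=> dF ch h0 mA AF.
(* The offsets give b n <= a + 1 < c n already at n = 0. *)
pose b (n : nat) : R := a + n.+1%:R^-1; pose c (n : nat) : R := a + n.+2%:R.
have ab n : a < b n by rewrite ltrDl invr_gt0.
have bc n : b n < c n.
  by rewrite ltrD2l (@le_lt_trans _ _ 1) ?invf_le1 ?ler1n ?ltr1n.
have cov p : a < p -> exists N, forall n, (N <= n)%N -> b n < p <= c n.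
  move=> ap; have pa : 0 < p - a by rewrite subr_gt0.
  have pai : 0 <= (p - a)^-1 by rewrite invr_ge0 ltW.
  exists (maxn (Num.bound (p - a)^-1) (Num.bound (p - a))) => n.
  rewrite geq_max => /andP[n1 n2]; apply/andP; split.
    rewrite /b -ltrBrDl invf_plt ?posrE// (lt_le_trans (archi_boundP pai))// ler_nat.
    exact: leqW.
  rewrite /c -lerBlDl (le_trans (ltW (archi_boundP (ltW pa))))// ler_nat.
  by rewrite (leq_trans n2)// leqW.
have Flt u v : a < u -> u < v -> F u < F v.
  move=> bu uv; apply: (@derive_gt0_lt R F h u v uv) => z /andP[uz zv].
    by apply: dF; rewrite (lt_le_trans bu).
  by apply: h0; rewrite (lt_trans bu).
have Fle u v : a < u -> u <= v -> F u <= F v.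
  by move=> bu; rewrite le_eqVlt => /predU1P[->//|uv]; exact/ltW/Flt.
have Fitv n p : a < p -> (F (b n) < F p <= F (c n)) = (b n < p <= c n).
  move=> ap; congr andb.
    apply/idP/idP => [|/(Flt _ _ (ab n))//]; rewrite !ltNge; apply: contra.
    exact: Fle.
  apply/idP/idP => [|/(Fle _ _ ap)//]; rewrite !leNgt; apply: contra.
  by apply: Flt; exact: lt_trans (ab n) (bc n).
have dFn n p : b n <= p <= c n -> is_derive p 1 F (h p).
  by move=> /andP[bp _]; apply/dF/(lt_le_trans (ab n)).
pose S n := `]b n, c n]%classic `&` F @^-1` A : set mR.
pose T n := A `&` `]F (b n), F (c n)]%classic : set mR.
have ST n : mu (T n) = density_measure mh (S n).
  apply: (lebesgue_image_segment _ _ _ _ _ _ (bc n) (dFn n)) => // p /andP[bp _].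
  - by apply/ch/(lt_le_trans (ab n)).
  - by apply/h0/(lt_le_trans (ab n)).
have mS n : measurable (S n) by apply: measurable_preimage_segment (dFn n) mA.
have mT n : measurable (T n) by apply: measurableI => //; exact: measurable_itv.
have bcle m n : (m <= n)%N -> b n <= b m /\ c m <= c n.
  move=> mn; split; first by rewrite lerD2l lef_pV2 ?posrE// ler_nat.
  by rewrite lerD2l ler_nat.
have ndS : nondecreasing_seq S.
  move=> m n /bcle[bnm cmn]; apply/subsetPset => p [/=]; rewrite !in_itv/=.
  by move=> /andP[bp pc] Ap; split => //=; rewrite in_itv/= (le_lt_trans bnm bp) (le_trans pc cmn).
have ndT : nondecreasing_seq T.
  move=> m n /bcle[bnm cmn]; apply/subsetPset => x [Ax] /=; rewrite in_itv/=.
  move=> /andP[bx xc]; split => //=; rewrite in_itv/=; apply/andP; split.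
    exact: le_lt_trans (Fle _ _ (ab n) bnm) bx.
  exact: le_trans xc (Fle _ _ (lt_trans (ab m) (bc m)) cmn).
have UT : A = \bigcup_n T n.
  apply/seteqP; split=> [x Ax|x [n _ []]//].
  have [p /=] := AF _ Ax; rewrite in_itv/= andbT => ap pE.
  have [N HN] := cov p ap; exists N => //; split => //=.
  by rewrite in_itv/= -pE Fitv// HN.
have US : `]a, +oo[%classic `&` F @^-1` A = \bigcup_n S n :> set mR.
  apply/seteqP; split=> [p [/=]|p [n _ [/=]]]; rewrite in_itv/=.
    rewrite andbT => ap Ap.
    by have [N HN] := cov p ap; exists N => //; split => //=; rewrite in_itv/= HN.
  by move=> /andP[bp _] Ap; split => //=; rewrite in_itv/= andbT (lt_trans (ab n)).
rewrite US [in LHS]UT.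
have c1 := nondecreasing_cvg_mu mT (bigcupT_measurable _ mT) ndT (mu := mu).
have c2 := nondecreasing_cvg_mu mS (bigcupT_measurable _ mS) ndS (mu := density_measure mh).
rewrite (_ : mu \o T = density_measure mh \o S) in c1; last exact/funext.
exact: cvg_unique c1 c2.
Qed.

Local Notation plane := (mR * mR)%type.

Lemma tonelli_sections (D : plane -> R) (C : set plane) :
  measurable_fun [set: plane] D -> measurable C ->
  (\int[mu]_y \int[mu]_(p in ysection C y) (Num.max 0 (D (p, y)))%:E =
   \int[mu]_p \int[mu]_(y in xsection C p) (Num.max 0 (D (p, y)))%:E)%E.
Proof.
move=> mD mC; pose g z : R := Num.max 0 (D z).
pose f : plane -> \bar R := (EFin \o g) \_ C.
have mg : measurable_fun [set: plane] g by exact: measurable_maxr.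
have mf : measurable_fun [set: plane] f.
  by apply/measurable_restrict => //; apply/measurable_EFinP; exact: measurable_funTS.
have f0 z : (0 <= f z)%E.
  by rewrite /f patchE; case: ifP => // _; rewrite lee_fin le_max lexx.
have H := @fubini_tonelli _ _ mR mR R mu mu f mf f0.
transitivity (\int[mu]_y \int[mu]_p f (p, y))%E.
  apply: eq_integral => y _; rewrite integral_mkcond.
  by apply: eq_integral => p _; rewrite /f !patchE mem_ysection.
rewrite -H; apply: eq_integral => p _; rewrite [in RHS]integral_mkcond.
by apply: eq_integral => y _; rewrite /f !patchE mem_xsection.
Qed.

(** The product measure integrates the x-sections by definition; uniqueness on rectangles allows the
    other order. *)
Lemma area_ysection (A : set plane) : measurable A ->
  area A = (\int[mu]_y mu (ysection A y))%E.
Proof.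
move=> mA; rewrite /area; rewrite [LHS](@product_measure_unique _ _ mR mR R mu mu
  (product_measure2 mu mu))// => B B' mB mB'.
by rewrite /= product_measure2E.
Qed.

End ChangeOfVariable.

(** * Measurability of the model functions *)

Section Measurability.
Context {R : realType}.
Context d (T : measurableType d).
Implicit Types f g : T -> R.

Lemma measurable_fun_inv f : measurable_fun [set: T] f ->
  measurable_fun [set: T] (fun z => (f z)^-1).
Proof.
move=> mf; rewrite (_ : (fun z => _) = (fun z => f z * expR (- (2 * ln `|f z|)))).
  apply: measurable_funM => //; apply: measurableT_comp => //.
  apply: measurable_funN; apply: measurable_funM => //.
  by apply: measurableT_comp; [exact: measurable_ln|exact: measurableT_comp].
apply/funext => z; have [->|fz] := eqVneq (f z) 0; first by rewrite invr0 mul0r.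
rewrite expRN expRM_natl lnK ?posrE ?normr_gt0// real_normK ?num_real//.
by rewrite expr2 invfM mulrA mulfV// mul1r.
Qed.

Lemma measurable_lt_set f g : measurable_fun [set: T] f -> measurable_fun [set: T] g ->
  measurable [set z | f z < g z].
Proof.
move=> mf mg; have := measurable_funB mg mf => /(_ measurableT `]0, +oo[%classic).
rewrite setTI (_ : _ @^-1` _ = [set z | f z < g z]); first by apply; exact: measurable_itv.
by apply/seteqP; split=> z /=; rewrite in_itv/= andbT subr_gt0.
Qed.

Lemma measurable_fun_of_gt f : (forall c, measurable [set z | c < f z]) ->
  measurable_fun [set: T] f.
Proof.
move=> H; apply: (measurability (@RGenOInfty.G R)) => [|/= _ [_ [r ->] <-]].
  exact: RGenOInfty.measurableE.
rewrite setTI (_ : _ @^-1` _ = [set z | r < f z]); first exact: H.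
by apply/seteqP; split=> z /=; rewrite in_itv/= andbT.
Qed.

Variable e : R.

Lemma measurable_log_radius f g : measurable_fun [set: T] f -> measurable_fun [set: T] g ->
  measurable_fun [set: T] (fun z => log_radius R (f z) (g z)).
Proof.
move=> mf mg; apply: measurable_funM => //; apply: measurableT_comp; first exact: measurable_ln.
by apply: measurable_funD; exact: measurable_funX.
Qed.

Lemma measurable_angle f g : measurable_fun [set: T] f -> measurable_fun [set: T] g ->
  measurable_fun [set: T] (fun z => angle R (f z) (g z)).
Proof.
move=> mf mg; apply: measurable_funB => //; apply: measurableT_comp.
  by apply: continuous_measurable_fun => x; exact: continuous_atan.
by apply: measurable_funM => //; exact: measurable_fun_inv.
Qed.

Lemma measurable_model_x f g : measurable_fun [set: T] f -> measurable_fun [set: T] g ->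
  measurable_fun [set: T] (fun z => model_x R e (f z) (g z)).
Proof.
move=> mf mg; apply: measurable_funD => //; apply: measurable_funM => //.
apply: measurable_funD; apply: measurable_funM => //.
  exact: measurable_log_radius. exact: measurable_angle.
Qed.

Lemma measurable_model_q f g : measurable_fun [set: T] f -> measurable_fun [set: T] g ->
  measurable_fun [set: T] (fun z => model_q R e (f z) (g z)).
Proof.
move=> mf mg; apply: measurable_funD => //; apply: measurable_funM => //.
apply: measurable_funB; apply: measurable_funM => //.
  exact: measurable_log_radius. exact: measurable_angle.
Qed.

Lemma measurable_model_slope f g : measurable_fun [set: T] f -> measurable_fun [set: T] g ->
  measurable_fun [set: T] (fun z => model_slope R e (f z) (g z)).
Proof.
move=> mf mg; apply: measurable_funD => //; apply: measurable_funM => //.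
apply: measurable_funD; first exact: measurable_log_radius.
apply: measurable_funM; last exact: measurable_angle.
by apply: measurable_funM => //; exact: measurable_fun_inv.
Qed.

Lemma measurable_model_density f g : measurable_fun [set: T] f -> measurable_fun [set: T] g ->
  measurable_fun [set: T] (fun z => model_density R e (f z) (g z)).
Proof.
move=> mf mg; apply: measurable_funD => //; apply: measurable_funM => //.
by apply: measurable_funD => //; exact: measurable_log_radius.
Qed.

Lemma measurable_model_w f g : measurable_fun [set: T] f -> measurable_fun [set: T] g ->
  measurable_fun [set: T] (fun z => model_w R e (f z) (g z)).
Proof.
move=> mf mg; have mr := measurable_log_radius _ _ mf mg.
have ma := measurable_angle _ _ mf mg.
apply: measurable_funD; apply: measurable_funM => //.
- by apply: measurable_funM => //; apply: measurable_funB; exact: measurable_funX.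
- by apply: measurable_funD => //; exact: measurable_funM.
- by apply: measurable_funM => //; exact: measurable_funM.
Qed.

End Measurability.

(** * Inverting the two shears and comparing areas *)

Section ModelMeasure.
Variables (R : realType) (e : R).
Hypothesis e_gt0 : 0 < e.
Local Notation mR := (measurableTypeR R).
Local Notation plane := (mR * mR)%type.
Local Notation mu := (@lebesgue_measure R).
Implicit Types (z : plane) (p q x y : R).

Local Notation mx := (@model_x R e).
Local Notation mq := (@model_q R e).
Local Notation slope := (@model_slope R e).
Local Notation density := (@model_density R e).
Local Notation dent := (@dent R e).

(** The default value 0 outside the open quadrant matters: of [model_p z] and its value at the
    mirror point at most one is nonzero, so sums and differences of them perform the
    symmetrization. *)
Definition model_p z : R := xget 0 [set p | [/\ 0 < z.1, 0 < z.2, 0 < p & mx p z.2 = z.1]].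

Lemma model_pP z : 0 < z.1 -> 0 < z.2 ->
  [/\ 0 < model_p z, mx (model_p z) z.2 = z.1 & 0 < slope (model_p z) z.2].
Proof.
move=> x0 y0; rewrite /model_p; case: xgetP => [p _ /= [_ _ p0 pE]|H].
  by split => //; rewrite -model_x_gt0// pE.
by have [p [p0 pE]] := model_x_surj _ _ e_gt0 _ _ x0 y0; exfalso; apply: (H p).
Qed.

Lemma model_p_out z : ~ (0 < z.1 /\ 0 < z.2) -> model_p z = 0.
Proof.
move=> nz; rewrite /model_p; case: xgetP => [p _ /= [x0 y0 _ _]|//].
by exfalso; apply: nz.
Qed.

Lemma model_pK p y : 0 < p -> 0 < y -> 0 < slope p y -> model_p (mx p y, y) = p.
Proof.
move=> p0 y0 s0; have x0 : 0 < mx p y by rewrite model_x_gt0.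
have [p'0 pE _] := model_pP (mx p y, y) x0 y0.
by apply/esym/(model_x_inj _ _ e_gt0 _ _ y); rewrite ?pE.
Qed.

(** x increases with p once the slope is positive, and is nonpositive where the slope is. The
    superlevel sets of the implicit [model_p] thus become explicit inequalities, which gives its
    measurability. *)
Lemma model_p_gt c z : 0 < c -> (c < model_p z) <-> [/\ 0 < z.1, 0 < z.2 & mx c z.2 < z.1].
Proof.
move=> c0; split=> [cz|[x0 y0 cz]].
  have [x0 y0] : 0 < z.1 /\ 0 < z.2.
    by apply: contrapT => /model_p_out pz; rewrite pz ltNge ltW in cz.
  have [p0 <- s0] := model_pP _ x0 y0.
  by split => //; [rewrite model_x_gt0|exact: model_x_lt].
have [p0 pE s0] := model_pP _ x0 y0.
rewrite ltNge; apply/negP => pc; have h : 0 < slope c z.2.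
  by apply: lt_le_trans s0 _; exact: model_slope_le_l.
by have := model_x_le _ _ e_gt0 _ _ z.2 p0 pc h; rewrite pE leNgt cz.
Qed.

Let fst_mR : measurable_fun [set: plane] (fst : plane -> R) := measurable_fst.
Let snd_mR : measurable_fun [set: plane] (snd : plane -> R) := measurable_snd.

Lemma measurable_model_p : measurable_fun [set: plane] (model_p : plane -> R).
Proof.
apply: measurable_fun_of_gt => c.
have mq : measurable [set z : plane | 0 < z.1 /\ 0 < z.2].
  by apply: measurableI; apply: measurable_lt_set => //.
have [c0|c0|->] := ltgtP c 0.
- rewrite (_ : [set z | _] = setT)//; apply/seteqP; split=> // z _ /=.
  have [[x0 y0]|/model_p_out->//] := pselect (0 < z.1 /\ 0 < z.2).
  by have [p0 _ _] := model_pP _ x0 y0; exact: lt_trans p0.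
- rewrite (_ : [set z | _] = [set z : plane | 0 < z.1 /\ 0 < z.2] `&`
     [set z | mx c z.2 < z.1]).
    by apply: measurableI => //; apply: measurable_lt_set => //; apply: measurable_model_x.
  apply/seteqP; split=> z /=; first by move=> /(model_p_gt _ _ c0)[].
  by move=> [[x0 y0] cz]; apply/model_p_gt.
- rewrite (_ : [set z | _] = [set z : plane | 0 < z.1 /\ 0 < z.2])//.
  apply/seteqP; split=> z /= => [pz|[x0 y0]]; last by have [] := model_pP _ x0 y0.
  by apply: contrapT => /model_p_out E; rewrite E ltxx in pz.
Qed.

Definition model_y z : R :=
  xget 0 [set y | [/\ 0 < z.1, dent z.1 < y & mq z.1 y = z.2]].

Definition above_dent z := 0 < z.1 /\ dent_q R e z.1 < z.2.

Lemma model_q_surj p q : 0 < p -> dent_q R e p < q -> exists2 y, dent p < y & mq p y = q.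
Proof.
move=> p0 dq; have d0 := dent_ge0 _ _ e_gt0 _ p0.
(* Since M >= 1 the logarithm at (p, M) is nonnegative, so q(p, M) >= M - 2 e p >= |q|. *)
pose M := dent p + 1 + `|q| + 2 * (e * p).
have ep : 0 < e * p by rewrite mulr_gt0.
have q0 := normr_ge0 q; have M1 : 1 <= M by rewrite /M; lra.
have dM : dent p <= M by rewrite /M; lra.
have qM : q <= mq p M.
  rewrite /model_q mulrBr; have lr0 : 0 <= log_radius R p M.
    by apply: log_radius_ge0 => //; rewrite (le_trans (exprn_ege1 2 M1))// lerDr sqr_ge0.
  have a1 : angle R p M <= 2.
    have := @pihalf_lt2 R; have := angle_le_pihalf _ p M p0 (le_trans ler01 M1); lra.
  have h1 : 0 <= e * (M * log_radius R p M).
    by apply: mulr_ge0; [exact: ltW|apply: mulr_ge0 lr0; exact: le_trans M1].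
  have h2 : e * (p * angle R p M) <= 2 * (e * p).
    by rewrite mulrA mulrC ler_pM2r.
  have := ler_norm q; rewrite /M in h1 h2 *; lra.
have [||y [/andP[dy _] yE]] := @intermediate_value R (fun y => mq p y) (fun y => density p y)
  (dent p) M q dM.
- by move=> z _; exact: is_derive_model_q_r.
- by rewrite qM ltW.
exists y => //; rewrite lt_neqAle dy andbT; apply/eqP => E.
by rewrite -yE -E ltxx in dq.
Qed.

Lemma dent_q_lt p y : 0 < p -> dent p < y -> dent_q R e p < mq p y.
Proof. by move=> p0 dy; apply: model_q_lt => //; exact: dent_slope_ge0. Qed.

Lemma model_yP z : above_dent z ->
  [/\ dent z.1 < model_y z, mq z.1 (model_y z) = z.2, 0 < model_y z &
      0 < slope z.1 (model_y z)].
Proof.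
move=> [p0 dq].
have [dy yE] : dent z.1 < model_y z /\ mq z.1 (model_y z) = z.2.
  rewrite /model_y; case: xgetP => [y _ /= []//|H]; exfalso.
  by have [y dy yE] := model_q_surj _ _ p0 dq; apply: (H y).
have y0 : 0 < model_y z := le_lt_trans (dent_ge0 _ _ e_gt0 _ p0) dy.
by split => //; rewrite (model_slope_gt0 _ _ e_gt0).
Qed.

Lemma model_y_out z : ~ above_dent z -> model_y z = 0.
Proof.
move=> nz; rewrite /model_y; case: xgetP => [y _ /= [p0 dy yE]|//].
by exfalso; apply: nz; split => //; rewrite -yE dent_q_lt.
Qed.

Lemma model_yK p y : 0 < p -> dent p < y -> model_y (p, mq p y) = y.
Proof.
move=> p0 dy; have [dy' yE _ s0] := model_yP (p, mq p y) (conj p0 (dent_q_lt _ _ p0 dy)).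
rewrite /= in dy' yE s0; case: (ltgtP (model_y (p, mq p y)) y) => // h.
- by have := model_q_lt _ _ e_gt0 _ _ _ p0 (ltW s0) h; rewrite yE ltxx.
- have s1 : 0 < slope p y.
    rewrite (model_slope_gt0 _ _ e_gt0)//; exact: le_lt_trans (dent_ge0 _ _ e_gt0 _ p0) dy.
  by have := model_q_lt _ _ e_gt0 _ _ _ p0 (ltW s1) h; rewrite yE ltxx.
Qed.

(** A rational r strictly between max(c, dent) and [model_y] witnesses the inequality. The condition
    that r lies above the dent is replaced by the positivity of the slope at (z.1, r), so the
    superlevel set is a countable union of explicit sets and [dent] does not enter. *)
Lemma model_y_gt c z : 0 <= c -> (c < model_y z) <->
  exists r : rat, [/\ c <= ratr r, 0 < ratr r :> R, 0 < z.1, 0 < slope z.1 (ratr r) &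
    mq z.1 (ratr r) < z.2].
Proof.
move=> c0; split=> [cz|[r [cr r0 p0 s0 rz]]].
  have az : above_dent z.
    by apply: contrapT => /model_y_out E; rewrite E ltNge c0 in cz.
  have [dy yE y0 s0] := model_yP _ az; have [p0 _] := az.
  have m : Num.max c (dent z.1) < model_y z by rewrite gt_max cz dy.
  have [r] := rat_in_itvoo m; rewrite in_itv/= gt_max => /andP[/andP[cr dr] ry].
  have r0 : 0 < ratr r :> R := le_lt_trans c0 cr.
  have sr : 0 < slope z.1 (ratr r) by rewrite (model_slope_gt0 _ _ e_gt0).
  by exists r; split => //; [exact: ltW|rewrite -yE; apply: model_q_lt => //; exact: ltW].
have dr : dent z.1 < ratr r by rewrite -(model_slope_gt0 _ _ e_gt0).
have az : above_dent z by split => //; apply: lt_trans rz; exact: dent_q_lt.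
have [dy yE y0 _] := model_yP _ az.
apply: (le_lt_trans cr); rewrite ltNge; apply/negP; rewrite le_eqVlt => /predU1P[E|h].
  by rewrite -E yE ltxx in rz.
have h2 : 0 <= slope z.1 (model_y z) by rewrite ltW// (model_slope_gt0 _ _ e_gt0).
have := model_q_lt _ _ e_gt0 _ _ _ p0 h2 h; rewrite yE => h3.
by have := lt_trans h3 rz; rewrite ltxx.
Qed.

Lemma measurable_model_y : measurable_fun [set: plane] (model_y : plane -> R).
Proof.
apply: measurable_fun_of_gt => c; have [c0|c0] := ltP c 0.
  rewrite (_ : [set z | _] = setT)//; apply/seteqP; split=> // z _ /=.
  have [/model_yP[_ _ y0 _]|/model_y_out->//] := pselect (above_dent z).
  exact: lt_trans y0.
pose S (r : rat) : set plane := [set z | [/\ c <= ratr r, 0 < ratr r :> R, 0 < z.1,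
  0 < slope z.1 (ratr r) & mq z.1 (ratr r) < z.2]].
rewrite (_ : [set z | _] = \bigcup_r S r).
  apply: bigcupT_measurable_rat => r.
  have [cr|cr] := pselect (c <= ratr r /\ 0 < ratr r :> R); last first.
    rewrite (_ : S r = set0)//; rewrite -subset0 => z [h1 h2 _ _ _].
    by apply: cr; split.
  rewrite (_ : S r = [set z : plane | 0 < z.1] `&` ([set z : plane | 0 < slope z.1 (ratr r)] `&`
     [set z : plane | mq z.1 (ratr r) < z.2])).
    apply: measurableI; first exact: measurable_lt_set.
    apply: measurableI; apply: measurable_lt_set => //.
      exact: measurable_model_slope.
    exact: measurable_model_q.
  by apply/seteqP; split=> z /=; [move=> [_ _ ? ? ?]|move: cr => [? ?] [? [? ?]]].
apply/seteqP; split=> z /=.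
  by move=> /(model_y_gt _ _ c0)[r H]; exists r.
by move=> [r _ H]; apply/model_y_gt => //; exists r.
Qed.

Definition model_domain : set plane := [set z | [/\ 0 < z.1, 0 < z.2 & 0 < slope z.1 z.2]].
Definition source_set (C : set plane) : set plane :=
  [set z | [/\ 0 < z.1, 0 < z.2 & C (model_p z, z.2)]].
Definition target_set (C : set plane) : set plane :=
  [set z | above_dent z /\ C (z.1, model_y z)].

Lemma measurable_source_set C : measurable C -> measurable (source_set C).
Proof.
move=> mC; have m : measurable_fun [set: plane] (fun z : plane => (model_p z, z.2) : plane).
  by apply: measurable_fun_pair => //; exact: measurable_model_p.
have := m measurableT C mC; rewrite setTI => {}m.
rewrite (_ : source_set C = [set z : plane | 0 < z.1] `&` ([set z : plane | 0 < z.2] `&`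
   (fun z : plane => (model_p z, z.2) : plane) @^-1` C)).
  apply: measurableI; first exact: measurable_lt_set.
  by apply: measurableI => //; exact: measurable_lt_set.
by apply/seteqP; split=> z /=; [move=> []|move=> [? []]].
Qed.

Lemma measurable_target_set C : measurable C -> measurable (target_set C).
Proof.
move=> mC; have m : measurable_fun [set: plane] (fun z : plane => (z.1, model_y z) : plane).
  by apply: measurable_fun_pair => //; exact: measurable_model_y.
have := m measurableT C mC; rewrite setTI => {}m.
rewrite (_ : target_set C = [set z : plane | 0 < model_y z] `&`
   (fun z : plane => (z.1, model_y z) : plane) @^-1` C).
  apply: measurableI => //; apply: measurable_lt_set => //; exact: measurable_model_y.
apply/seteqP; split=> z /= [h1 h2]; first by split => //; have [] := model_yP _ h1.
by split => //; apply: contrapT => /model_y_out E; rewrite E ltxx in h1.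
Qed.

Lemma model_slope_lt_l p q y : 0 < p -> p < q -> slope p y < slope q y.
Proof.
move=> p0 pq; apply: (@derive_gt0_lt R (fun t => slope t y)
  (fun t => e * (t - y * angle R t y) / t ^+ 2) p q pq) => t.
  by move=> /andP[pz _]; apply/is_derive_model_slope_l/(lt_le_trans p0).
move=> /andP[pz _]; have t0 := lt_trans p0 pz.
by rewrite !mulr_gt0 ?invr_gt0 ?exprn_gt0// subr_gt0 mul_angle_lt.
Qed.

(** The slope increases strictly with p and exceeds 1 far away, so it is positive exactly beyond its
    zero, or on the whole half-line if it has none. *)
Lemma slope_gt0_ray y : 0 < y ->
  exists2 a, 0 <= a & forall p, a < p <-> 0 < p /\ 0 < slope p y.
Proof.
move=> y0; have [[p1 [p10 sp]]|H] := pselect (exists p, 0 < p /\ slope p y <= 0); last first.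
  exists 0 => // p; split=> [p0|[]//]; split => //; rewrite ltNge; apply/negP => h.
  by apply: H; exists p.
have p1le : p1 <= p1 + 1 by lra.
have [||g [/andP[pg _] gE]] := @intermediate_value R (fun p => slope p y)
  (fun t => e * (t - y * angle R t y) / t ^+ 2) p1 (p1 + 1) 0 p1le.
- by move=> z /andP[pz _]; apply/is_derive_model_slope_l/(lt_le_trans p10).
- rewrite sp/= (le_trans ler01)// model_slope_ge1//; [lra|exact: ltW|].
  have := sqr_ge0 y; nra.
have g0 : 0 < g := lt_le_trans p10 pg.
exists g; first exact: ltW.
move=> p; split=> [gp|[p0 s0]].
  have p0 := lt_trans g0 gp; split => //.
  by rewrite -gE; exact: model_slope_lt_l.
rewrite ltNge; apply/negP => pg'; have := model_slope_le_l _ _ e_gt0 _ _ y p0 pg'.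
by rewrite gE leNgt s0.
Qed.

Lemma model_density_continuous_l y p : 0 < p -> {for p, continuous (fun p => density p y)}.
Proof.
move=> p0; apply: (@is_derive_continuous R _ _ (e * (p / (p ^+ 2 + y ^+ 2)))).
rewrite /model_density; derive; first exact: is_derive_log_radius_l.
by ring.
Qed.

Lemma model_density_continuous_r y p : 0 < p -> {for y, continuous (fun y => density p y)}.
Proof.
move=> p0; apply: (@is_derive_continuous R _ _ (e * (y / (p ^+ 2 + y ^+ 2)))).
rewrite /model_density; derive; first exact: is_derive_log_radius_r.
by ring.
Qed.

(* Both partial maps (p, y) |-> (x, y) and (p, y) |-> (p, q) have Jacobian
   [model_density], so that (x, y) |-> (p, q) preserves the area. *)
Lemma model_area (C : set plane) : measurable C -> C `<=` model_domain ->
  area (source_set C) = area (target_set C).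
Proof.
move=> mC Csub; have mS := measurable_source_set _ mC; have mT := measurable_target_set _ mC.
pose D (z : plane) : R := density z.1 z.2.
have mD : measurable_fun [set: plane] D by exact: measurable_model_density.
rewrite area_ysection//.
transitivity (\int[mu]_y \int[mu]_(p in ysection C y) (Num.max 0 (D (p, y)))%:E)%E.
  apply: eq_integral => y _.
  have [y0|y0] := ltP 0 (y : R); last first.
    rewrite (_ : ysection (source_set C) y = set0); last first.
      rewrite -subset0 => x; rewrite /ysection/= inE => -[_ /= y0' _].
      by move: y0'; rewrite ltNge y0.
    rewrite (_ : ysection C y = set0) ?measure0 ?integral_set0//.
    rewrite -subset0 => p; rewrite /ysection/= inE => /Csub[_ /= y0' _].
    by move: y0'; rewrite ltNge y0.
  have [a a0 aP] := slope_gt0_ray _ y0.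
  have mh : measurable_fun [set: mR] ((fun p => density p y) : mR -> R).
    by apply: measurable_model_density.
  have mA : measurable (ysection (source_set C) y) by exact: measurable_ysection.
  rewrite (@lebesgue_image_ray R (fun p => mx p y) (fun p => density p y) mh a _ _ _ _ mA).
  - rewrite /density_measure; congr integral.
    apply/seteqP; split=> p; rewrite /ysection /= inE/=.
      rewrite in_itv/= andbT => -[/aP[p0 s0]]; rewrite inE => -[/= x0 _].
      by rewrite model_pK.
    move=> Cp; have [/= p0 _ s0] := Csub _ Cp.
    rewrite in_itv/= andbT; split; first exact/aP.
    by rewrite inE; split => //=; rewrite ?model_x_gt0 ?model_pK.
  - by move=> p /aP[p0 _]; exact: is_derive_model_x_l.
  - by move=> p /aP[p0 _]; exact: model_density_continuous_l.
  - move=> p /aP[p0 s0]; apply: lt_trans s0 _; exact: model_density_gt.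
  - move=> x; rewrite /ysection/= inE => -[/= x0 _ _].
    have [p0 pE s0] := model_pP (x, y) x0 y0; exists (model_p (x, y)) => //.
    by rewrite /= in_itv/= andbT; apply/aP.
rewrite tonelli_sections//; apply: eq_integral => p _.
have [p0|p0] := ltP 0 (p : R); last first.
  rewrite /= (_ : xsection (target_set C) p = set0); last first.
    rewrite -subset0 => x; rewrite /xsection/= inE => -[[/= p0' _] _].
    by move: p0'; rewrite ltNge p0.
  rewrite (_ : xsection C p = set0) ?measure0 ?integral_set0//.
  rewrite -subset0 => y; rewrite /xsection/= inE => /Csub[/= p0' _ _].
  by move: p0'; rewrite ltNge p0.
have mh : measurable_fun [set: mR] ((fun y => density p y) : mR -> R).
  by apply: measurable_model_density.
have mA : measurable (xsection (target_set C) p) by exact: measurable_xsection.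
rewrite /= (@lebesgue_image_ray R (fun y => mq p y) (fun y => density p y) mh (dent p) _ _ _ _ mA).
- rewrite /density_measure; congr integral.
  apply/seteqP; split=> y; rewrite /xsection /= inE/=.
    move=> Cp; have [/= _ y0 s0] := Csub _ Cp.
    have dy : dent p < y by rewrite -(model_slope_gt0 _ _ e_gt0).
    rewrite in_itv/= andbT; split => //; rewrite inE/=.
    by split => //=; [split => //; exact: dent_q_lt|rewrite model_yK].
  rewrite in_itv/= andbT => -[dy]; rewrite inE => -[_ /=].
  by rewrite model_yK.
- by move=> y _; exact: is_derive_model_q_r.
- by move=> y _; exact: model_density_continuous_r.
- move=> y dy; apply: le_lt_trans (model_density_gt _ _ e_gt0 _ _ p0).
  apply: le_trans (dent_slope_ge0 _ _ e_gt0 _ p0) _.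
  exact/model_slope_le_r/ltW.
- move=> q; rewrite /xsection/= inE => -[az _].
  have [dy yE y0 s0] := model_yP _ az; exists (model_y (p, q)) => //.
  by rewrite /= in_itv/= andbT.
Qed.

End ModelMeasure.

(** * Open sets, reflections and the axis under the area measure *)

Section PlaneMeasure.
Variable R : realType.
Local Notation mR := (measurableTypeR R).
Local Notation plane := (mR * mR)%type.
Local Notation mu := (@lebesgue_measure R).
Implicit Types (A : set plane) (z : plane).

(** Measurability refers to the product of the two Borel structures, so an open set is written as a
    countable union of squares with rational centres and sizes. *)
Lemma open_plane_measurable A : open (A : set (R * R)) -> measurable A.
Proof.
move=> oA.
pose B (a b r : rat) : set plane :=
  [set` `]ratr a - ratr r, ratr a + ratr r[] `*` [set` `]ratr b - ratr r, ratr b + ratr r[ : interval R].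
pose C a b r : set plane := if `[< B a b r `<=` A >] then B a b r else set0.
rewrite (_ : A = \bigcup_a \bigcup_b \bigcup_r C a b r).
  do 3 (apply: bigcupT_measurable_rat => ?).
  rewrite /C; case: ifP => _ //; by apply: measurableX; exact: measurable_itv.
apply/seteqP; split=> [z Az|z [a _ [b _ [r _]]]]; last first.
  by rewrite /C; case: asboolP => // H /H.
have [d d0 dA] := proj1 (open_planeP _ _) oA _ Az.
have [r] := rat_in_itvoo (divr_gt0 d0 (ltr0n R 2) : 0 < d / 2).
rewrite in_itv/= => /andP[r0 rd].
have near (x : R) : exists2 a : rat, x - ratr r < ratr a & ratr a < x + ratr r.
  have h : x - ratr r < x + ratr r by lra.
  by have [a] := rat_in_itvoo h; rewrite in_itv/= => /andP[h1 h2]; exists a.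
have [a a1 a2] := near z.1; have [b b1 b2] := near z.2.
exists a => //; exists b => //; exists r => //; rewrite /C; case: asboolP => [_|]; last first.
  case=> v [/=]; rewrite !in_itv/= => /andP[v1 v2] /andP[v3 v4].
  by apply: dA; split; rewrite ltr_norml; apply/andP; split; lra.
by split => /=; rewrite in_itv/=; apply/andP; split; lra.
Qed.

Definition reflect_plane z : plane := (- z.1, z.2).

Lemma reflect_planeK : involutive reflect_plane.
Proof. by move=> [x y]; rewrite /reflect_plane/= opprK. Qed.

Lemma measurable_reflect_plane : measurable_fun [set: plane] reflect_plane.
Proof.
apply: measurable_fun_pair; last exact: measurable_snd.
have mf : measurable_fun [set: plane] (fst : plane -> R) := measurable_fst.
exact: (measurable_funN mf).
Qed.

Lemma measurable_reflect_preimage A : measurable A -> measurable (reflect_plane @^-1` A).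
Proof. by move=> mA; have := measurable_reflect_plane measurableT _ mA; rewrite setTI. Qed.

Lemma area_reflect A : measurable A -> area (reflect_plane @^-1` A) = area A.
Proof.
move=> mA; have mB := measurable_reflect_preimage _ mA.
rewrite !area_ysection//; apply: eq_integral => y _.
have mY : measurable (ysection A y) by exact: measurable_ysection.
rewrite -[RHS](lebesgue_measureN mY) /pushforward; congr mu.
Qed.

Lemma area_axis A : measurable A -> A `<=` [set z | z.1 = 0] -> area A = 0%E.
Proof.
move=> mA A0; rewrite area_ysection// integral0_eq// => y _.
apply/eqP; rewrite -measure_le0 -[leRHS](lebesgue_measure_set1 (0 : R)).
apply: le_measure; rewrite ?inE//; first exact: measurable_ysection.
by move=> x; rewrite /ysection/= inE => /A0.
Qed.

Let fst_mR : measurable_fun [set: plane] (fst : plane -> R) := measurable_fst.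

Lemma measurable_right : measurable [set z : plane | 0 < z.1].
Proof. exact: measurable_lt_set. Qed.

Lemma measurable_left : measurable [set z : plane | z.1 < 0].
Proof. exact: measurable_lt_set. Qed.

Lemma area_split A : measurable A ->
  area A = (area (A `&` [set z | (0 < z.1)%R]) +
            area (A `&` [set z | (z.1 < 0)%R]))%E.
Proof.
move=> mA.
have m1 : measurable (A `&` [set z : plane | 0 < z.1]).
  by apply: measurableI => //; exact: measurable_right.
have m2 : measurable (A `&` [set z : plane | z.1 < 0]).
  by apply: measurableI => //; exact: measurable_left.
have m0 : measurable (A `\` ([set z : plane | 0 < z.1] `|` [set z : plane | z.1 < 0])).
  apply: measurableD => //; apply: measurableU; [exact: measurable_right|exact: measurable_left].
have m12 := measurableU _ _ m1 m2.
rewrite -measureU//; last first.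
  rewrite -subset0 => z [[_ /= h1] [_ /= h2]].
  by have := lt_trans h1 h2; rewrite ltxx.
rewrite -[RHS]adde0 -(area_axis _ m0); last first.
  move=> z [_ /= /not_orP[h1 h2]]; by case: (ltgtP z.1 0) h1 h2.
rewrite -measureU//; last first.
  by rewrite -subset0 => z [[[_ h1]|[_ h1]] [_ h]]; apply: h; [left|right].
congr (area _); apply/seteqP; split=> [z Az|z [[[]//|[]//]|[]//]].
have [h|h] := pselect (([set z : plane | 0 < z.1] `|` [set z : plane | z.1 < 0]) z).
  by left; case: h => h; [left|right].
by right.
Qed.

End PlaneMeasure.

(** * The symmetrized model map as a transport map *)

Section Transport.
Variables (R : realType) (e : R).
Hypothesis e_gt0 : 0 < e.
Local Notation mR := (measurableTypeR R).
Local Notation plane := (mR * mR)%type.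
Implicit Types (z v : plane) (p q x y : R).

Local Notation mx := (@model_x R e).
Local Notation mq := (@model_q R e).
Local Notation slope := (@model_slope R e).
Local Notation mp := (@model_p R e).
Local Notation my := (@model_y R e).
Local Notation refl := (@reflect_plane R).

(* [Y] is the image of [X] under (x, y) |-> (p, q) on the right half-plane. *)
Definition half_image (X Y : set plane) := forall z, 0 < z.1 ->
  Y z <-> above_dent R e z /\ X (mx z.1 (my z), my z).

Definition half_map z : plane := (mp z, mq (mp z) z.2).

(** [model_area] is applied to the points (p, y) sent into X by the first shear and into B by the
    second; its source and target sets are then the two sides. *)
Lemma half_transport (X Y B : set plane) : measurable X -> measurable B ->
  X `<=` [set z | 0 < z.2] -> half_image X Y ->
  area (X `&` [set z | (0 : R) < z.1] `&` half_map @^-1` B) =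
  area (Y `&` [set z | (0 : R) < z.1] `&` B).
Proof.
move=> mX mB Xpos XY.
pose C : set plane := model_domain R e `&`
   ((fun z : plane => (mx z.1 z.2, z.2) : plane) @^-1` X `&`
    (fun z : plane => (z.1, mq z.1 z.2) : plane) @^-1` B).
have f1 : measurable_fun [set: plane] (fst : plane -> R) := measurable_fst.
have f2 : measurable_fun [set: plane] (snd : plane -> R) := measurable_snd.
have mC : measurable C.
  apply: measurableI.
    rewrite (_ : model_domain R e = [set z : plane | 0 < z.1] `&`
      ([set z : plane | 0 < z.2] `&` [set z : plane | 0 < slope z.1 z.2])).
      apply: measurableI; first exact: measurable_lt_set.
      by apply: measurableI; apply: measurable_lt_set => //; exact: measurable_model_slope.
    by apply/seteqP; split=> z /=; [move=> []|move=> [? []]].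
  apply: measurableI.
    have m : measurable_fun [set: plane] (fun z : plane => (mx z.1 z.2, z.2) : plane).
      by apply: measurable_fun_pair => //; exact: measurable_model_x.
    by have := m measurableT X mX; rewrite setTI.
  have m : measurable_fun [set: plane] (fun z : plane => (z.1, mq z.1 z.2) : plane).
    by apply: measurable_fun_pair => //; exact: measurable_model_q.
  by have := m measurableT B mB; rewrite setTI.
have := model_area _ _ e_gt0 _ mC (@subIsetl _ _ _).
rewrite (_ : source_set R e C = X `&` [set z | (0 : R) < z.1] `&` half_map @^-1` B); last first.
  apply/seteqP; split=> z /=.
    move=> [x0 y0 [_ [/=]]]; have [_ -> _] := model_pP _ _ e_gt0 _ x0 y0.
    by rewrite -surjective_pairing.
  move=> [[Xz x0] Bz]; have y0 := Xpos _ Xz; have [p0 pE s0] := model_pP _ _ e_gt0 _ x0 y0.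
  by split => //; split => //; split => //=; rewrite pE -surjective_pairing.
move=> ->; congr (area _); apply/seteqP; split=> z /=.
  move=> [az [_ [/= Xz Bz]]]; have [dy qE y0 s0] := model_yP _ _ e_gt0 _ az.
  have p0 := az.1; split; last by move: Bz; rewrite qE -surjective_pairing.
  by split => //; apply/XY.
move=> [[/XY Yz p0] Bz]; have [az Xz] := Yz p0; have [dy qE y0 s0] := model_yP _ _ e_gt0 _ az.
by split => //; split => //; split => //=; rewrite qE -surjective_pairing.
Qed.

(** At least one of the two values of [model_p] is zero, so the difference is the signed p and the
    sum is |p|. This avoids a case distinction on the sign of z.1 and sends the axis to p = 0. *)
Definition model_map z : plane := (mp z - mp (refl z), mq (mp z + mp (refl z)) z.2).

Lemma measurable_model_map : measurable_fun [set: plane] model_map.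
Proof.
have mm := measurable_model_p _ _ e_gt0.
have mr : measurable_fun [set: plane] (fun z => mp (refl z) : R).
  exact: (measurableT_comp mm (measurable_reflect_plane R)).
apply: measurable_fun_pair; first exact: (measurable_funB mm mr).
apply: measurable_model_q; first exact: (measurable_funD mm mr).
exact: measurable_snd.
Qed.

Lemma model_map_right z : 0 < z.1 -> model_map z = half_map z.
Proof.
move=> x0; rewrite /model_map (model_p_out _ e (refl z)) ?subr0 ?addr0//= => -[h _].
by rewrite oppr_gt0 ltNge ltW in h.
Qed.

Lemma model_map_left z : z.1 < 0 -> model_map z = refl (half_map (refl z)).
Proof.
move=> x0; rewrite /model_map (model_p_out _ e z) ?sub0r ?add0r// => -[h _].
by have := lt_trans h x0; rewrite ltxx.
Qed.

Lemma model_transport (X Y B : set plane) : measurable X -> measurable Y -> measurable B ->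
  X `<=` [set z | 0 < z.2] -> half_image X Y ->
  half_image (refl @^-1` X) (refl @^-1` Y) ->
  area (X `&` model_map @^-1` B) = area (Y `&` B).
Proof.
move=> mX mY mB Xpos XY XY'.
have mT : measurable (model_map @^-1` B).
  by have := measurable_model_map measurableT _ mB; rewrite setTI.
have mXT : measurable (X `&` model_map @^-1` B) by exact: measurableI.
have mYB : measurable (Y `&` B) by exact: measurableI.
rewrite (area_split _ _ mXT) (area_split _ _ mYB); congr (_ + _)%E.
  rewrite [X in area X = _](_ : _ = X `&` [set z | (0 : R) < z.1] `&` half_map @^-1` B).
    by rewrite (half_transport X Y B)// -!setIA [B `&` _]setIC.
  apply/seteqP; split=> z /= [[h1 h2] h3].
    by split => //; rewrite -model_map_right.
  by split => //; split => //; rewrite model_map_right.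
rewrite -area_reflect; last by apply: measurableI => //; exact: measurable_left.
rewrite -[RHS]area_reflect; last by apply: measurableI => //; exact: measurable_left.
have H := half_transport _ _ _ (measurable_reflect_preimage _ _ mX)
  (measurable_reflect_preimage _ _ mB) _ XY'.
rewrite [X in area X = _](_ : _ = (refl @^-1` X) `&` [set z | (0 : R) < z.1] `&`
   half_map @^-1` (refl @^-1` B)).
  rewrite H; last by move=> z /Xpos.
  congr (area _); apply/seteqP; split=> z /=.
    by move=> [[h1 h2] h3]; rewrite oppr_lt0.
  by rewrite oppr_lt0 => -[[h1 h2] h3].
apply/seteqP; split=> z /=; rewrite oppr_lt0.
  move=> [[h1 h2] h3]; split => //; move: h2; rewrite model_map_left/= ?oppr_lt0//.
  by rewrite reflect_planeK.
move=> [[h1 h3] h2]; split => //; split => //.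
by rewrite model_map_left/= ?oppr_lt0// reflect_planeK.
Qed.

End Transport.

(** * Kantorovich duality *)

Section KantorovichDuality.
Variable R : realType.
Local Notation mR := (measurableTypeR R).
Local Notation plane := (mR * mR)%type.
Implicit Types (z : plane) (S T : plane -> plane).

Lemma enorm_sqr (z : R * R) : enorm z ^+ 2 = dot z z.
Proof. by rewrite dot_sqr_le. Qed.

Lemma measurable_fun_fst (D : set plane) (f : plane -> plane) :
  measurable_fun D f -> measurable_fun D (fun z => (f z).1 : R).
Proof. by move=> mf; apply: (measurableT_comp (measurable_fst (T1 := mR) (T2 := mR)) mf). Qed.

Lemma measurable_fun_snd (D : set plane) (f : plane -> plane) :
  measurable_fun D f -> measurable_fun D (fun z => (f z).2 : R).
Proof. by move=> mf; apply: (measurableT_comp (measurable_snd (T1 := mR) (T2 := mR)) mf). Qed.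

Lemma measurable_fun_dot (D : set plane) (f g : plane -> plane) :
  measurable_fun D f -> measurable_fun D g ->
  measurable_fun D (fun z => dot (f z) (g z) : R).
Proof.
move=> mf mg; apply: measurable_funD; apply: measurable_funM.
- exact: measurable_fun_fst.
- exact: measurable_fun_fst.
- exact: measurable_fun_snd.
- exact: measurable_fun_snd.
Qed.

Lemma measurable_sqdist (D : set plane) (f g : plane -> plane) :
  measurable_fun D f -> measurable_fun D g ->
  measurable_fun D (fun z => enorm (f z - g z : R * R) ^+ 2 : R).
Proof.
move=> mf mg.
rewrite (_ : (fun z => _) = (fun z => ((f z).1 - (g z).1) ^+ 2 + ((f z).2 - (g z).2) ^+ 2)).
  by apply: measurable_funD; apply: measurable_funX; apply: measurable_funB;
    do ?[exact: measurable_fun_fst|exact: measurable_fun_snd].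
by apply/funext => z; rewrite enorm_sqr.
Qed.

(** X' and Y' are parts of full measure on which the duality inequality holds pointwise. K shifts
    the integrands so that they are nonnegative and their integrals can be added freely; z0 is a
    point outside Y' used as a default value. *)
Variables (X Y X' Y' : set plane) (u v : plane -> R) (K : R) (z0 : plane).
Hypothesis mX : measurable X.
Hypothesis mY : measurable Y.
Hypothesis Xfin : (area X < +oo)%E.
Hypothesis mX' : measurable X'.
Hypothesis mY' : measurable Y'.
Hypothesis XX' : X' `<=` X.
Hypothesis YY' : Y' `<=` Y.
Hypothesis nX : area (X `\` X') = 0%E.
Hypothesis nY : area (Y `\` Y') = 0%E.
Hypothesis nz0 : ~ Y' z0.
Hypothesis mu_ : measurable_fun [set: plane] u.
Hypothesis mv : measurable_fun [set: plane] v.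
Hypothesis K_ge0 : 0 <= K.
Hypothesis uK : forall z, X' z -> 2 * `|u z| <= K.
Hypothesis vK : forall z, Y' z -> 2 * `|v z| <= K.
Hypothesis dual : forall z w, X' z -> Y' w -> dot z w <= u z + v w.

(** Chosen so that |z - S z|^2 + 2 K = [phi z] + [psi (S z)] + [gap S z], where the gap is twice the
    defect in the duality inequality. *)
Let phi z : R := dot z z - 2 * u z + K.
Let psi z : R := dot z z - 2 * v z + K.
Let gap S z : R := 2 * (u z + v (S z) - dot z (S z)).
Let good S : set plane := X' `&` S @^-1` Y'.

Let dot_ge0 (z : R * R) : 0 <= dot z z.
Proof. by rewrite -enorm_sqr sqr_ge0. Qed.

Let phi_ge0 z : X' z -> 0 <= phi z.
Proof.
by move=> /uK h; have := dot_ge0 z; have := ler_norm (u z); rewrite /phi; lra.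
Qed.

Let psi_ge0 z : Y' z -> 0 <= psi z.
Proof.
by move=> /vK h; have := dot_ge0 z; have := ler_norm (v z); rewrite /psi; lra.
Qed.

Let mid (D : set plane) : measurable_fun D (fun z : plane => z).
Proof. exact: measurable_id. Qed.

Let mphi (D : set plane) : measurable_fun D phi.
Proof.
apply: (@measurable_funTS _ _ plane R) => //.
apply: measurable_funD => //; apply: measurable_funB; first exact: measurable_fun_dot.
exact: measurable_funM.
Qed.

Let mpsi (D : set plane) : measurable_fun D psi.
Proof.
apply: (@measurable_funTS _ _ plane R) => //.
apply: measurable_funD => //; apply: measurable_funB; first exact: measurable_fun_dot.
exact: measurable_funM.
Qed.

Section Fixed.
Variable S : plane -> plane.
Hypothesis tS : transport_map X Y S.

Let mS : measurable_fun X S. Proof. by case: tS. Qed.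

Let goodX : good S `<=` X. Proof. by move=> z [/XX']. Qed.

Let mgood : measurable (good S).
Proof.
rewrite (_ : good S = X' `&` (X `&` S @^-1` Y')).
  by apply: measurableI => //; exact: mS.
by apply/seteqP; split=> z [h1 h2]; split=> //; [split => //; exact: XX'|case: h2].
Qed.

Lemma transport_good_null : area (X `\` good S) = 0%E.
Proof.
have m1 : measurable (X `\` X') by exact: measurableD.
have m2 : measurable (X `&` S @^-1` (~` Y')) by apply: mS => //; exact: measurableC.
have n2 : area (X `&` S @^-1` (~` Y')) = 0%E.
  by rewrite (proj2 tS); [rewrite -setDE|exact: measurableC].
apply/eqP; rewrite -measure_le0.
apply: (@le_trans _ _ (area ((X `\` X') `|` (X `&` S @^-1` (~` Y'))))).
  apply: le_measure; rewrite ?inE; [exact: measurableD|exact: measurableU|].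
  move=> z [Xz ng]; have [h|h] := pselect (X' z); last by left.
  by right; split => // Yz; apply: ng.
apply: (@le_trans _ _ (area (X `\` X') + area (X `&` S @^-1` (~` Y')))%E).
  exact: measureU2.
by rewrite nX n2 adde0.
Qed.

Let null_sub (D : set plane) : measurable D -> D `<=` X -> area (D `\` good S) = 0%E.
Proof.
move=> mD DX; apply/eqP; rewrite -measure_le0 -transport_good_null.
apply: le_measure; rewrite ?inE; [exact: measurableD|exact: measurableD|exact: setSD].
Qed.

Let setD_good (D : set plane) : good S `<=` D -> D `\` (D `\` good S) = good S.
Proof. by move=> h; rewrite setDD; apply/setIidPr. Qed.

Let area_good : area (good S) = area X.
Proof.
have : area X = (area (X `\` good S) + area (X `&` good S))%E by exact: measureDI.
rewrite transport_good_null add0e => ->.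
by congr (area _); rewrite setIidr.
Qed.

Lemma transport_integral : (\int[area]_(z in good S) (psi (S z))%:E =
  \int[area]_(z in Y') (psi z)%:E)%E.
Proof.
(* S is measurable only on X. Sending all other points to z0, outside Y', gives a globally
   measurable map whose preimage of Y' is exactly [good S]. *)
pose S' z := if z \in good S then S z else z0.
have S'E B : S' @^-1` B = (good S `&` S @^-1` B) `|` (if z0 \in B then ~` good S else set0).
  apply/seteqP; split=> z /=; rewrite /S'.
    case: ifPn => [|]; rewrite ?inE ?notin_setE => h Bz; first by left; split => //; rewrite inE in h.
    by right; rewrite mem_set.
  move=> [[h1 h2]|]; first by rewrite mem_set.
  by case: ifPn => //; rewrite inE => h h1; rewrite memNset.
have mgB B : measurable B -> measurable (good S `&` S @^-1` B).
  move=> mB; rewrite (_ : _ `&` _ = good S `&` (X `&` S @^-1` B)).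
    by apply: measurableI => //; exact: mS.
  by apply/seteqP; split=> z [h1 h2]; split=> //; [split => //; exact: goodX|case: h2].
have mS' : measurable_fun [set: plane] S'.
  move=> _ B mB; rewrite setTI S'E; apply: measurableU; first exact: mgB.
  by case: ifP => _ //; exact: measurableC.
have pre A : A `<=` Y' -> S' @^-1` A = good S `&` S @^-1` A.
  by move=> AY; rewrite S'E memNset ?setU0// => /AY.
have PY : S' @^-1` Y' = good S by rewrite pre// setIidl// => z [].
have H : (\int[pushforward area S']_(y in Y') (psi y)%:E =
    \int[area]_(z in good S) (psi (S' z))%:E)%E.
  rewrite -PY; apply: (@ge0_integral_pushforward _ _ plane plane R S' mS' area Y' (EFin \o psi) mY').
    by apply/measurable_EFinP; exact: mpsi.
  by move=> z; rewrite inE => /psi_ge0 h; rewrite lee_fin.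
transitivity (\int[area]_(z in good S) (psi (S' z))%:E)%E.
  by apply: eq_integral => z zS; rewrite /S' zS.
rewrite -H; apply: eq_measure_integral => A mA AY.
transitivity (area (good S `&` S @^-1` A)); first by rewrite -pre.
have YA : Y `&` A = A by apply: setIidr; exact: subset_trans AY YY'.
have E : area A = area (X `&` S @^-1` A) by rewrite (proj2 tS A mA) YA.
rewrite [RHS]E {E}.
have mXA : measurable (X `&` S @^-1` A) by exact: mS.
have : area (X `&` S @^-1` A) = (area ((X `&` S @^-1` A) `\` good S) +
    area ((X `&` S @^-1` A) `&` good S))%E by exact: measureDI.
rewrite (null_sub _ mXA (@subIsetl _ _ _)) add0e => ->.
by rewrite setIAC (setIidr goodX).
Qed.

Let gap_ge0 z : good S z -> 0 <= gap S z.
Proof. by move=> [h1 h2]; rewrite /gap mulr_ge0// subr_ge0; exact: dual. Qed.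

Let mSg : measurable_fun (good S) S.
Proof. exact: measurable_funS mS. Qed.

Let mgap : measurable_fun (good S) (gap S).
Proof.
apply: measurable_funM => //; apply: measurable_funB; last exact: measurable_fun_dot.
apply: measurable_funD; first exact: measurable_funTS.
exact: (measurableT_comp mv mSg).
Qed.

(** The pointwise identity behind [phi], [psi] and [gap], integrated. The integrals of [phi] and
    [psi] do not depend on S, so minimizing the cost amounts to minimizing the integral of the
    gap. *)
Lemma transport_cost_identity :
  (transport_cost X S + (2 * K)%:E * area X =
   \int[area]_(z in X') (phi z)%:E + \int[area]_(z in Y') (psi z)%:E +
   \int[area]_(z in good S) (gap S z)%:E)%E.
Proof.
have mc : measurable_fun X (fun z => (enorm (z - S z : R * R) ^+ 2)%:E : \bar R).
  by apply/measurable_EFinP; exact: (measurable_sqdist _ _ _ (mid X) mS).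
have mcG : measurable_fun (good S) (fun z => (enorm (z - S z : R * R) ^+ 2)%:E : \bar R).
  exact: measurable_funS mc.
have c0 z : (0 <= (enorm (z - S z : R * R) ^+ 2)%:E)%E by rewrite lee_fin sqr_ge0.
have mXG : measurable (X `\` good S) by exact: measurableD.
have mX'G : measurable (X' `\` good S) by exact: measurableD.
have mphiE D : measurable_fun D (EFin \o phi) by apply/measurable_EFinP; exact: mphi.
have mpsiE : measurable_fun (good S) (fun z => (psi (S z))%:E : \bar R).
  apply/measurable_EFinP.
  by apply: (measurableT_comp (_ : measurable_fun [set: plane] psi) mSg); exact: mpsi.
have mgapE : measurable_fun (good S) (EFin \o gap S) by apply/measurable_EFinP; exact: mgap.
have k0 : (0 <= (2 * K)%:E)%E by rewrite lee_fin mulr_ge0.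
have E1 : transport_cost X S = (\int[area]_(z in good S) (enorm (z - S z : R * R) ^+ 2)%:E)%E.
  rewrite /transport_cost.
  rewrite (@ge0_negligible_integral _ plane R area X (X `\` good S) _ mXG mX mc)//.
    by rewrite setD_good.
  exact: transport_good_null.
have E2 : ((2 * K)%:E * area X = \int[area]_(z in good S) (2 * K)%:E)%E.
  by rewrite integral_cst// area_good.
have E4 : (\int[area]_(z in X') (phi z)%:E = \int[area]_(z in good S) (phi z)%:E)%E.
  rewrite (@ge0_negligible_integral _ plane R area X' (X' `\` good S) _ mX'G mX' (mphiE X'))//.
  - by rewrite setD_good// => z [].
  - exact: (null_sub _ mX' XX').
have p0 z : good S z -> (0 <= (phi z)%:E)%E by move=> [/phi_ge0 h _]; rewrite lee_fin.
have q0 z : good S z -> (0 <= (psi (S z))%:E)%E by move=> [_ /psi_ge0 h]; rewrite lee_fin.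
have g0 z : good S z -> (0 <= (gap S z)%:E)%E by move=> /gap_ge0 h; rewrite lee_fin.
rewrite E1 E2 E4 -transport_integral.
rewrite -(ge0_integralD area mgood (fun z _ => c0 z) mcG (fun z _ => k0) (measurable_cst _)).
rewrite -(ge0_integralD area mgood p0 (mphiE _) q0 mpsiE).
rewrite -(ge0_integralD area mgood _ _ g0 mgapE); last 2 first.
- by move=> z Gz; rewrite adde_ge0// ?p0// q0.
- exact: emeasurable_funD.
apply: eq_integral => z _; rewrite -!EFinD; congr EFin.
by rewrite enorm_sqr /phi /psi /gap /dot /=; ring.
Qed.

Lemma transport_gap_measurable : measurable_fun (good S) (EFin \o gap S).
Proof. by apply/measurable_EFinP; exact: mgap. Qed.

Lemma transport_gap_ge0 : (0 <= \int[area]_(z in good S) (gap S z)%:E)%E.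
Proof. by apply: integral_ge0 => z /gap_ge0 h; rewrite lee_fin. Qed.

Lemma transport_good_measurable : measurable (good S).
Proof. exact: mgood. Qed.

End Fixed.

Variable T : plane -> plane.
Hypothesis tT : transport_map X Y T.
Hypothesis TY' : forall z, X' z -> Y' (T z).
Hypothesis dualT : forall z, X' z -> dot z (T z) = u z + v (T z).

Let gapT : (\int[area]_(z in good T) (gap T z)%:E = 0)%E.
Proof. by apply: integral0_eq => z [h _]; rewrite /gap -dualT// subrr mulr0. Qed.

Let cfin : ((2 * K)%:E * area X \is a fin_num)%E.
Proof. by rewrite fin_numM// ge0_fin_numE. Qed.

Lemma duality_optimal : optimal_transport X Y T.
Proof.
split=> // S tS; rewrite -(leeD2rE _ _ cfin).
rewrite (transport_cost_identity _ tT) (transport_cost_identity _ tS) gapT adde0.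
by rewrite leeDl// transport_gap_ge0.
Qed.

Hypothesis Tfin : (transport_cost X T < +oo)%E.
Hypothesis dual_eq : forall z w, X' z -> Y' w -> dot z w = u z + v w -> w = T z.

(** Optimality of S forces the integral of its gap to be at most that of T, which is 0; finiteness
    of the cost of T allows the cancellation. A nonnegative gap of zero integral vanishes almost
    everywhere, and [dual_eq] then identifies S z. *)
Lemma duality_unique S : optimal_transport X Y S ->
  {ae area, forall z, X z -> S z = T z}.
Proof.
move=> [tS /(_ _ tT) ST].
have cT0 : (0 <= transport_cost X T)%E.
  by apply: integral_ge0 => z _; rewrite lee_fin sqr_ge0.
have gap0 : (\int[area]_(z in good S) (gap S z)%:E = 0)%E.
  apply/eqP; rewrite eq_le transport_gap_ge0// andbT.
  have := ST; rewrite -(leeD2rE _ _ cfin) (transport_cost_identity _ tS).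
  have E := transport_cost_identity _ tT; rewrite gapT adde0 in E; rewrite -E.
  rewrite -[leRHS]adde0 leeD2lE// fin_numD cfin andbT ge0_fin_numE//.
have : (\int[area]_(z in good S) `|(EFin \o gap S) z| = 0)%E.
  rewrite -[RHS]gap0; apply: eq_integral => z; rewrite inE => -[h1 h2].
  by rewrite /= ger0_norm// mulr_ge0// subr_ge0 dual.
move/(ae_eq_integral_abs area (transport_good_measurable _ tS) (transport_gap_measurable _ tS)) => ae1.
have ae2 : {ae area, forall z, ~ (X `\` good S) z}.
  exists (X `\` good S); split; first exact: (measurableD mX (transport_good_measurable _ tS)).
    exact: transport_good_null.
  by move=> z /= /contrapT.
apply: filterS2 ae1 ae2 => z h1 h2 Xz.
have G : good S z by apply: contrapT => nG; apply: h2.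
have := h1 G; rewrite /= => -[] /eqP; rewrite mulf_eq0 pnatr_eq0/= subr_eq0 => /eqP h3.
by case: G => x' y'; apply: dual_eq.
Qed.

End KantorovichDuality.

(** * Optimality of the model map *)

Section OptimalMap.
Variables (R : realType) (e : R).
Hypothesis e_gt0 : 0 < e.
Hypothesis e_small : 1000 * e <= 1.
Local Notation mR := (measurableTypeR R).
Local Notation plane := (mR * mR)%type.
Implicit Types (z w : plane) (p q x y : R).

Local Notation mx := (@model_x R e).
Local Notation slope := (@model_slope R e).
Local Notation my := (@model_y R e).
Local Notation dent := (@dent R e).
Local Notation ext_x := (@ext_x R e).
Local Notation ext_q := (@ext_q R e).
Local Notation refl := (@reflect_plane R).

Let es : 100 * e <= 1. Proof. have h := e_small; have := e_gt0; lra. Qed.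

(** In the unit disc the logarithm is nonpositive, so truncating it can only increase x, and
    [ext_x_inner] applies. *)
Lemma model_x_inner p y : 0 < p -> 0 < y -> 0 < slope p y -> p ^+ 2 + y ^+ 2 <= 1 ->
  `|mx p y| < 2.
Proof.
move=> p0 y0 s0 r1; apply: le_lt_trans (ext_x_inner _ _ e_gt0 es p y (ltW y0) r1).
have x0 : 0 < mx p y by rewrite model_x_gt0.
rewrite (gtr0_norm x0) (le_trans _ (ler_norm _))// /model_x /ext_x /shift_x.
rewrite log_radius_max_inner// mulr0 add0r lerD2l ler_pM2l// /hat angleE// gerDr.
rewrite pmulr_rle0// /log_radius pmulr_lle0 ?invr_gt0//.
by rewrite ln_le0.
Qed.

Section Fibre.
Variables X Y : set plane.
Hypothesis X_bound : forall z, X z -> `|z.1| < 5 / 2 /\ 0 < z.2 < 2.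
Hypothesis X_flat : forall z, `|z.1| < 2 -> 0 < z.2 <= 1 -> X z.
Hypothesis XY : forall p q, 0 < p -> Y (p, q) <->
  exists y, [/\ `|p| <= 3, X (ext_x p y, y) & ext_q p y = q].

Let circle_height p y : 0 < p -> 0 < y -> p ^+ 2 + y ^+ 2 < 1 ->
  exists y1, [/\ y < y1, y1 <= 1, p < 1 & p ^+ 2 + y1 ^+ 2 = 1].
Proof.
move=> p0 y0 r1; exists (Num.sqrt (1 - p ^+ 2)).
have h : 0 <= 1 - p ^+ 2 by have := sqr_ge0 y; lra.
have s2 : Num.sqrt (1 - p ^+ 2) ^+ 2 = 1 - p ^+ 2 by rewrite sqr_sqrtr.
have s0 := sqrtr_ge0 (1 - p ^+ 2).
have p2 := sqr_ge0 p.
split.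
- rewrite -(@ltr_pXn2r _ 2) ?nnegrE//; [lra|exact: ltW].
- rewrite -(@expr_le1 _ 2)//; lra.
- rewrite -(@expr_lt1 _ 2)//; [have := exprn_gt0 2 y0; lra|exact: ltW].
- lra.
Qed.

(** On the fibre over p the model and the modified formulas agree outside the unit disc. Inside, let
    y1 be the height at which the fibre leaves the disc: [ext_q] maps ]0, y1[ and [model_q] maps
    ]dent p, y1[ onto the same interval from [dent_q] to q(p, y1). All points involved have |x| < 2
    and y <= 1, hence lie in X, so the change of parametrization is invisible in Y. *)
Lemma half_image_of_ext : half_image R e X Y.
Proof.
move=> [p q] /= p0; have pn : `|p| = p by rewrite gtr0_norm.
split=> [/(XY _ _ p0)[y [p3 Xy qE]]|[az Xb]].
  have [/= _ /andP[y0 y2]] := X_bound _ Xy.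
  have [r1|r1] := leP 1 (p ^+ 2 + y ^+ 2).
    have s1 := model_slope_ge1 _ _ e_gt0 _ _ p0 (ltW y0) r1.
    have s0 : 0 < slope p y := lt_le_trans ltr01 s1.
    have dy : dent p < y by rewrite -(model_slope_gt0 _ _ e_gt0).
    move: qE; rewrite ext_q_outer// => qE; rewrite ext_x_outer// in Xy.
    rewrite -qE model_yK//; split=> //; split=> //=; exact: dent_q_lt.
  have [y1 [yy1 y11 p1 r1E]] := circle_height _ _ p0 y0 r1.
  have y10 := lt_trans y0 yy1.
  have bx t : 0 <= t <= 1 -> box R p t by move=> /andP[t0 t1]; split; [lra|apply/andP; split; lra].
  have q1 : ext_q p 0 < q.
    by rewrite -qE; apply: (ext_q_lt _ _ e_gt0 es) => //; apply: bx; apply/andP; split; lra.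
  have q2 : q < ext_q p y1.
    by rewrite -qE; apply: (ext_q_lt _ _ e_gt0 es) => //; apply: bx; apply/andP; split; lra.
  rewrite ext_q_bottom// in q1.
  rewrite (ext_q_outer _ _ e_gt0 es) ?r1E// in q2.
  have az : above_dent R e (p, q) by [].
  split => //; have [dy bE b0 s0] := model_yP _ _ e_gt0 _ az; rewrite /= in dy bE b0 s0.
  have s1 : 0 <= slope p y1.
    by apply: le_trans ler01 _; apply: model_slope_ge1 => //; [exact: ltW|rewrite r1E].
  have by1 : my (p, q) < y1.
    rewrite ltNge; apply/negP; rewrite le_eqVlt => /predU1P[E|h].
      by rewrite E bE ltxx in q2.
    have := model_q_lt _ _ e_gt0 _ _ _ p0 s1 h; rewrite bE => h'.
    by have := lt_trans h' q2; rewrite ltxx.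
  apply: X_flat => /=; last by rewrite b0 (le_trans (ltW by1)).
  apply: model_x_inner => //; rewrite -r1E lerD2l lerXn2r ?nnegrE//; exact: ltW.
have [dy bE b0 s0] := model_yP _ _ e_gt0 _ az; rewrite /= in dy bE b0 s0.
set b := my (p, q) in Xb dy bE b0 s0.
apply/(XY _ _ p0); have [r1|r1] := leP 1 (p ^+ 2 + b ^+ 2).
  exists b; rewrite ext_x_outer// (ext_q_outer _ _ e_gt0 es)//; split => //.
  have [/= x5 _] := X_bound _ Xb.
  have := ext_x_norm _ _ e_gt0 p b (ltW b0); rewrite ext_x_outer//; lra.
have [y1 [yy1 y11 p1 r1E]] := circle_height _ _ p0 b0 r1.
have y10 := lt_trans b0 yy1.
have bx t : 0 <= t <= 1 -> box R p t by move=> /andP[t0 t1]; split; [lra|apply/andP; split; lra].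
have q1 : ext_q p 0 < q by rewrite ext_q_bottom//; case: az.
have q2 : q < ext_q p y1.
  rewrite (ext_q_outer _ _ e_gt0 es) ?r1E// -bE.
  by apply: model_q_lt => //; exact: ltW.
have [|||y' /andP[y'0 y'1] y'E] := @lipschitz_intermediate_value R
   (fun y => ext_q p y) 2 0 y1 q.
- exact: ltW.
- move=> s t /andP[s0' s1] /andP[t0 t1].
  have bs : box R p s by apply: bx; rewrite s0' (le_trans s1).
  have bt : box R p t by apply: bx; rewrite t0 (le_trans t1).
  have [st|ts] := leP s t.
    have /andP[i3 i4] := ext_q_increment _ _ e_gt0 e_small _ _ _ bs bt st.
    by rewrite distrC (distrC s) !ger0_norm//; lra.
  have /andP[i3 i4] := ext_q_increment _ _ e_gt0 e_small _ _ _ bt bs (ltW ts).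
  by rewrite !ger0_norm//; lra.
- by rewrite !ltW.
exists y'; rewrite pn; split => //; first by lra.
have y'gt : 0 < y'.
  by rewrite lt_neqAle y'0 andbT; apply/eqP => E; rewrite -E in y'E; rewrite y'E ltxx in q1.
apply: X_flat => /=; last by rewrite y'gt (le_trans y'1).
apply: (ext_x_inner _ _ e_gt0 es) => //; rewrite -r1E lerD2l lerXn2r ?nnegrE//; exact: ltW.
Qed.

End Fibre.

Variable X : set plane.
Hypothesis openX : open (X : set (R * R)).
Hypothesis X_bound : forall z, X z -> `|z.1| < 5 / 2 /\ 0 < z.2 < 2.
Hypothesis X_flat : forall z, `|z.1| < 2 -> 0 < z.2 <= 1 -> X z.

Local Notation Y := (@perturbed_domain R e X).

Lemma half_image_domain : half_image R e X Y.
Proof.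
apply: half_image_of_ext => // p q _; exact: perturbed_domainP.
Qed.

(** [ext_x] is odd and [ext_q] even in p, and the two bounds on X are invariant under reflection. *)
Lemma half_image_reflected : half_image R e (refl @^-1` X) (refl @^-1` Y).
Proof.
apply: half_image_of_ext.
- by move=> z /X_bound; rewrite /= normrN.
- by move=> z z1 z2; apply: X_flat; rewrite //= normrN.
move=> p q _; rewrite /reflect_plane/=.
split=> [/(proj1 (perturbed_domainP _ _ e_gt0 e_small _ X_bound _ _))[y]|[y]];
  rewrite -?ext_xN ?ext_qN ?normrN.
  by move=> [p3 Xy qE]; exists y; rewrite -ext_xN.
move=> [p3 Xy qE]; apply/(perturbed_domainP _ _ e_gt0 e_small _ X_bound).
by exists y; rewrite normrN ext_qN.
Qed.

Lemma X_measurable : measurable X.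
Proof. exact: open_plane_measurable. Qed.

Lemma Y_measurable : measurable Y.
Proof. by apply: open_plane_measurable; exact: perturbed_domain_open. Qed.

Lemma X_area_finite : (area X < +oo)%E.
Proof.
pose A : set mR := [set` `[- 3, 3 : R]]; pose B : set mR := [set` `[0, 3 : R]].
have mA : measurable A by exact: measurable_itv.
have mB : measurable B by exact: measurable_itv.
apply: (@le_lt_trans _ _ (area (A `*` B))).
  apply: le_measure; rewrite ?inE//; [exact: X_measurable|exact: measurableX|].
  move=> z /X_bound[z1 /andP[z2 z3]]; split; rewrite /A /B /= in_itv/=.
    by move: z1; rewrite ltr_norml => /andP[h1 h2]; apply/andP; split; lra.
  by apply/andP; split; lra.
have -> : (area (A `*` B) = lebesgue_measure A * lebesgue_measure B)%E.
  exact: product_measure1E.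
rewrite !lebesgue_measure_itv/=.
by do 2 case: ifP => _; rewrite -?EFinB -?EFinM ?mule0 ?mul0e ltry.
Qed.

Lemma model_map_transport : transport_map X Y (model_map R e).
Proof.
split; first by apply: measurable_funTS; exact: measurable_model_map.
move=> B mB; apply: model_transport => //; first exact: X_measurable.
- exact: Y_measurable.
- by move=> z /X_bound[_ /andP[]].
- exact: half_image_domain.
- exact: half_image_reflected.
Qed.

End OptimalMap.

(** From ln t <= t at r or at 1 / r. With r the squared radius, it bounds the logarithmic term of
    [model_w] up to the origin. *)
Lemma mul_norm_ln_le (R : realType) (r : R) : 0 < r -> r * `|ln r| <= 1 + r ^+ 2.
Proof.
move=> r0; have [r1|r1] := leP 1 r.
  rewrite ger0_norm ?ln_ge0//; have h := ln_le_id _ _ (ltW r0).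
  by have := ler_wpM2l (ltW r0) h; rewrite -expr2; lra.
rewrite ler0_norm ?ln_le0 ?(ltW r1)// -lnV ?posrE//.
have h : ln r^-1 <= r^-1 by apply: ln_le_id; rewrite invr_ge0 ltW.
apply: (@le_trans _ _ (r * r^-1)); first by rewrite ler_pM2l.
by rewrite mulfV ?gt_eqF// lerDl sqr_ge0.
Qed.

(** * Dual potentials for the model map *)

Section Optimality.
Variables (R : realType) (e : R).
Hypothesis e_gt0 : 0 < e.
Hypothesis e_small : 1000 * e <= 1.
Local Notation mR := (measurableTypeR R).
Local Notation plane := (mR * mR)%type.
Implicit Types (z w : plane) (p q x y : R).

Local Notation mx := (@model_x R e).
Local Notation mq := (@model_q R e).
Local Notation mw := (@model_w R e).
Local Notation slope := (@model_slope R e).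
Local Notation mp := (@model_p R e).
Local Notation my := (@model_y R e).
Local Notation dent := (@dent R e).
Local Notation refl := (@reflect_plane R).
Local Notation T := (@model_map R e).

(** With r <= 18 one has r |ln r| <= 1 + 18^2 = 325, and the three contributions sum to at most 9 +
    325 / 4 + 18; 300 is a round bound. *)
Lemma model_w_bound p y : 0 < p <= 3 -> 0 < y <= 3 -> `|mw p y| <= 300.
Proof.
move=> /andP[p0 p3] /andP[y0 y3]; have h := e_small; have h0 := e_gt0.
have [r rE] : {r | r = p ^+ 2 + y ^+ 2} by exists (p ^+ 2 + y ^+ 2).
have r0 : 0 < r by rewrite rE addr_gt0 ?exprn_gt0.
have sq9 (t : R) : 0 < t -> t <= 3 -> t ^+ 2 <= 9.
  move=> t0 t3; have := ler_pM (ltW t0) (ltW t0) t3 t3; rewrite -expr2 => h2.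
  by apply: le_trans h2 _; lra.
have p9 := sq9 _ p0 p3; have y9 := sq9 _ y0 y3.
have r18 : r <= 18 by rewrite rE; lra.
have l1 := mul_norm_ln_le _ _ r0.
have l2 : r * `|ln r| <= 325.
  by apply: le_trans l1 _; have := ler_pM (ltW r0) (ltW r0) r18 r18; rewrite -expr2; lra.
have ab : `|(p ^+ 2 - y ^+ 2) / 2| <= r / 2.
  have := sqr_ge0 p; have := sqr_ge0 y; rewrite ler_norml rE => ? ?.
  by apply/andP; split; lra.
have cd : `|1 - e / 2 + e * log_radius R p y| <= 1 + `|ln r| / 2.
  rewrite /log_radius -rE.
  have : `|e * (ln r / 2)| <= `|ln r| / 2.
    rewrite normrM (gtr0_norm e_gt0) normrM (ger0_norm (_ : 0 <= 2^-1)) ?invr_ge0//.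
    by rewrite ler_piMl ?mulr_ge0 ?invr_ge0//; lra.
  rewrite !ler_norml => /andP[i1 i2]; apply/andP; split; lra.
have ef : `|e * (p * y * angle R p y)| <= 18.
  have a0 := angle_gt0 _ p y; have a1 := angle_le_pihalf _ _ _ p0 (ltW y0).
  have a2 : angle R p y <= 2 by have := @pihalf_lt2 R; lra.
  rewrite ger0_norm ?mulr_ge0 ?(ltW e_gt0) ?(ltW p0) ?(ltW y0) ?(ltW a0)//.
  have i1 : p * y <= 9 by have := ler_pM (ltW p0) (ltW y0) p3 y3; lra.
  have i2 : p * y * angle R p y <= 9 * 2 by rewrite ler_pM ?mulr_ge0 ?(ltW p0) ?(ltW y0) ?(ltW a0).
  have i3 : 0 <= p * y * angle R p y by rewrite !mulr_ge0 ?ltW.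
  have : e * (p * y * angle R p y) <= 1 * (9 * 2) by rewrite ler_pM ?(ltW e_gt0)//; lra.
  lra.
apply: le_trans (ler_normD _ _) _.
have : `|(p ^+ 2 - y ^+ 2) / 2 * (1 - e / 2 + e * log_radius R p y)| <=
    r / 2 * (1 + `|ln r| / 2) by rewrite normrM ler_pM.
have -> : r / 2 * (1 + `|ln r| / 2) = r / 2 + r * `|ln r| / 4 by field.
lra.
Qed.

Variable X : set plane.
Hypothesis openX : open (X : set (R * R)).
Hypothesis X_bound : forall z, X z -> `|z.1| < 5 / 2 /\ 0 < z.2 < 2.
Hypothesis X_flat : forall z, `|z.1| < 2 -> 0 < z.2 <= 1 -> X z.

Local Notation Y := (@perturbed_domain R e X).

Let X' : set plane := X `&` [set z | z.1 != 0].
Let Y' : set plane := Y `&` [set z | z.1 != 0].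

(* The potential and its Legendre transform, through the partial Legendre
   transform [model_w] in the first variable. *)
Let a z : R := mp z + mp (refl z).
Let b w : R := my w + my (refl w).
Let u z : R := `|z.1| * a z - mw (a z) z.2.
Let v w : R := w.2 * b w + mw `|w.1| (b w).

Let aE z : z.1 != 0 -> a z = mp (`|z.1|, z.2).
Proof.
rewrite /a; case: (ltgtP z.1 0) => // x0 _.
  rewrite ltr0_norm// (model_p_out _ e z) ?add0r// => -[h _].
  by have := lt_trans h x0; rewrite ltxx.
rewrite gtr0_norm// -surjective_pairing (model_p_out _ e (refl z)) ?addr0//= => -[h _].
by rewrite oppr_gt0 ltNge ltW in h.
Qed.

Let bE w : w.1 != 0 -> b w = my (`|w.1|, w.2).
Proof.
rewrite /b; case: (ltgtP w.1 0) => // x0 _.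
  rewrite ltr0_norm// (model_y_out _ _ e_gt0 w) ?add0r// => -[h _].
  by have := lt_trans h x0; rewrite ltxx.
rewrite gtr0_norm// -surjective_pairing (model_y_out _ _ e_gt0 (refl w)) ?addr0//= => -[h _].
by rewrite oppr_gt0 ltNge ltW in h.
Qed.

Let TE z : z.1 != 0 -> T z = (Num.sg z.1 * a z, mq (a z) z.2).
Proof.
move=> z1; rewrite /model_map -/(a z); congr pair; rewrite /a.
case: (ltgtP z.1 0) z1 => // x0 _.
  rewrite ltr0_sg// (model_p_out _ e z) ?add0r ?sub0r ?mulN1r// => -[h _].
  by have := lt_trans h x0; rewrite ltxx.
rewrite gtr0_sg// (model_p_out _ e (refl z)) ?addr0 ?subr0 ?mul1r//= => -[h _].
by rewrite oppr_gt0 ltNge ltW in h.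
Qed.

Let aP z : X' z -> [/\ 0 < a z, mx (a z) z.2 = `|z.1|, 0 < slope (a z) z.2 & 0 < z.2].
Proof.
move=> [/X_bound[_ /andP[z2 _]] /= z1]; rewrite aE//.
have n0 : 0 < `|z.1| by rewrite normr_gt0.
by have [p0 pE s0] := model_pP _ _ e_gt0 (`|z.1|, z.2) n0 z2.
Qed.

Let YP w : w.1 != 0 -> Y w <->
  above_dent R e (`|w.1|, w.2) /\ X (Num.sg w.1 * mx `|w.1| (b w), b w).
Proof.
move=> w1; rewrite bE//; case: (ltgtP w.1 0) w1 => // x0 _.
  have h : 0 < (refl w).1 by rewrite /= oppr_gt0.
  have := half_image_reflected _ _ e_gt0 e_small _ X_bound X_flat _ h.
  rewrite /= reflect_planeK ltr0_norm// ltr0_sg// mulN1r.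
  exact.
have := half_image_domain _ _ e_gt0 e_small _ X_bound X_flat _ x0.
by rewrite gtr0_norm// gtr0_sg// mul1r -surjective_pairing.
Qed.

Let Y_bound w : Y w -> `|w.1| <= 3 /\ `|w.2| <= 3.
Proof.
case: w => p q Yw; split=> /=.
  by have [y []] := proj1 (perturbed_domainP _ _ e_gt0 e_small _ X_bound _ _) Yw.
case: Yw => z Xz zE; have := perturbation_norm _ _ e_gt0 e_small _ (X_strip _ _ X_bound _ Xz).
have := snd_le_enorm _ (perturbation R e z - z); rewrite zE/= => h1 h2.
have [_ /andP[z0 z2]] := X_bound _ Xz.
have h := e_small; move: (le_trans h1 h2); rewrite !ler_norml => /andP[i1 i2].
by apply/andP; split; lra.
Qed.

Let bP w : Y' w -> [/\ 0 < b w <= 3, mq `|w.1| (b w) = w.2, 0 < slope `|w.1| (b w),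
  0 < `|w.1| <= 3 & `|w.2| <= 3].
Proof.
move=> [Yw /= w1]; have [w3 w23] := Y_bound _ Yw.
have [az /X_bound[_ /= /andP[b0 b2]]] := proj1 (YP _ w1) Yw.
have [_ qE _ s0] := model_yP _ _ e_gt0 _ az; rewrite /= in qE s0.
split => //; first by rewrite b0; lra.
- by rewrite bE.
- by rewrite bE.
- by rewrite normr_gt0 w1 w3.
Qed.

Let b_map z : X' z -> b (T z) = z.2 /\ Y' (T z).
Proof.
move=> Xz; have [a0 aX s0 z2] := aP _ Xz; case: (Xz) => Xz0 /= z1.
have T1 : (T z).1 != 0 by rewrite TE//= mulf_neq0 ?sgr_eq0// gt_eqF.
have nT : `|(T z).1| = a z by rewrite TE//= normrM normr_sg z1 mul1r gtr0_norm.
have T2 : (T z).2 = mq (a z) z.2 by rewrite TE.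
have da : dent (a z) < z.2 by rewrite -(model_slope_gt0 _ _ e_gt0).
have bT : b (T z) = z.2 by rewrite bE// nT T2 model_yK.
split => //; split => //; apply/YP => //; rewrite bT nT T2; split.
  by split=> //=; exact: dent_q_lt.
rewrite aX TE//= sgrM (gtr0_sg a0) mulr1 sgr_id -numEsg.
by rewrite -surjective_pairing.
Qed.

Let normT z : X' z -> `|(T z).1| = a z.
Proof.
move=> Xz; have [a0 _ _ _] := aP _ Xz; have z1 : z.1 != 0 by case: Xz.
by rewrite TE//= normrM normr_sg z1 mul1r gtr0_norm.
Qed.

Let saddle z w : X' z -> Y' w -> (a z, z.2) != (`|w.1|, b w) ->
  `|z.1| * `|w.1| + z.2 * w.2 < u z + v w.
Proof.
move=> Xz Yw neq; have [a0 aX s0 z2] := aP _ Xz.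
have [/andP[b0 _] bQ s1 /andP[w0 _] _] := bP _ Yw.
have := model_w_saddle_lt _ _ e_gt0 _ _ _ _ a0 z2 s0 w0 b0 s1 neq.
rewrite aX bQ /u /v; set A := mw _ _; set B := mw _ _.
by move=> h; rewrite -subr_gt0; move: h; rewrite -subr_gt0; congr (0 < _); ring.
Qed.

Let diag z w : X' z -> Y' w -> (a z, z.2) = (`|w.1|, b w) ->
  `|z.1| * `|w.1| + z.2 * w.2 = u z + v w.
Proof.
move=> Xz Yw [aw zb]; rewrite /u /v -aw -zb; ring.
Qed.

(** The step z.1 w.1 <= |z.1| |w.1| reduces every pair to the right half-plane. It is why the even
    extension of the potential stays convex across its crease on the axis. *)
Let dual z w : X' z -> Y' w -> dot z w <= u z + v w.
Proof.
move=> Xz Yw; apply: (@le_trans _ _ (`|z.1| * `|w.1| + z.2 * w.2)).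
  by rewrite /dot lerD2r -normrM ler_norm.
have [E|neq] := eqVneq (a z, z.2) (`|w.1|, b w); first by rewrite diag.
exact/ltW/saddle.
Qed.

Let dualT z : X' z -> dot z (T z) = u z + v (T z).
Proof.
move=> Xz; have [bT YT] := b_map _ Xz.
rewrite -diag//; last by rewrite bT normT.
rewrite /dot; congr (_ + _); have z1 : z.1 != 0 by case: Xz.
rewrite TE//= normrM normr_sg z1 mul1r mulrA [z.1 * _]mulrC -normrEsg.
congr (_ * _); by rewrite ger0_norm// ltW//; have [] := aP _ Xz.
Qed.

(** Strictness of the saddle determines |w.1| and [b w], hence w.2; equality in z.1 w.1 = |z.1|
    |w.1| then determines the sign of w.1. *)
Let dual_eq z w : X' z -> Y' w -> dot z w = u z + v w -> w = T z.
Proof.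
move=> Xz Yw E; have h : dot z w <= `|z.1| * `|w.1| + z.2 * w.2.
  by rewrite /dot lerD2r -normrM ler_norm.
have [eq|neq] := eqVneq (a z, z.2) (`|w.1|, b w); last first.
  by have := saddle _ _ Xz Yw neq; rewrite -E ltNge h.
have [_ bQ _ _ _] := bP _ Yw.
move: E; rewrite -diag// /dot => /addIr E.
case: eq => aw zb; have z1 : z.1 != 0 by case: Xz.
rewrite TE// aw zb bQ; rewrite [LHS]surjective_pairing; congr pair.
by apply: (mulfI z1); rewrite E mulrA [z.1 * _]mulrC -normrEsg.
Qed.

Let measurable_off_axis : measurable [set z : plane | z.1 != 0].
Proof.
rewrite (_ : [set z | _] = [set z : plane | 0 < z.1] `|` [set z : plane | z.1 < 0]).
  by apply: measurableU; [exact: measurable_right|exact: measurable_left].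
apply/seteqP; split=> z /=; rewrite neq_lt; first by move=> /orP[]; [right|left].
by case=> ->; rewrite ?orbT.
Qed.

Let mX' : measurable X'.
Proof.
by apply: measurableI; [exact: X_measurable|exact: measurable_off_axis].
Qed.

Let mY' : measurable Y'.
Proof.
by apply: measurableI; [exact: Y_measurable|exact: measurable_off_axis].
Qed.

Let nX : area (X `\` X') = 0%E.
Proof.
apply: area_axis; first by apply: measurableD => //; exact: X_measurable.
by move=> z [Xz nz] /=; apply/eqP; apply: contrapT => h; apply: nz; split => //; exact/negP.
Qed.

Let nY : area (Y `\` Y') = 0%E.
Proof.
apply: area_axis; first by apply: measurableD => //; exact: Y_measurable.
by move=> z [Xz nz] /=; apply/eqP; apply: contrapT => h; apply: nz; split => //; exact/negP.
Qed.

Let measurable_a : measurable_fun [set: plane] a.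
Proof.
apply: measurable_funD; first exact: measurable_model_p.
exact: (measurableT_comp (measurable_model_p _ _ e_gt0) (measurable_reflect_plane R)).
Qed.

Let measurable_b : measurable_fun [set: plane] b.
Proof.
apply: measurable_funD; first exact: measurable_model_y.
exact: (measurableT_comp (measurable_model_y _ _ e_gt0) (measurable_reflect_plane R)).
Qed.

Let mfst : measurable_fun [set: plane] (fst : plane -> R) := measurable_fst.
Let msnd : measurable_fun [set: plane] (snd : plane -> R) := measurable_snd.

Let mabs : measurable_fun [set: plane] (fun z : plane => `|z.1| : R).
Proof. exact: (measurableT_comp (@normr_measurable R setT) mfst). Qed.

Let mu_ : measurable_fun [set: plane] u.
Proof.
apply: measurable_funB; first exact: measurable_funM.
exact: measurable_model_w.
Qed.

Let mv : measurable_fun [set: plane] v.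
Proof.
apply: measurable_funD; first exact: measurable_funM.
exact: measurable_model_w.
Qed.

Let a_le z : X' z -> a z <= 3.
Proof.
move=> Xz; rewrite -normT//.
by have [_ [/Y_bound[]]] := b_map _ Xz.
Qed.

Let uK z : X' z -> 2 * `|u z| <= 1000.
Proof.
move=> Xz; have [a0 _ _ z0] := aP _ Xz; have a3 := a_le _ Xz.
have [z5 /andP[_ z2]] : `|z.1| < 5 / 2 /\ 0 < z.2 < 2 by case: Xz => /X_bound.
have w3 : `|mw (a z) z.2| <= 300.
  by apply: model_w_bound; rewrite ?a0 ?z0//=; lra.
have h : `| `|z.1| * a z| <= 3 * 3.
  by rewrite normrM normr_id (gtr0_norm a0) ler_pM ?(ltW a0)//; lra.
by have := ler_normB (`|z.1| * a z) (mw (a z) z.2); rewrite /u; lra.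
Qed.

Let vK w : Y' w -> 2 * `|v w| <= 1000.
Proof.
move=> /bP[b3 _ _ w1 w2]; have w3 := model_w_bound _ _ w1 b3.
have h : `|w.2 * b w| <= 3 * 3.
  by case/andP: b3 => b0 b3; rewrite normrM (gtr0_norm b0) ler_pM ?(ltW b0).
by have := ler_normD (w.2 * b w) (mw `|w.1| (b w)); rewrite /v; lra.
Qed.

Let nz0 : ~ Y' (100, 100).
Proof. by move=> [/Y_bound[/= h _] _]; move: h; rewrite ger0_norm//; lra. Qed.

Let tT : transport_map X Y T.
Proof. exact: model_map_transport. Qed.

Let TY' z : X' z -> Y' (T z).
Proof. by move=> /b_map[]. Qed.

Lemma model_map_optimal : optimal_transport X Y T.
Proof.
(* 1000 exceeds 2 (9 + 300), the bound obtained for both potentials, and (100, 100) is far outside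
   Y. *)
exact: (@duality_optimal R X Y X' Y' u v 1000 (100, 100) (X_measurable _ _ openX)
  (X_area_finite _ _ openX X_bound) mX' mY' (@subIsetl _ _ _) (@subIsetl _ _ _) nX nY nz0
  mu_ mv (ler0n _ _) uK vK dual T tT dualT).
Qed.

Lemma model_map_cost : (transport_cost X T < +oo)%E.
Proof.
have mX := X_measurable _ _ openX.
have mT : measurable_fun X T by apply: measurable_funTS; exact: measurable_model_map.
have mc : measurable_fun X (fun z => (enorm (z - T z : R * R) ^+ 2)%:E : \bar R).
  by apply/measurable_EFinP; apply: measurable_sqdist => //; exact: measurable_id.
have mXX' : measurable (X `\` X') by exact: measurableD.
rewrite /transport_cost.
rewrite (@ge0_negligible_integral _ plane R area X (X `\` X') _ mXX' mX mc)//; last first.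
  by move=> z _; rewrite lee_fin sqr_ge0.
rewrite setDD (setIidr (@subIsetl _ _ _)).
(* The distance is at most 5/2 + 3 + 2 + 3 <= 11, and 11^2 <= 200. *)
apply: (@le_lt_trans _ _ (\int[area]_(z in X') (200 : R)%:E)%E).
  apply: ge0_le_integral => //.
  - by move=> z _; rewrite lee_fin sqr_ge0.
  - by apply: measurable_funS mc => //; exact: subIsetl.
  - move=> z Xz; rewrite lee_fin.
    have [Y1 Y2] : `|(T z).1| <= 3 /\ `|(T z).2| <= 3 by have [/Y_bound] := TY' _ Xz.
    have [z1 /andP[z2 z3]] : `|z.1| < 5 / 2 /\ 0 < z.2 < 2 by case: Xz => /X_bound.
    have h : enorm (z - T z : R * R) <= 11.
      apply: le_trans (enorm_le_sum _ _) _.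
      apply: (@le_trans _ _ (`|z.1| + `|(T z).1| + (`|z.2| + `|(T z).2|))).
        by apply: lerD; exact: ler_normB.
      by rewrite (gtr0_norm z2); lra.
    have := ler_pM (enorm_ge0 _ _) (enorm_ge0 _ _) h h; rewrite -expr2; lra.
rewrite integral_cst// lte_mul_pinfty// ?lee_fin//.
apply: le_lt_trans (X_area_finite _ _ openX X_bound).
by apply: le_measure; rewrite ?inE//; exact: subIsetl.
Qed.

Lemma model_map_unique S : optimal_transport X Y S ->
  {ae area, forall z, X z -> S z = T z}.
Proof.
exact: (@duality_unique R X Y X' Y' u v 1000 (100, 100) (X_measurable _ _ openX)
  (X_area_finite _ _ openX X_bound) mX' mY' (@subIsetl _ _ _) (@subIsetl _ _ _) nX nY nz0
  mu_ mv (ler0n _ _) uK vK dual T tT dualT model_map_cost dual_eq).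
Qed.

End Optimality.

(** * The jump across the axis *)

Section Discontinuity.
Variables (R : realType) (e : R).
Hypothesis e_gt0 : 0 < e.
Hypothesis e_small : 1000 * e <= 1.
Local Notation mR := (measurableTypeR R).
Local Notation plane := (mR * mR)%type.
Implicit Types (z w : plane) (p q x y : R).

Lemma ae_meets_rectangle (P : plane -> Prop) (a b c d : R) : a < b -> c < d ->
  {ae area, forall z, P z} -> exists z, [/\ a < z.1 < b, c < z.2 < d & P z].
Proof.
move=> ab cd [N [mN N0 PN]]; apply: contrapT => H.
pose A : set mR := [set` `]a, b[]; pose B : set mR := [set` `]c, d[].
have mA : measurable A by exact: measurable_itv.
have mB : measurable B by exact: measurable_itv.
have AB : A `*` B `<=` N.
  move=> z [/=]; rewrite /A /B /= !in_itv/= => z1 z2; apply: PN => Pz.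
  by apply: H; exists z.
have : (area (A `*` B) <= area N)%E.
  by apply: le_measure; rewrite ?inE//; exact: measurableX.
have -> : (area (A `*` B) = lebesgue_measure A * lebesgue_measure B)%E.
  exact: product_measure1E.
rewrite N0 !lebesgue_measure_itv/= !lte_fin ab cd -!EFinB -EFinM lee_fin.
by rewrite leNgt mulr_gt0 ?subr_gt0.
Qed.

Lemma dent_gt0 p : 0 < p -> p < dent_radius R e -> 0 < dent R e p.
Proof.
move=> p0 pr; rewrite lt_neqAle dent_ge0// andbT; apply/eqP => d0.
have := dent_slope_ge0 _ _ e_gt0 _ p0; rewrite -d0 leNgt => /negP; apply.
rewrite /model_slope /log_radius !mul0r addr0 expr0n/= addr0 lnXn// (_ : ln p *+ 2 / 2 = ln p); last first.
  by rewrite mulr2n; field.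
have : ln p < - e^-1 by rewrite -(expRK (- e^-1)) ltr_ln ?posrE ?expR_gt0.
rewrite -(ltr_pM2l e_gt0) mulrN mulfV ?gt_eqF// => h; lra.
Qed.

Variable X : set plane.
Hypothesis openX : open (X : set (R * R)).
Hypothesis X_flat : forall z, `|z.1| < 2 -> 0 < z.2 <= 1 -> X z.

(* Just above the origin the boundary of the image has a dent, and the first
   component of the map jumps across the axis [x = 0]. *)
Lemma discontinuous_of_ae_model_map (T : plane -> plane) :
  {ae area, forall z, X z -> T z = model_map R e z} -> discontinuous_on X T.
Proof.
move=> TM [S [cS ST]].
have SM : {ae area, forall z, X z -> S z = model_map R e z}.
  by apply: filterS2 TM ST => z h1 h2 Xz; rewrite h2// h1.
(* Half of [dent_radius], so that the dent above c has positive height; c will be a lower bound for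
   |p| on both sides of the axis. *)
pose c := dent_radius R e / 2.
have r0 : 0 < dent_radius R e := expR_gt0 _.
have c0 : 0 < c by rewrite divr_gt0.
have d0 : 0 < dent R e c by apply: dent_gt0 => //; rewrite /c; lra.
have [m m0 [md m1]] : exists2 m, 0 < m & m <= dent R e c /\ m <= 1.
  exists (Num.min (dent R e c) 1); first by rewrite lt_min d0 ltr01.
  by split; rewrite ge_min lexx ?orbT.
(* Below the height of the dent at c, x(c, y) <= 0 < z.1, so p exceeds c however close z is to the
   axis. *)
have pc z : 0 < z.1 -> 0 < z.2 < m -> c < model_p R e z.
  move=> x0 /andP[y0 ym]; apply/model_p_gt => //; split => //.
  apply: le_lt_trans x0; rewrite model_xE// pmulr_rle0// leNgt model_slope_gt0// -leNgt.
  by rewrite (le_trans (ltW ym)).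
pose z0 : R * R := (0, m / 2).
have Xz0 : X z0 by apply: X_flat; rewrite /= ?normr0//; apply/andP; split; lra.
have cSz : {for z0, continuous (S : R * R -> R * R)}.
  by move: cS; rewrite continuous_open_subspace// => /(_ z0); apply; rewrite inE.
have [d d0' dS] : exists2 d : R, 0 < d & forall v, close_to R z0 d v ->
    close_to R (S z0) c (S v).
  apply/nbhs_planeP; apply: cSz; apply/nbhs_planeP; by exists c.
have [k k0 [kd km k2]] : exists2 k, 0 < k & [/\ k <= d, k <= m / 2 & k <= 1].
  exists (Num.min d (Num.min (m / 2) 1)); first by rewrite !lt_min d0' ltr01 divr_gt0.
  by split; rewrite !ge_min lexx ?orbT.
have rect (a b : R) : a < b -> - k <= a -> b <= k -> exists z,
    [/\ a < z.1 < b, 0 < z.2 < m, close_to R z0 d z & S z = model_map R e z].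
  move=> ab ka kb; have mk : m / 2 - k < m / 2 + k by lra.
  have [z [/andP[z1 z2] /andP[z3 z4] h]] := ae_meets_rectangle _ _ _ _ _ ab mk SM.
  exists z; split; rewrite ?z1 ?z2//; first by apply/andP; split; lra.
    by split; rewrite /= ltr_norml; apply/andP; split; lra.
  by apply: h; apply: X_flat; [rewrite ltr_norml|]; apply/andP; split; lra.
(* No null set hides the jump: the rectangles on both sides contain points where S equals the model
   map. There its first coordinates are above c and below - c, yet both are within c of that of S
   z0. *)
have nk0 : - k < 0 by rewrite oppr_lt0.
have [z [/andP[z1 _] z2 /dS[h _] zE]] := rect 0 k k0 (ltW nk0) (lexx k).
have [w [/andP[_ w1] w2 /dS[h' _] wE]] := rect (- k) 0 nk0 (lexx _) (ltW k0).
have hz := pc _ z1 z2.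
have w1' : 0 < (reflect_plane R w).1 by rewrite /= oppr_gt0.
have hw := pc _ w1' w2.
move: h h'; rewrite zE wE model_map_right// model_map_left//= !ltr_norml.
by move=> /andP[h1 h2] /andP[h3 h4]; lra.
Qed.

End Discontinuity.

Lemma Linfty_norm_le (R : realType) (X : set (R * R)) (f : R * R -> R * R) (c : R) :
  0 <= c -> (forall z, X z -> enorm (f z) <= c) -> (Linfty_norm X f <= c%:E)%E.
Proof.
move=> c0 fc; rewrite /Linfty_norm unlock /=; case: ifP => _; last by rewrite lee_fin.
apply/ess_supP; apply: nearW => z /=; rewrite patchE; case: ifPn => [|_].
  by rewrite inE => /fc h; rewrite lee_fin ger0_norm// enorm_ge0.
by rewrite abse0 lee_fin.
Qed.

Lemma Lip_le (R : realType) (A : set (R * R)) (f : R * R -> R * R) (c : R) : 0 <= c ->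
  (forall x y, A x -> A y -> enorm (f x - f y) <= c * enorm (x - y)) -> (Lip A f <= c%:E)%E.
Proof.
move=> c0 fc; apply: ereal_inf_lbound.
exact: (ex_intro2 _ _ c (conj c0 fc) erefl).
Qed.

(** * Size of the perturbation *)

Section SmallPerturbation.
Variables (R : realType) (e : R).
Hypothesis e_gt0 : 0 < e.
Hypothesis e_small : 1000 * e <= 1.
Variable X : set (R * R).
Hypothesis X_bound : forall z, X z -> `|z.1| < 5 / 2 /\ 0 < z.2 < 2.
Hypothesis X_flat : forall z, `|z.1| < 2 -> 0 < z.2 <= 1 -> X z.
Local Notation Phi := (@perturbation R e).

Lemma perturbation_small (eps : R) : 1000 * e <= eps ->
  small_lipschitz_perturbation eps X (@perturbed_domain R e X).
Proof.
move=> eeps; exists Phi; split => //; first exact: perturbation_bilipschitz_homeo.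
apply: (@le_trans _ _ ((80 * e)%:E + (480 * e)%:E)%E); last first.
  by rewrite -EFinD lee_fin; have := e_gt0; lra.
apply: leeD.
  apply: Linfty_norm_le => [|z Xz]; first by rewrite mulr_ge0// ltW.
  apply: perturbation_norm => //; exact: (X_strip _ _ X_bound).
apply: Lip_le => [|z w /(closure_strip _ _ X_bound) sz /(closure_strip _ _ X_bound) sw].
  exact: mulr_ge0 (ler0n R 480) (ltW e_gt0).
exact: perturbation_lipschitz.
Qed.

End SmallPerturbation.

Lemma transport_map_area (R : realType) (X Y : set (R * R)) T :
  transport_map X Y T -> area X = area Y.
Proof.
by move=> [_ /(_ setT measurableT)]; rewrite preimage_setT !setIT.
Qed.

(** * Smooth functions *)

Section SmoothFunctions.
Variable R : realType.
Implicit Types (f g h : R -> R) (A B : set R) (x y t c d : R) (n k : nat).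

(* On an open set [A] this says that [f] is [n] times differentiable; unlike
   [derive1n], it only depends on the values of [f] on [A]. *)
Fixpoint diff_on n A f : Prop := if n is n'.+1 then
  exists2 df : R -> R, (forall x, A x -> is_derive x 1 f (df x)) & diff_on n' A df
  else True.

Definition smooth_on A f := forall n, diff_on n A f.

Lemma diff_onS n A f : diff_on n.+1 A f -> diff_on n A f.
Proof. by elim: n f => [//|n IH] f [df fd /IH]; exists df. Qed.

Lemma diff_on_sub n A B f : A `<=` B -> diff_on n B f -> diff_on n A f.
Proof.
move=> AB; elim: n f => [//|n IH] f [df fd /IH h].
by exists df => // x /AB; exact: fd.
Qed.

Lemma smooth_fun_of_smooth_on f : smooth_on setT f -> smooth_fun f.
Proof.
move=> H n; have {H} := H n.+1; elim: n f => [|n IH] f [df fd dfd] t.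
  by have h := fd t I; exact: ex_derive.
rewrite /derive1n iterSr; rewrite (_ : derive1 f = df); first exact: IH.
apply/funext => x; rewrite derive1E.
by have h := fd x I; exact: derive_val.
Qed.

Lemma smooth_on_continuous A f x : smooth_on A f -> A x -> {for x, continuous f}.
Proof. by move=> /(_ 1)[df fd _] /fd; exact: is_derive_continuous. Qed.

Lemma diff_on_cst n A c : diff_on n A (fun _ => c).
Proof. by elim: n c => [//|n IH] c; exists (fun _ => 0) => // x _; derive. Qed.

Lemma diff_on_id n A : diff_on n A (fun x => x).
Proof. by case: n => [//|n]; exists (fun _ => 1) => [x _|]; [derive|exact: diff_on_cst]. Qed.

Lemma diff_on_add n A f g : diff_on n A f -> diff_on n A g -> diff_on n A (fun x => f x + g x).
Proof.
elim: n f g => [//|n IH] f g [df fd dfd] [dg gd dgd].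
exists (fun x => df x + dg x); last exact: IH.
by move=> x Ax; have h1 := fd x Ax; have h2 := gd x Ax; exact: is_derive_add.
Qed.

Lemma diff_on_mul n A f g : diff_on n A f -> diff_on n A g -> diff_on n A (fun x => f x * g x).
Proof.
elim: n f g => [//|n IH] f g fS gS; have fn := diff_onS _ _ _ fS; have gn := diff_onS _ _ _ gS.
case: fS gS => [df fd dfd] [dg gd dgd].
exists (fun x => f x * dg x + g x * df x); last by apply: diff_on_add; exact: IH.
by move=> x Ax; have h1 := fd x Ax; have h2 := gd x Ax; exact: is_derive_mul.
Qed.

Lemma diff_on_comp n A B f g : (forall x, A x -> B (f x)) ->
  diff_on n B g -> diff_on n A f -> diff_on n A (fun x => g (f x)).
Proof.
move=> AB; elim: n g => [//|n IH] g [dg gd dgd] fS; have fn := diff_onS _ _ _ fS.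
case: fS => df fd dfd.
exists (fun x => dg (f x) * df x); last by apply: diff_on_mul => //; exact: IH.
by move=> x Ax; have h1 := fd x Ax; have h2 := gd _ (AB x Ax); exact: is_derive_comp.
Qed.

Lemma smooth_on_cst A c : smooth_on A (fun _ => c).
Proof. by move=> n; exact: diff_on_cst. Qed.

Lemma smooth_on_id A : smooth_on A (fun x => x).
Proof. by move=> n; exact: diff_on_id. Qed.

Lemma smooth_on_add A f g : smooth_on A f -> smooth_on A g -> smooth_on A (fun x => f x + g x).
Proof. by move=> F G n; exact: diff_on_add. Qed.

Lemma smooth_on_mul A f g : smooth_on A f -> smooth_on A g -> smooth_on A (fun x => f x * g x).
Proof. by move=> F G n; exact: diff_on_mul. Qed.

Lemma smooth_on_opp A f : smooth_on A f -> smooth_on A (fun x => - f x).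
Proof.
move=> F; rewrite (_ : (fun x => - f x) = fun x => -1 * f x).
  by apply: smooth_on_mul => //; exact: smooth_on_cst.
by apply/funext => x; rewrite mulN1r.
Qed.

Lemma smooth_on_comp A B f g : (forall x, A x -> B (f x)) ->
  smooth_on B g -> smooth_on A f -> smooth_on A (fun x => g (f x)).
Proof. by move=> AB F G n; exact: (diff_on_comp _ _ B). Qed.

Lemma smooth_on_expR A : smooth_on A expR.
Proof. by elim=> [//|n IH]; exists (@expR R) => // x _; exact: is_derive_expR. Qed.

Lemma smooth_on_inv : smooth_on [set x | x != 0] (fun x : R => x^-1).
Proof.
elim=> [//|n IH]; exists (fun x => (-1 * x^-1) * x^-1) => [x /= x0|].
  by derive => //; field.
by apply: diff_on_mul => //; apply: diff_on_mul => //; exact: diff_on_cst.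
Qed.

Lemma smooth_on_ln : smooth_on [set x | 0 < x] (@ln R).
Proof.
case=> [//|n]; exists (fun x => x^-1) => [x /= x0|]; first exact: is_derive1_ln.
by apply: (diff_on_sub _ _ [set x | x != 0]); [move=> x /= /gt_eqF ->|exact: smooth_on_inv].
Qed.

Lemma smooth_on_eq A f g : (forall x, A x -> \forall y \near x, f y = g y) ->
  smooth_on A f -> smooth_on A g.
Proof.
move=> fg F [//|n]; have [df fd dfd] := F n.+1; exists df => // x Ax.
by have h := fd x Ax; exact: (near_eq_is_derive (fg x Ax)).
Qed.

Lemma sqrtrE_exp x : 0 < x -> Num.sqrt x = expR (ln x * 2^-1).
Proof.
move=> x0; apply/eqP; rewrite -(@eqrXn2 _ 2) ?sqrtr_ge0 ?expR_ge0//.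
by rewrite sqr_sqrtr ?ltW// -expRM_natr mulrVK ?unitfE ?pnatr_eq0// lnK.
Qed.

Lemma smooth_on_sqrt : smooth_on [set x | 0 < x] (@Num.sqrt R).
Proof.
apply: (smooth_on_eq _ (fun x => expR (ln x * 2^-1))) => [x /= x0|].
  near=> y; rewrite -sqrtrE_exp//; near: y; exact: lt_nbhsr.
apply: (smooth_on_comp _ setT) => //; first exact: smooth_on_expR.
by apply: smooth_on_mul; [exact: smooth_on_ln|exact: smooth_on_cst].
Unshelve. all: by end_near. Qed.

(** The classical flat function with the powers of 1 / t that its derivatives produce: the family is
    stable under differentiation, up to linear combinations, so smoothness follows by induction for
    all k at once. *)
Definition flat k t : R := if 0 < t then t^-1 ^+ k * expR (- t^-1) else 0.

Lemma flat_ge0 k t : 0 <= flat k t.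
Proof.
rewrite /flat; case: ifPn => // t0.
by rewrite mulr_ge0 ?expR_ge0// exprn_ge0// invr_ge0 ltW.
Qed.

Lemma flat_gt0 k t : 0 < t -> 0 < flat k t.
Proof. by move=> t0; rewrite /flat t0 mulr_gt0 ?expR_gt0// exprn_gt0// invr_gt0. Qed.

Lemma flat_le0 k t : t <= 0 -> flat k t = 0.
Proof. by rewrite /flat leNgt => /negbTE ->. Qed.

(** With s = 1 / t and m = k + 2, exp s = (exp (s / m))^m >= (s / m)^m; the two powers beyond k
    leave the factor t^2 that makes the derivative at 0 vanish. *)
Lemma flat_le k t : 0 < t -> flat k t <= k.+2%:R ^+ k.+2 * t ^+ 2.
Proof.
move=> t0; rewrite /flat t0; set m := k.+2.
have m0 : 0 < m%:R :> R by rewrite ltr0n.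
have h : (t^-1 / m%:R) ^+ m <= expR t^-1.
  rewrite -[X in expR X](_ : t^-1 / m%:R * m%:R = _); last by rewrite divfK ?gt_eqF.
  rewrite expRM_natr lerXn2r ?nnegrE ?expR_ge0//.
    by rewrite divr_ge0// ?invr_ge0 ltW.
  by apply: le_trans (expR_ge1Dx _); rewrite lerDr.
rewrite expRN ler_pdivrMr ?expR_gt0//.
have -> : t^-1 ^+ k = m%:R ^+ m * t ^+ 2 * (t^-1 / m%:R) ^+ m.
  rewrite expr_div_n (_ : t^-1 ^+ m = t^-1 ^+ k * t^-1 ^+ 2); last by rewrite -exprD addn2.
  have : m%:R ^+ m != 0 :> R by rewrite expf_neq0// gt_eqF.
  set M := m%:R ^+ m; set T := t^-1 ^+ k => M0.
  by field; rewrite M0 gt_eqF.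
by rewrite ler_wpM2l// mulr_ge0 ?exprn_ge0// ltW.
Qed.

Lemma is_derive0_of_sqr f c : (forall t, `|f t| <= c * t ^+ 2) -> is_derive (0 : R) 1 f 0.
Proof.
move=> H; have f0 : f 0 = 0.
  by apply/eqP; rewrite -normr_eq0 eq_le normr_ge0 (le_trans (H 0))// expr0n mulr0.
have c0 : 0 <= c by have := le_trans (normr_ge0 _) (H 1); rewrite expr1n mulr1.
have cv : (fun t : R => t^-1 *: ((f \o shift 0) (t *: 1) - f 0) : R) @ (0 : R)^' --> (0 : R).
  apply/cvgrPdist_lt => d d0; rewrite near_withinE; apply/nbhs_ballP.
  have c1 : 0 < c + 1 by rewrite ltr_wpDl.
  exists (d / (c + 1)) => /=; first by rewrite divr_gt0.
  move=> h; rewrite -ball_normE /= !sub0r !normrN f0 subr0 addr0 => hd h0.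
  rewrite /GRing.scale /= mulr1 normrM normfV.
  have h1 : 0 < `|h| by rewrite normr_gt0.
  rewrite -ltr_pdivlMl ?invr_gt0// invrK; apply: le_lt_trans (H h) _.
  rewrite -real_normK ?num_real// expr2 mulrA mulrC ltr_pM2l//.
  by rewrite ltr_pdivlMr// in hd; apply: le_lt_trans hd; rewrite mulrC ler_pM2l// lerDl.
apply: DeriveDef; first by apply/cvg_ex; exists (0 : R).
exact: cvg_lim cv.
Qed.

Lemma is_derive_flat k t : is_derive t 1 (flat k) (flat k.+2 t - k%:R * flat k.+1 t).
Proof.
have [t0|t0|->] := ltgtP t 0.
- rewrite !flat_le0 ?ltW// mulr0 subr0.
  apply: near_eq_is_derive (is_derive_const R t 0).
  by near=> y; rewrite flat_le0// ltW//; near: y; exact: lt_nbhsl.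
- have D : is_derive t 1 (fun y : R => y^-1 ^+ k * expR (- y^-1))
      (flat k.+2 t - k%:R * flat k.+1 t).
    have t1 : t != 0 by rewrite gt_eqF.
    rewrite /flat t0; case: k => [|k].
      rewrite (_ : (fun y => _) = fun y => expR (- y^-1)).
        by derive => //; field.
      by apply/funext => y; rewrite expr0 mul1r.
    by derive => //; rewrite !exprS; field; rewrite ?expf_neq0.
  apply: near_eq_is_derive D.
  by near=> y; rewrite /flat ifT//; near: y; exact: lt_nbhsr.
- rewrite !flat_le0// mulr0 subr0.
  apply: (is_derive0_of_sqr _ (k.+2%:R ^+ k.+2)) => s.
  have [s0|s0] := ltP 0 s; first by rewrite ger0_norm ?flat_ge0// flat_le.
  by rewrite flat_le0// normr0 mulr_ge0 ?sqr_ge0// exprn_ge0.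
Unshelve. all: by end_near. Qed.

Lemma smooth_on_flat A k : smooth_on A (flat k).
Proof.
move=> n; elim: n k => [//|n IH] k.
exists (fun t => flat k.+2 t + (- k%:R) * flat k.+1 t) => [x _|].
  by rewrite mulNr; exact: is_derive_flat.
by apply: diff_on_add => //; apply: diff_on_mul => //; exact: diff_on_cst.
Qed.

(** Plateau function, equal to 1 on [-1, 1] and to 0 for |t| >= 2; the two flat terms of the
    denominator never vanish together. *)
Definition bump t : R := flat 0 (4 - t ^+ 2) / (flat 0 (4 - t ^+ 2) + flat 0 (t ^+ 2 - 1)).

Let bump_den_gt0 t : 0 < flat 0 (4 - t ^+ 2) + flat 0 (t ^+ 2 - 1).
Proof.
have [h|h] := ltP 0 (4 - t ^+ 2); first by rewrite ltr_pwDl ?flat_gt0 ?flat_ge0.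
by rewrite ltr_wpDl ?flat_ge0 ?flat_gt0//; lra.
Qed.

Lemma bump_smooth : smooth_on setT bump.
Proof.
have sq : smooth_on setT (fun t => t ^+ 2).
  by apply: smooth_on_mul; exact: smooth_on_id.
have f4 : smooth_on setT (fun t => flat 0 (4 - t ^+ 2)).
  apply: (smooth_on_comp _ setT) => //; first exact: smooth_on_flat.
  by apply: smooth_on_add; [exact: smooth_on_cst|exact: smooth_on_opp].
apply: smooth_on_mul => //.
apply: (smooth_on_comp _ [set x | x != 0]); [|exact: smooth_on_inv|].
  by move=> t _ /=; rewrite gt_eqF.
apply: smooth_on_add => //; apply: (smooth_on_comp _ setT) => //; first exact: smooth_on_flat.
by apply: smooth_on_add => //; exact: smooth_on_cst.
Qed.

Lemma bump1 t : `|t| <= 1 -> bump t = 1.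
Proof.
move=> t1; have t2 : t ^+ 2 <= 1 by rewrite -real_normK ?num_real// expr_le1.
rewrite /bump (flat_le0 _ (t ^+ 2 - 1)); last by lra.
by rewrite addr0 divff// gt_eqF// flat_gt0//; lra.
Qed.

Lemma mul_bump_lt t : `|t * bump t| < 2.
Proof.
have [h|h] := ltP 0 (4 - t ^+ 2); last by rewrite /bump flat_le0// mul0r mulr0 normr0.
have b0 : 0 <= bump t by rewrite divr_ge0 ?flat_ge0// ltW.
have b1 : bump t <= 1 by rewrite ler_pdivrMr// mul1r lerDl flat_ge0.
rewrite normrM (ger0_norm b0); apply: (@le_lt_trans _ _ `|t|); first by rewrite ler_piMr.
rewrite -(@ltr_pXn2r _ 2) ?nnegrE// real_normK ?num_real//; lra.
Qed.

(* Precomposing with the bounded map [t |-> t * bump t], which is the identity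
   near [0], extends the germ of a smooth function. *)
Lemma smooth_on_extend A f c : open A -> A c -> smooth_on A f ->
  exists g d, [/\ smooth_fun g, 0 < d & forall x, `|x - c| <= d -> g x = f x].
Proof.
move=> oA Ac F; have /nbhs_ballP[r /= r0 rA] : nbhs c A by exact: open_nbhs_nbhs.
pose d := r / 2; have d0 : 0 < d by rewrite divr_gt0.
exists (fun x => f (c + d * ((x - c) / d * bump ((x - c) / d)))), d; split => //; last first.
  move=> x xd; rewrite bump1 ?mulr1; last first.
    by rewrite normrM normfV (gtr0_norm d0) ler_pdivrMr// mul1r.
  by congr f; field; rewrite gt_eqF.
have scale : smooth_on setT (fun x => (x - c) / d).
  by apply: smooth_on_mul; [apply: smooth_on_add; [exact: smooth_on_id|]|]; exact: smooth_on_cst.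
apply: smooth_fun_of_smooth_on; apply: (smooth_on_comp _ A) => //.
  move=> x _; apply: rA; rewrite -ball_normE /= opprD addNKr normrN normrM (gtr0_norm d0).
  by rewrite -ltr_pdivlMl// (_ : d^-1 * r = 2) ?mul_bump_lt// /d; field; rewrite gt_eqF.
apply: smooth_on_add; first exact: smooth_on_cst.
apply: smooth_on_mul; first exact: smooth_on_cst.
apply: smooth_on_mul => //.
exact: (smooth_on_comp _ _ _ _ (fun x _ => I) bump_smooth scale).
Qed.

End SmoothFunctions.

(** * The convex domain *)

Section Stadium.
Variable R : realType.
Implicit Types (x y t a b c : R) (z p : R * R) (A : set R).

(* For t > 0 this is exp (2 - 1 / t), which is flat at 0, convex on t <= 1 / 2
   and equal to 1 at t = 1 / 2. *)
Definition cap t := expR 2 * flat R 0 t.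
Definition flank x := cap (x - 2) + cap (- x - 2).
Definition profile z := flank z.1 + (z.2 - 1) ^+ 2.
(** The lower boundary is y = 1 - sqrt (1 - [flank x]), which is the segment y = 0 for |x| <= 2.
    Convexity comes from that of [profile] on the strip |x| <= 5 / 2. *)
Definition stadium : set (R * R) := [set z | profile z < 1].

Lemma capE t : 0 < t -> cap t = expR (2 - t^-1).
Proof. by move=> t0; rewrite /cap /flat t0 expr0 mul1r -expRD. Qed.

Lemma cap_le0 t : t <= 0 -> cap t = 0.
Proof. by move=> t0; rewrite /cap flat_le0// mulr0. Qed.

Lemma cap_ge0 t : 0 <= cap t.
Proof. by rewrite mulr_ge0 ?expR_ge0 ?flat_ge0. Qed.

(** [cap] inverts explicitly, with value d at 1 / (2 - ln d). This later describes the sides of the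
    stadium without an implicit function theorem. *)
Lemma cap_lt_expR t d : 0 < t -> 0 < d <= 1 -> (cap t < d) = (t < (2 - ln d)^-1).
Proof.
move=> t0 /andP[d0 d1]; have l0 : 0 < 2 - ln d by have := ln_le0 d1; lra.
rewrite capE// -[in LHS](lnK d0) ltr_expR -[RHS]ltf_pV2 ?posrE ?invr_gt0// invrK.
by rewrite ltrBlDr -ltrBlDl.
Qed.

Lemma cap_lt1 t : (cap t < 1) = (t < 1 / 2).
Proof.
have [t0|t0] := ltP 0 t; last by rewrite cap_le0// ltr01; apply/esym; lra.
by rewrite cap_lt_expR ?ltr01 ?lexx// ln1 subr0 mul1r.
Qed.

Lemma flank_right x : 0 < x -> flank x = cap (x - 2).
Proof. by move=> x0; rewrite /flank (cap_le0 (- x - 2)) ?addr0//; lra. Qed.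

Lemma flankN x : flank (- x) = flank x.
Proof. by rewrite /flank opprK addrC. Qed.

Lemma flank_norm x : flank `|x| = flank x.
Proof. by case: (ger0P x) => // _; rewrite flankN. Qed.

Lemma flank_ge0 x : 0 <= flank x.
Proof. by rewrite addr_ge0 ?cap_ge0. Qed.

Lemma flank0 x : `|x| <= 2 -> flank x = 0.
Proof.
by rewrite ler_norml => /andP[h1 h2]; rewrite /flank !cap_le0 ?addr0//; lra.
Qed.

Lemma flank_lt1 x : (flank x < 1) = (`|x| < 5 / 2).
Proof.
rewrite -flank_norm; have [->|x0] := eqVneq x 0.
  by rewrite normr0 flank0 ?normr0 ?ler0n// ltr01; apply/esym; lra.
rewrite flank_right ?normr_gt0// cap_lt1 ltrBlDr; congr (_ < _); lra.
Qed.

Lemma flank_smooth A : smooth_on R A flank.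
Proof.
have s (f : R -> R) : smooth_on R A f -> smooth_on R A (fun x => cap (f x - 2)).
  move=> fs; apply: smooth_on_mul; first exact: smooth_on_cst.
  apply: (smooth_on_comp _ _ setT) => //; first exact: smooth_on_flat.
  by apply: smooth_on_add => //; exact: smooth_on_cst.
apply: smooth_on_add; apply: s; first exact: smooth_on_id.
by apply: smooth_on_opp; exact: smooth_on_id.
Qed.

Lemma flank_continuous : continuous flank.
Proof. by move=> x; exact: (smooth_on_continuous _ _ _ _ (flank_smooth setT)). Qed.

Lemma profile_continuous : continuous profile.
Proof.
move=> z; apply: cvgD.
  by apply: (continuous_comp (f := fst)); [exact: cvg_fst|exact: flank_continuous].
apply: (continuous_comp (f := snd) (g := fun y => (y - 1) ^+ 2)); first exact: cvg_snd.
apply: (is_derive_continuous _ _ _ (2 * (z.2 - 1))); derive; ring.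
Qed.

Lemma stadium_open : open stadium.
Proof.
apply: (@open_comp _ _ profile [set t : R | t < 1]); last exact: open_lt.
by move=> z _; exact: profile_continuous.
Qed.

Lemma stadium_bound z : stadium z -> `|z.1| < 5 / 2 /\ 0 < z.2 < 2.
Proof.
rewrite /stadium /profile /= => h; have s0 := sqr_ge0 (z.2 - 1); have k0 := flank_ge0 z.1.
split; first by rewrite -flank_lt1; lra.
have : (z.2 - 1) ^+ 2 < 1 by lra.
by rewrite -real_normK ?num_real// expr_lt1// ltr_norml => /andP[? ?]; apply/andP; split; lra.
Qed.

Lemma stadium_flat z : `|z.1| < 2 -> 0 < z.2 <= 1 -> stadium z.
Proof.
move=> z1 /andP[z2 z3]; rewrite /stadium /profile /= flank0 ?(ltW z1)// add0r.
by rewrite -real_normK ?num_real// expr_lt1// ltr_norml; apply/andP; split; lra.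
Qed.

Lemma stadium_boundary z : (closure stadium `\` stadium^°) z -> profile z = 1.
Proof.
rewrite (proj1 (interior_id _) stadium_open) => -[cz nz].
apply/eqP; rewrite eq_le [1 <= _]leNgt; apply/andP; split; last exact/negP.
have cl : closed [set z | profile z <= 1].
  apply: (@closed_comp _ _ profile [set t : R | t <= 1]); last exact: closed_le.
  by move=> v _; exact: profile_continuous.
have : closure stadium `<=` [set z | profile z <= 1].
  rewrite [X in _ `<=` X](proj1 (closure_id _) cl); apply: closureS.
  by move=> v /ltW.
exact.
Qed.

Lemma is_derive_cap t : is_derive t 1 cap (expR 2 * flat R 2 t).
Proof.
have h := is_derive_flat _ 0 t.
have := is_derive_mul _ _ _ _ _ _ (is_derive_const _ t (expR 2)) h.
by rewrite mul0r subr0 mulr0 addr0.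
Qed.

(** For t > 0 the derivative of [flat 2] is t^-3 (1 / t - 2) exp (- 1 / t), nonnegative up to t = 1
    / 2: this is why the stadium is cut at |x| = 5 / 2. *)
Lemma cap_slope_le a b : a <= b -> b <= 1 / 2 -> flat R 2 a <= flat R 2 b.
Proof.
move=> ab b2; apply: (@derive_ge0_le R (flat R 2) (fun t => flat R 4 t - 2 * flat R 3 t) a b ab).
  by move=> t _; exact: is_derive_flat.
move=> t /andP[_ tb]; have [t0|t0] := ltP 0 t; last by rewrite !flat_le0// mulr0 subr0.
rewrite /flat t0 -subr_ge0 subr0 mulrA -mulrBl mulr_ge0 ?expR_ge0//.
rewrite exprS -mulrBl mulr_ge0 ?exprn_ge0 ?invr_ge0 ?(ltW t0)//.
by rewrite subr_ge0 -[2]invrK lef_pV2 ?posrE ?invr_gt0//; lra.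
Qed.

Lemma cap_tangent c t : c <= 1 / 2 -> t <= 1 / 2 ->
  cap c + expR 2 * flat R 2 c * (t - c) <= cap t.
Proof.
move=> c2 t2; have e0 := expR_ge0 (2 : R).
have D (s : R) : is_derive s 1 cap (expR 2 * flat R 2 s) := is_derive_cap s.
have [ct|tc|->] := ltgtP c t; last by rewrite subrr mulr0 addr0.
  have [s [/andP[cs st] E]] := @mean_value R cap (fun s => expR 2 * flat R 2 s) c t ct (fun s _ => D s).
  rewrite addrC -lerBrDr E ler_wpM2r ?subr_ge0 ?(ltW ct)// ler_wpM2l// cap_slope_le//; lra.
have [s [/andP[ts sc] E]] := @mean_value R cap (fun s => expR 2 * flat R 2 s) t c tc (fun s _ => D s).
have : expR 2 * flat R 2 s * (c - t) <= expR 2 * flat R 2 c * (c - t).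
  by rewrite ler_wpM2r ?subr_ge0 ?(ltW tc)// ler_wpM2l// cap_slope_le//; lra.
rewrite -E; lra.
Qed.

Lemma cap_convex a b t : 0 <= t <= 1 -> a <= 1 / 2 -> b <= 1 / 2 ->
  cap (t * a + (1 - t) * b) <= t * cap a + (1 - t) * cap b.
Proof.
move=> /andP[t0 t1] a2 b2; set c := t * a + (1 - t) * b.
have c2 : c <= 1 / 2.
  have := ler_wpM2l t0 a2; have := ler_wpM2l (_ : 0 <= 1 - t) b2.
  by rewrite subr_ge0 => /(_ t1); rewrite /c; lra.
have h1 := ler_wpM2l t0 (cap_tangent _ _ c2 a2).
have := ler_wpM2l (_ : 0 <= 1 - t) (cap_tangent _ _ c2 b2).
rewrite subr_ge0 => /(_ t1) h2; have := lerD h1 h2; apply: le_trans.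
by rewrite le_eqVlt; apply/orP; left; apply/eqP; rewrite /c; ring.
Qed.

(** [flank] is convex only for |x| <= 5 / 2, so [stadium_bound] is applied to both points before the
    convexity of [cap]. *)
Lemma stadium_avg z p t : 0 <= t <= 1 -> stadium z -> stadium p ->
  stadium (t * z.1 + (1 - t) * p.1, t * z.2 + (1 - t) * p.2).
Proof.
move=> t01 Xz Xp; have [z1 _] := stadium_bound _ Xz; have [p1 _] := stadium_bound _ Xp.
move: z1 p1; rewrite !ltr_norml => /andP[z1 z2] /andP[p1 p2].
have h1 := cap_convex (z.1 - 2) (p.1 - 2) t t01.
have h2 := cap_convex (- z.1 - 2) (- p.1 - 2) t t01.
have {}h1 : cap (t * z.1 + (1 - t) * p.1 - 2) <= t * cap (z.1 - 2) + (1 - t) * cap (p.1 - 2).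
  rewrite (_ : _ - 2 = t * (z.1 - 2) + (1 - t) * (p.1 - 2)); last by ring.
  by apply: h1; lra.
have {}h2 : cap (- (t * z.1 + (1 - t) * p.1) - 2) <= t * cap (- z.1 - 2) + (1 - t) * cap (- p.1 - 2).
  rewrite (_ : _ - 2 = t * (- z.1 - 2) + (1 - t) * (- p.1 - 2)); last by ring.
  by apply: h2; lra.
have h3 : (t * z.2 + (1 - t) * p.2 - 1) ^+ 2 <= t * (z.2 - 1) ^+ 2 + (1 - t) * (p.2 - 1) ^+ 2.
  rewrite -subr_ge0 (_ : _ - _ = t * (1 - t) * (z.2 - p.2) ^+ 2); last by ring.
  case/andP: t01 => t0 t1; rewrite mulr_ge0 ?sqr_ge0// mulr_ge0// subr_ge0//.
have : t * profile z + (1 - t) * profile p < 1.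
  have [->|t0] := eqVneq t 0; first by rewrite mul0r add0r subr0 mul1r; exact: Xp.
  have tp : 0 < t by rewrite lt_neqAle eq_sym t0; case/andP: t01.
  have i1 : t * profile z < t by rewrite -[ltRHS]mulr1 ltr_pM2l//; exact: Xz.
  have i2 : (1 - t) * profile p <= 1 - t.
    by rewrite -[leRHS]mulr1 ler_wpM2l ?subr_ge0 ?(ltW Xp)//; case/andP: t01 => ? ?.
  lra.
rewrite /stadium /profile /flank /=; lra.
Qed.

Lemma stadium_convex : convex_set (stadium : set (convex_lmodType (R * R)%type)).
Proof.
move=> z p t; rewrite !inE => Xz Xp.
by apply: (stadium_avg _ _ _ _ Xz Xp); rewrite ge0 le1.
Qed.

(** A union of segments issuing from the centre (0, 1). *)
Lemma stadium_connected : connected stadium.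
Proof.
pose seg z t : R * R := (t * z.1 + (1 - t) * 0, t * z.2 + (1 - t) * 1).
rewrite (_ : stadium = \bigcup_(z in stadium) (seg z @` `[0, 1])).
  apply: bigcup_connected.
    exists (0, 1) => z _; exists 0; first by rewrite /= in_itv/= lexx ler01.
    by rewrite /seg !mul0r !add0r mulr0 subr0 mulr1.
  move=> z _; apply: connected_continuous_connected; first exact: segment_connected.
  apply: continuous_subspaceT => t.
  have D (a b : R) : {for t, continuous (fun t => t * a + (1 - t) * b)}.
    have d : is_derive t 1 (fun t => t * a + (1 - t) * b) (a - b) by derive; ring.
    exact: is_derive_continuous d.
  exact: (cvg_pair (D z.1 0) (D z.2 1)).
apply/seteqP; split=> z.
  move=> Xz; exists z => //; exists 1; first by rewrite /= in_itv/= ler01 lexx.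
  by rewrite /seg subrr !mul0r !addr0 !mul1r -surjective_pairing.
move=> [v Xv [t]]; rewrite /= in_itv/= => t01 <-.
apply: (stadium_avg v (0, 1)) => //; apply: stadium_flat; rewrite /= ?normr0//.
by rewrite ltr01 lexx.
Qed.

Lemma stadium_bounded : bounded_set stadium.
Proof.
exists 3; split; first exact: num_real.
move=> M M3 z /stadium_bound[z1 /andP[z2 z3]]; rewrite /= prod_normE/= ge_max; apply/andP.
by split; [|rewrite gtr0_norm//]; lra.
Qed.

Lemma dot_sub_le (u z p : R * R) : enorm u = 1 -> `|dot u z - dot u p| <= enorm (z - p).
Proof.
move=> u1; have E : dot u u = 1 by rewrite dot_sqr_le u1 expr1n.
rewrite -(@ler_pXn2r _ 2) ?nnegrE ?enorm_ge0// -dot_sqr_le real_normK ?num_real//.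
rewrite -[leRHS]mul1r -E -subr_ge0.
rewrite (_ : _ - _ = (u.1 * (z - p).2 - u.2 * (z - p).1) ^+ 2) ?sqr_ge0//.
by rewrite /dot /=; ring.
Qed.

(** The boundary functions are smooth only near the relevant parameter; [smooth_on_extend] replaces
    them by global smooth ones, and a unit vector u makes [dot u] contract distances, so one radius
    serves both. *)
Lemma smooth_chart (X : set (R * R)) p u A (f : R -> R) (r : R) :
  enorm u = 1 -> open A -> A (dot u p) -> smooth_on R A f -> 0 < r ->
  (forall z, enorm (z - p) < r -> X z <-> f (dot u z) < dot (perp u) z) ->
  exists (e : R * R) (g : R -> R) (r : R), [/\ enorm e = 1, smooth_fun g, 0 < r &
    forall x : R * R, enorm (x - p) < r -> X x <-> g (dot e x) < dot (perp e) x].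
Proof.
move=> u1 oA Ap F r0 XF; have [g [d [gs d0 gf]]] := smooth_on_extend _ _ _ _ oA Ap F.
exists u, g, (Num.min r d); split => //; first by rewrite lt_min r0.
move=> z; rewrite lt_min => /andP[zr zd]; rewrite gf; first exact: XF.
by rewrite (le_trans (dot_sub_le _ _ _ u1))// ltW.
Qed.

Lemma lt_sqrt a b : 0 <= a -> (a < Num.sqrt b) = (a ^+ 2 < b).
Proof.
move=> a0; have [b0|b0] := ltP 0 b.
  by rewrite -[a in LHS]ger0_norm// -sqrtr_sqr ltr_sqrt.
by rewrite ler0_sqrtr// ltNge a0; apply/esym; rewrite ltNge (le_trans b0)// sqr_ge0.
Qed.

Let enorm_axis (z : R * R) : z.1 ^+ 2 + z.2 ^+ 2 = 1 -> enorm z = 1.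
Proof. by rewrite /enorm /dot -!expr2 => ->; rewrite sqrtr1. Qed.

Let roof_smooth : smooth_on R [set x | flank x < 1] (fun x => Num.sqrt (1 - flank x)).
Proof.
apply: (smooth_on_comp _ _ [set x | 0 < x]); [|exact: smooth_on_sqrt|].
  by move=> x /=; rewrite subr_gt0.
apply: smooth_on_add; first exact: smooth_on_cst.
by apply: smooth_on_opp; exact: flank_smooth.
Qed.

Let roof_open : open [set x | flank x < 1].
Proof.
apply: (@open_comp _ _ flank [set t : R | t < 1]); last exact: open_lt.
by move=> x _; exact: flank_continuous.
Qed.

(** The right boundary as a graph over y: 2 plus the inverse of [cap] at 1 - (y - 1)^2. *)
Let side y : R := 2 + (2 - ln (1 - (y - 1) ^+ 2))^-1.
Let side_dom : set R := [set y | (y - 1) ^+ 2 < 1].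

Let side_dom_open : open side_dom.
Proof.
apply: (@open_comp _ _ (fun y : R => (y - 1) ^+ 2) [set t : R | t < 1]); last exact: open_lt.
move=> y _; apply: (is_derive_continuous _ _ _ (2 * (y - 1))); derive; ring.
Qed.

Let side_smooth : smooth_on R side_dom side.
Proof.
have D : smooth_on R side_dom (fun y => 1 - (y - 1) ^+ 2).
  apply: smooth_on_add; first exact: smooth_on_cst.
  apply: smooth_on_opp; apply: smooth_on_mul;
    by apply: smooth_on_add; [exact: smooth_on_id|exact: smooth_on_cst].
apply: smooth_on_add; first exact: smooth_on_cst.
apply: (smooth_on_comp _ _ [set x | x != 0]); [|exact: smooth_on_inv|].
  move=> y /= yd; rewrite gt_eqF//.
  by have : ln (1 - (y - 1) ^+ 2) <= 0 by [rewrite ln_le0// gerBl sqr_ge0]; lra.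
apply: smooth_on_add; first exact: smooth_on_cst.
apply: smooth_on_opp; apply: (smooth_on_comp _ _ [set x | 0 < x]) => //.
  by move=> y /=; rewrite subr_gt0.
exact: smooth_on_ln.
Qed.

Let stadium_side z : 2 < `|z.1| -> (z.2 - 1) ^+ 2 < 1 -> stadium z <-> `|z.1| < side z.2.
Proof.
move=> z1 z2; rewrite /stadium /profile/= -flank_norm flank_right; last by lra.
rewrite -ltrBrDr cap_lt_expR ?subr_gt0//; last by rewrite z2 gerBl sqr_ge0.
by rewrite /side ltrBlDl.
Qed.

(** Below and above the line y = 1 the boundary is a graph over x, given by a square root that stays
    away from its zero. On that line the root is singular because [flank] equals 1, and the graph
    over y given by [side] takes over. *)
Lemma stadium_smooth : smooth_boundary stadium.
Proof.
move=> p /stadium_boundary pE; have k0 := flank_ge0 p.1; have s0 := sqr_ge0 (p.2 - 1).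
have [p2|p2|p2] := ltgtP p.2 1.
- have k1 : flank p.1 < 1.
    have : 0 < (p.2 - 1) ^+ 2 by rewrite exprn_even_gt0//= subr_eq0 lt_eqF.
    by rewrite /profile in pE; lra.
  apply: (smooth_chart _ _ (1, 0) _ (fun x => 1 + - Num.sqrt (1 - flank x)) (1 - p.2) _ roof_open).
  + by apply: enorm_axis => /=; ring.
  + by rewrite /dot /= mul1r mul0r addr0.
  + by apply: smooth_on_add; [exact: smooth_on_cst|exact: smooth_on_opp].
  + by rewrite subr_gt0.
  move=> z /(le_lt_trans (snd_le_enorm _ _)) /=; rewrite ltr_norml => /andP[_ z2].
  rewrite /dot /perp /= !(mul1r, mul0r, oppr0, add0r, addr0) ltrBlDr -ltrBlDl.
  rewrite lt_sqrt; last by lra.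
  by rewrite /stadium /profile /= -sqrrN opprB -ltrBrDl.
- have k1 : flank p.1 < 1.
    have : 0 < (p.2 - 1) ^+ 2 by rewrite exprn_even_gt0//= subr_eq0 gt_eqF.
    by rewrite /profile in pE; lra.
  apply: (smooth_chart _ _ (-1, 0) _ (fun x => - 1 + - Num.sqrt (1 - flank x)) (p.2 - 1) _ roof_open).
  + by apply: enorm_axis => /=; ring.
  + by rewrite /dot /= mul0r addr0 mulN1r flankN.
  + by apply: smooth_on_add; [exact: smooth_on_cst|exact: smooth_on_opp].
  + by rewrite subr_gt0.
  move=> z /(le_lt_trans (snd_le_enorm _ _)) /=; rewrite ltr_norml => /andP[z2 _].
  rewrite /dot /perp /= !(mulN1r, mul1r, mul0r, oppr0, add0r, addr0) flankN.
  rewrite -opprD ltrN2 addrC -ltrBlDr lt_sqrt; last by lra.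
  by rewrite /stadium /profile /= -ltrBrDl.
have p1 : 2 < `|p.1|.
  by rewrite ltNge; apply/negP => /flank0 k; move: pE; rewrite /profile k p2; lra.
have near z : enorm (z - p) < Num.min (`|p.1| - 2) 1 ->
    [/\ `|z.1 - p.1| < `|p.1| - 2, 2 < `|z.1| & (z.2 - 1) ^+ 2 < 1].
  rewrite lt_min => /andP[/(le_lt_trans (fst_le_enorm _ _)) /= h1].
  move=> /(le_lt_trans (snd_le_enorm _ _)) /=; rewrite p2 => h2; split => //.
    by have := ler_distD z.1 p.1 0; rewrite !subr0 distrC; lra.
  by rewrite -real_normK ?num_real// expr_lt1.
have [x0|x0] := leP 0 p.1.
  apply: (smooth_chart _ _ (0, 1) _ (fun y => - side y) (Num.min (`|p.1| - 2) 1) _ side_dom_open).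
  + by apply: enorm_axis => /=; ring.
  + by rewrite /dot /side_dom /= mul1r mul0r add0r p2 subrr expr0n.
  + exact: smooth_on_opp.
  + by rewrite lt_min subr_gt0 p1 ltr01.
  move=> z /near[h1 h2 h3]; rewrite stadium_side//.
  rewrite /dot /perp /= !(mulN1r, mul1r, mul0r, oppr0, add0r, addr0) ltrN2.
  rewrite ger0_norm//; move: h1; rewrite (ger0_norm x0) ltr_norml => /andP[? _]; lra.
apply: (smooth_chart _ _ (0, -1) (-%R @^-1` side_dom) (fun y => - side (- y))
   (Num.min (`|p.1| - 2) 1)).
+ by apply: enorm_axis => /=; ring.
+ apply: (@open_comp _ _ (-%R : R -> R)); last exact: side_dom_open.
  by move=> y _; exact: opp_continuous.
+ by rewrite /dot /side_dom /= mulN1r mul0r add0r opprK p2 subrr expr0n.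
+ apply: smooth_on_opp; apply: (smooth_on_comp _ _ side_dom) => //.
  by apply: smooth_on_opp; exact: smooth_on_id.
+ by rewrite lt_min subr_gt0 p1 ltr01.
move=> z /near[h1 h2 h3]; rewrite stadium_side//.
rewrite /dot /perp /= !(mulN1r, mul1r, mul0r, oppr0, add0r, addr0) !opprK ?mul1r.
rewrite ltr0_norm; first by rewrite ltrNl.
by move: h1; rewrite (ltr0_norm x0) ltr_norml => /andP[_ ?]; lra.
Qed.

End Stadium.

Theorem theorem2p1 (R : realType) (eps : R) (eps_gt0 : 0 < eps) :
  exists X Y : set (R * R),
    [/\ bounded_domain X,
        convex_set (X : set (convex_lmodType (R * R)%type)) &
        smooth_boundary X] /\
    [/\ bounded_domain Y,
        area X = area Y,
        small_lipschitz_perturbation eps X Y,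
        exists T : R * R -> R * R, optimal_transport X Y T &
        forall T : R * R -> R * R,
          optimal_transport X Y T -> discontinuous_on X T].
Proof.
(* e = min(1, eps) / 1000: the Lipschitz estimates need 1000 e <= 1, and the perturbation has total
   size at most (80 + 480) e. *)
have [e [e0 e1 eeps]] : exists e : R, [/\ 0 < e, 1000 * e <= 1 & 1000 * e <= eps].
  have k0 : (1000 : R) != 0 by rewrite pnatr_eq0.
  exists (1000^-1 * Num.min 1 eps); split.
  - by apply: mulr_gt0; [rewrite invr_gt0 ltr0n|rewrite lt_min ltr01 eps_gt0].
  - by rewrite mulVKf// ge_min lexx.
  - by rewrite mulVKf// ge_min lexx orbT.
have oX := stadium_open R; have bX := @stadium_bound R; have fX := @stadium_flat R.
exists (stadium R), (perturbed_domain R e (stadium R)); split; split.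
- split; [exact: oX|exact: stadium_connected|exact: stadium_bounded].
- exact: stadium_convex.
- exact: stadium_smooth.
- split.
  + exact: (perturbed_domain_open _ _ e0 e1 _ oX bX).
  + exact: (perturbed_domain_connected _ _ e0 e1 _ (stadium_connected R) bX).
  + exact: (perturbed_domain_bounded _ _ e0 e1 _ bX).
(* A transport map tested on the whole plane gives the equality of areas. *)
- exact: (transport_map_area _ _ _ _ (model_map_transport _ _ e0 e1 _ oX bX fX)).
- exact: (perturbation_small _ _ e0 e1 _ bX).
- by exists (model_map R e); exact: (model_map_optimal _ _ e0 e1 _ oX bX fX).
- move=> T optT; apply: (discontinuous_of_ae_model_map _ _ e0 _ oX fX).
  exact: (model_map_unique _ _ e0 e1 _ oX bX fX).
Qed.
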